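(* Let $M=\left(M_1\times_{(\lambda_1,\lambda_2)}M_2\right)/\Gamma$ be a quotient of a doubly warped product such that $\mathcal{F}_1$ is a regular foliation. Then: (1) The projection $\eta:M\to\mathfrak{L}_1$ onto the space of leaves of $\mathcal{F}_1$ is a fiber bundle. Moreover, for every leaf $F\in\mathfrak{L}_1$ and $x\in F$, $\pi_1(\mathfrak{L}_1,F)=\pi_1(M,x)/\pi_1(F,x)$. (2) There exists an open dense subset $W\subset M$ globally isometric to a doubly warped product.
   Context: All manifolds are smooth, connected and semi-Riemannian. Given semi-Riemannian manifolds $(M_1,g_1),(M_2,g_2)$ and smooth functions $\lambda_1:M_2\to\mathbb{R}^+$, $\lambda_2:M_1\to\mathbb{R}^+$, the doubly warped product $M_1\times_{(\lambda_1,\lambda_2)}M_2$ is $M_1\times M_2$ with the metric $\lambda_1^2g_1+\lambda_2^2g_2$. (In part (2) the factors of the doubly warped product are not required to be connected.) Its first and second canonical foliations have leaves $M_1\times\{b\}$ and $\{a\}\times M_2$ respectively. A quotient of a doubly warped product is $M=(M_1\times_{(\lambda_1,\lambda_2)}M_2)/\Gamma$ with the quotient metric, where $\Gamma$ is a group of isometries which acts properly discontinuously (every point has a neighborhood $U$ with $f(U)\cap U=\emptyset$ for all $f\in\Gamma\setminus\{\mathrm{id}\}$, and points in different orbits have neighborhoods with disjoint orbits) and preserves both canonical foliations, so that each $f\in\Gamma$ is of the form $f=\phi\times\psi$. The images of the canonical foliations are foliations $\mathcal{F}_1,\mathcal{F}_2$ of $M$. A point $x$ is regular for a foliation if there is a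 chart adapted to the foliation with domain $U\ni x$ such that each leaf meeting $U$ intersects $U$ in a unique slice; the foliation is regular if all points are regular. In that case the space of leaves $\mathfrak{L}_1$ of $\mathcal{F}_1$ (quotient topology) is a smooth manifold except possibly for the Hausdorff property, and the canonical projection $\eta:M\to\mathfrak{L}_1$ is open. The group $\pi_1(F,x)$ is regarded as a (normal) subgroup of $\pi_1(M,x)$ via the homomorphism induced by inclusion. *)

(* Defs.v *)
From HB Require Import structures.
From mathcomp Require Import all_boot all_order all_algebra generic_quotient.
From mathcomp Require Import ring lra.
From mathcomp Require Import all_classical all_reals all_analysis.
Set Implicit Arguments.
Unset Strict Implicit.
Unset Printing Implicit Defensive.
Import Order.TTheory GRing.Theory Num.Theory.
Import numFieldNormedType.Exports.
Local Open Scope classical_set_scope.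
Local Open Scope ring_scope.
Local Open Scope quotient_scope.

Section quotient_group.
Variable G : groupType.

Record normal_subgroup := NormalSubgroup {
  normal_set :> set G ;
  normal1 : normal_set 1%g ;
  normalM : forall a b, normal_set a -> normal_set b -> normal_set (a * b)%g ;
  normalV : forall a, normal_set a -> normal_set a^-1%g ;
  normalJ : forall a b, normal_set a -> normal_set (b^-1 * a * b)%g }.

Variable N : normal_subgroup.

Definition coset_rel : rel G := [rel a b | `[< normal_set N (a^-1 * b)%g >]].

Lemma coset_rel_refl : reflexive coset_rel.
Proof. by move=> a; apply/asboolP; rewrite mulVg; exact: normal1. Qed.

Lemma coset_rel_sym : symmetric coset_rel.
Proof.
move=> a b; apply/idP/idP => /asboolP/normalV; rewrite invgM invgK => ?;
  exact/asboolP.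
Qed.

Lemma coset_rel_trans : transitive coset_rel.
Proof.
move=> b a c /asboolP ab /asboolP bc; apply/asboolP.
by have := normalM ab bc; rewrite -mulgA mulVKg.
Qed.

Canonical coset_equiv :=
  EquivRel coset_rel coset_rel_refl coset_rel_sym coset_rel_trans.

Definition quotient_group := {eq_quot coset_equiv}.
HB.instance Definition _ := Choice.on quotient_group.
HB.instance Definition _ := EqQuotient.on quotient_group.

Definition quotient_mul (a b : quotient_group) : quotient_group :=
  \pi_quotient_group (repr a * repr b)%g.
Definition quotient_inv (a : quotient_group) : quotient_group :=
  \pi_quotient_group ((repr a)^-1)%g.

Lemma pi_cosetP (a b : G) :
  \pi_quotient_group a = \pi_quotient_group b <-> normal_set N (a^-1 * b)%g.
Proof.
split=> [/eqP|h]; first by rewrite eqmodE => /asboolP.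
by apply/eqP; rewrite eqmodE; apply/asboolP.
Qed.

Lemma repr_cosetP (a : G) : normal_set N (a^-1 * repr (\pi_quotient_group a))%g.
Proof. by apply/pi_cosetP; rewrite reprK. Qed.

Lemma quotient_mul_pi (a b : G) :
  quotient_mul (\pi_quotient_group a) (\pi_quotient_group b)
  = \pi_quotient_group (a * b)%g.
Proof.
apply/esym/pi_cosetP; have ha := repr_cosetP a; have hb := repr_cosetP b.
have := normalM (normalJ b ha) hb.
by rewrite invgM !mulgA; congr (normal_set N _); rewrite mulgK.
Qed.

Lemma quotient_inv_pi (a : G) :
  quotient_inv (\pi_quotient_group a) = \pi_quotient_group a^-1%g.
Proof.
apply/esym/pi_cosetP; rewrite invgK; have ha := normalV (repr_cosetP a).
by have := normalJ a^-1%g ha; rewrite !invgM !invgK mulgA mulgK.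
Qed.

Lemma pi_surj (q : quotient_group) : exists a, q = \pi_quotient_group a.
Proof. by exists (repr q); rewrite reprK. Qed.

Lemma quotient_mulA : associative quotient_mul.
Proof.
move=> a b c; have [a' ->] := pi_surj a; have [b' ->] := pi_surj b.
by have [c' ->] := pi_surj c; rewrite !quotient_mul_pi mulgA.
Qed.

Lemma quotient_mul1 : left_id (\pi_quotient_group 1%g) quotient_mul.
Proof. by move=> a; have [a' ->] := pi_surj a; rewrite quotient_mul_pi mul1g. Qed.

Lemma quotient_1mul : right_id (\pi_quotient_group 1%g) quotient_mul.
Proof. by move=> a; have [a' ->] := pi_surj a; rewrite quotient_mul_pi mulg1. Qed.

Lemma quotient_mulV :
  left_inverse (\pi_quotient_group 1%g) quotient_inv quotient_mul.
Proof. by move=> a; have [a' ->] := pi_surj a; rewrite quotient_inv_pi quotient_mul_pi mulVg. Qed.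

Lemma quotient_Vmul :
  right_inverse (\pi_quotient_group 1%g) quotient_inv quotient_mul.
Proof. by move=> a; have [a' ->] := pi_surj a; rewrite quotient_inv_pi quotient_mul_pi mulgV. Qed.

HB.instance Definition _ := isGroup.Build quotient_group
  quotient_mulA quotient_mul1 quotient_1mul quotient_mulV quotient_Vmul.

End quotient_group.

Section fundamental_group.
Variable R : realType.

Lemma glue_continuous (X T : topologicalType) (p : X -> R) (f g : X -> T) :
  continuous p -> continuous f -> continuous g ->
  (forall z, p z = 0 -> f z = g z) ->
  continuous (fun z => if p z <= 0 then f z else g z).
Proof.
move=> cp cf cg fg.
have cl1 : closed (p @^-1` [set r | r <= 0]).
  by apply: closed_comp; [move=> ? _; exact: cp | exact: closed_le].
have cl2 : closed (p @^-1` [set r | 0 <= r]).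
  by apply: closed_comp; [move=> ? _; exact: cp | exact: closed_ge].
have U : p @^-1` [set r | r <= 0] `|` p @^-1` [set r | 0 <= r] = setT.
  by apply/seteqP; split=> // z _ /=; case: (leP (p z) 0) => [|/ltW]; [left|right].
apply/continuous_subspace_setT; rewrite -U; apply: withinU_continuous => //.
- apply: (@subspace_eq_continuous _ _ _ f); last exact: continuous_subspaceT.
  by move=> z; rewrite inE => h; rewrite /from_subspace ifT.
- apply: (@subspace_eq_continuous _ _ _ g); last exact: continuous_subspaceT.
  move=> z; rewrite inE => h; rewrite /from_subspace; case: ifP => // h'.
  by rewrite fg //; apply/eqP; rewrite eq_le h h'.
Qed.

Section loops.
Variables (T : topologicalType) (x : T).

(* A loop [0, 1] -> T at x is extended to R by the constant value x, and a
   homotopy of loops likewise to R * R; precomposing with the retraction of R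
   onto [0, 1] shows that nothing is changed. *)
Record loop := Loop {
  loop_fun :> R -> T ;
  loop_continuous : continuous loop_fun ;
  loop_base : forall t, t <= 0 \/ 1 <= t -> loop_fun t = x }.

HB.instance Definition _ := gen_eqMixin loop.
HB.instance Definition _ := gen_choiceMixin loop.

Definition loop_homotopy (a b : loop) (H : R * R -> T) :=
  [/\ continuous H, forall t, H (0, t) = a t, forall t, H (1, t) = b t
    & forall s t, t <= 0 \/ 1 <= t -> H (s, t) = x].

Definition loop_homotopic : rel loop :=
  [rel a b | `[< exists H, loop_homotopy a b H >]].

Lemma loop_homotopicP (a b : loop) :
  reflect (exists H, loop_homotopy a b H) (loop_homotopic a b).
Proof. exact: asboolP. Qed.

Lemma cont_fst (f : R -> R) : continuous f ->
  continuous (fun z : R * R => f z.1).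
Proof. by move=> cf z; apply: continuous_comp; [exact: cvg_fst|exact: cf]. Qed.

Lemma cont_snd (f : R -> R) : continuous f ->
  continuous (fun z : R * R => f z.2).
Proof. by move=> cf z; apply: continuous_comp; [exact: cvg_snd|exact: cf]. Qed.

Lemma cont_pair (p : R -> R) (H : R * R -> T) : continuous p -> continuous H ->
  continuous (fun z : R * R => H (p z.1, z.2)).
Proof.
move=> cp cH.
have cq : continuous (fun z : R * R => (p z.1, z.2)).
  move=> z; have h1 := @cont_fst p cp z.
  have h2 : (fun w : R * R => w.2) @ z --> z.2 by exact: cvg_snd.
  exact: (cvg_pair h1 h2).
by move=> z; apply: continuous_comp; [exact: cq|exact: cH].
Qed.

Lemma cont_aff (u v : R) : continuous (fun t : R => u * t + v).
Proof.
move=> t; apply: (@continuousD R R R (fun t => u * t) (fun=> v)).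
  by apply: (@continuousM R R (fun=> u) idfun);
    [exact: cst_continuous | exact: cvg_id].
exact: cst_continuous.
Qed.

Lemma cont_pair2 (u v : R) (H : R * R -> T) : continuous H ->
  continuous (fun z : R * R => H (z.1, u * z.2 + v)).
Proof.
move=> cH.
have cq : continuous (fun z : R * R => (z.1, u * z.2 + v)).
  move=> z; have h1 := @cont_snd _ (@cont_aff u v) z.
  have h2 : (fun w : R * R => w.1) @ z --> z.1 by exact: cvg_fst.
  exact: (cvg_pair h2 h1).
by move=> z; apply: continuous_comp; [exact: cq|exact: cH].
Qed.

Lemma loop_homotopic_refl : reflexive loop_homotopic.
Proof.
move=> a; apply/loop_homotopicP; exists (fun z => a z.2); split=> //.
- move=> z; apply: continuous_comp; [exact: cvg_snd|exact: loop_continuous].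
- by move=> s t /loop_base.
Qed.

Lemma loop_homotopic_sym : symmetric loop_homotopic.
Proof.
suff h a b : loop_homotopic a b -> loop_homotopic b a.
  by move=> a b; apply/idP/idP; exact: h.
move=> /loop_homotopicP [H [cH H0 H1 Hx]]; apply/loop_homotopicP.
exists (fun z => H (-1 * z.1 + 1, z.2)); split=> //=.
- exact: (cont_pair (@cont_aff (-1) (1)) cH).
- by move=> t; rewrite mulr0 add0r.
- by move=> t; rewrite mulr1 addNr.
- by move=> s t /Hx.
Qed.

Lemma loop_homotopic_trans : transitive loop_homotopic.
Proof.
move=> b a c /loop_homotopicP [H [cH H0 H1 Hx]] /loop_homotopicP [K [cK K0 K1 Kx]].
apply/loop_homotopicP.
exists (fun z => if 2 * z.1 + -1 <= 0 then H (2 * z.1 + 0, z.2)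
                 else K (2 * z.1 + -1, z.2)); split.
- apply: glue_continuous.
  + exact: cont_fst (@cont_aff 2 (-1)).
  + exact: (cont_pair (@cont_aff (2) (0)) cH).
  + exact: (cont_pair (@cont_aff (2) (-1)) cK).
  + move=> z e; have -> : 2 * z.1 + 0 = 1.
      by apply/eqP; rewrite addr0 -subr_eq0 e.
    by rewrite e H1 K0.
- by move=> t /=; rewrite mulr0 !add0r lerN10 H0.
- move=> t /=; rewrite mulr1; have -> : (2 + -1 : R) = 1.
    by rewrite -[2]/(1 + 1) addrK.
  by rewrite ler10 K1.
- by move=> s t h /=; case: ifP => _; [rewrite Hx | rewrite Kx].
Qed.

Canonical loop_homotopic_equiv := EquivRel loop_homotopic
  loop_homotopic_refl loop_homotopic_sym loop_homotopic_trans.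

Lemma cont_min (f g : R -> R) : continuous f -> continuous g ->
  continuous (fun t => Num.min (f t) (g t)).
Proof. by move=> cf cg t; exact: (@continuous_min R R f g t (cf t) (cg t)). Qed.

Lemma cont_max (f g : R -> R) : continuous f -> continuous g ->
  continuous (fun t => Num.max (f t) (g t)).
Proof. by move=> cf cg t; exact: (@continuous_max R R f g t (cf t) (cg t)). Qed.

Lemma reparametrization_homotopic (a b c : loop) (p q : R -> R) :
  continuous p -> continuous q ->
  (forall t, t <= 0 \/ 1 <= t ->
     (p t <= 0 /\ q t <= 0) \/ (1 <= p t /\ 1 <= q t)) ->
  b =1 a \o p -> c =1 a \o q -> loop_homotopic b c.
Proof.
move=> cp cq pq bE cE; apply/loop_homotopicP.
pose k (s : R) := Num.max 0 (Num.min 1 s).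
have ck : continuous k.
  apply: (@cont_max (cst 0) (fun s => Num.min 1 s)); first exact: cst_continuous.
  apply: (@cont_min (cst 1) idfun); first exact: cst_continuous.
  by move=> s; exact: cvg_id.
have k0 s : 0 <= k s by rewrite /k le_max lexx.
have k1 s : k s <= 1 by rewrite /k ge_max ler01 ge_min lexx.
exists (fun z => a ((1 - k z.1) * p z.2 + k z.1 * q z.2)); split=> /=.
- have c1 : continuous (fun z : R * R => k z.1) by apply: cont_fst.
  have c2 := @cont_snd p cp; have c3 := @cont_snd q cq.
  pose r (z : R * R) := (1 - k z.1) * p z.2 + k z.1 * q z.2.
  have cr : continuous r.
    move=> z; apply: (@continuousD R R _ (fun z : R * R => (1 - k z.1) * p z.2)
                                         (fun z : R * R => k z.1 * q z.2)).
      apply: (@continuousM R _ (fun z : R * R => 1 - k z.1)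
                               (fun z : R * R => p z.2)); last exact: c2.
      apply: (@continuousB R R _ (fun=> 1) (fun z : R * R => k z.1)).
        exact: cst_continuous.
      exact: c1.
    by apply: (@continuousM R _ (fun z : R * R => k z.1) (fun z : R * R => q z.2));
      [exact: c1|exact: c3].
  by move=> z; apply: (@continuous_comp _ _ _ r a); [exact: cr|exact: loop_continuous].
- move=> t; have -> : k 0 = 0 by rewrite /k (min_idPr ler01) maxxx.
  by rewrite bE subr0 mul1r mul0r addr0.
- move=> t; have -> : k 1 = 1 by rewrite /k minxx (max_idPr ler01).
  by rewrite cE subrr mul0r mul1r add0r.
- move=> s t /pq h; apply: loop_base; have := k0 s; have := k1 s.
  by case: h => -[]; [left|right]; nra.
Qed.

Lemma loop_affine_continuous (a : loop) (u v : R) :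
  continuous (fun t => a (u * t + v)).
Proof.
by move=> t; apply: (@continuous_comp _ _ _ (fun t => u * t + v) a);
  [exact: cont_aff|exact: loop_continuous].
Qed.

Program Definition loop_mul (a b : loop) : loop :=
  @Loop (fun t => if 2 * t + -1 <= 0 then a (2 * t + 0) else b (2 * t + -1)) _ _.
Next Obligation.
move=> a b; apply: glue_continuous; first exact: cont_aff.
- exact: loop_affine_continuous.
- exact: loop_affine_continuous.
- by move=> t h; rewrite !loop_base //; [left|right]; lra.
Qed.
Next Obligation.
move=> a b t /= h.
by case: ifP => ?; apply: loop_base; case: h => ?; [left|right|left|right]; lra.
Qed.

Program Definition loop_inv (a : loop) : loop :=
  @Loop (fun t => a (-1 * t + 1)) _ _.
Next Obligation.
by move=> a; exact: loop_affine_continuous.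
Qed.
Next Obligation.
by move=> a t h; apply: loop_base; case: h => ?; [right|left]; lra.
Qed.

Program Definition loop_one : loop := @Loop (fun=> x) _ _.
Next Obligation. exact: cst_continuous. Qed.
Next Obligation. by []. Qed.

Lemma loop_mul_homotopic (a a' b b' : loop) :
  loop_homotopic a a' -> loop_homotopic b b' ->
  loop_homotopic (loop_mul a b) (loop_mul a' b').
Proof.
move=> /loop_homotopicP [H [cH H0 H1 Hx]] /loop_homotopicP [K [cK K0 K1 Kx]].
apply/loop_homotopicP.
exists (fun z => if 2 * z.2 + -1 <= 0 then H (z.1, 2 * z.2 + 0)
                 else K (z.1, 2 * z.2 + -1)).
split=> /=.
- apply: glue_continuous.
  + exact: (@cont_snd _ (@cont_aff 2 (-1))).
  + exact: cont_pair2.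
  + exact: cont_pair2.
  + by move=> z h; rewrite Hx ?Kx //; [left|right]; lra.
- by move=> t; rewrite H0 K0.
- by move=> t; rewrite H1 K1.
- by move=> s t h; case: ifP => ?; [apply: Hx|apply: Kx];
    case: h => ?; [left|right|left|right]; lra.
Qed.

Lemma loop_inv_homotopic (a a' : loop) :
  loop_homotopic a a' -> loop_homotopic (loop_inv a) (loop_inv a').
Proof.
move=> /loop_homotopicP [H [cH H0 H1 Hx]]; apply/loop_homotopicP.
exists (fun z => H (z.1, -1 * z.2 + 1)); split=> /=.
- exact: cont_pair2.
- by move=> t; rewrite H0.
- by move=> t; rewrite H1.
- by move=> s t h; apply: Hx; case: h => ?; [right|left]; lra.
Qed.

Lemma loop_mulA (a b c : loop) :
  loop_homotopic (loop_mul a (loop_mul b c)) (loop_mul (loop_mul a b) c).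
Proof.
pose p (t : R) := Num.min (2 * t + 0) (Num.min (1 * t + 4^-1) (2^-1 * t + 2^-1)).
have pE t : p t = if t <= 4^-1 then 2 * t else
                  if t <= 2^-1 then t + 4^-1 else 2^-1 * t + 2^-1.
  rewrite /p; case: (leP t 4^-1) => h1; last case: (leP t 2^-1) => h2.
  - rewrite min_l; first by lra.
    by rewrite le_min; apply/andP; split; lra.
  - rewrite (@min_l _ _ (1 * t + 4^-1)); last by lra.
    by rewrite min_r; lra.
  - rewrite (@min_r _ _ (1 * t + 4^-1)); last by lra.
    by rewrite min_r; lra.
apply: (@reparametrization_homotopic (loop_mul a (loop_mul b c)) _ _ (fun t => 1 * t + 0) p).
- exact: cont_aff.
- by apply: cont_min; [|apply: cont_min]; exact: cont_aff.
- move=> t h; rewrite pE.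
  case: h => h; [left|right]; (split; first by lra);
    case: (leP t 4^-1) => ?; by [lra|case: (leP t 2^-1) => ?; lra].
- by move=> t; rewrite /comp mul1r addr0.
- move=> t /=; rewrite pE.
  case: (leP t 4^-1) => h1.
    rewrite ifT; last by lra.
    rewrite ifT; last by lra.
    rewrite ifT; last by lra.
    by congr (loop_fun a _); lra.
  case: (leP t 2^-1) => h2.
    rewrite ifT; last by lra.
    rewrite ifF; last by apply/negbTE; rewrite -ltNge; lra.
    rewrite ifF; last by apply/negbTE; rewrite -ltNge; lra.
    rewrite ifT; last by lra.
    by congr (loop_fun b _); lra.
  rewrite ifF; last by apply/negbTE; rewrite -ltNge; lra.
  rewrite ifF; last by apply/negbTE; rewrite -ltNge; lra.
  rewrite ifF; last by apply/negbTE; rewrite -ltNge; lra.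
  by congr (loop_fun c _); lra.
Qed.

Lemma loop_mul1 (a : loop) : loop_homotopic (loop_mul loop_one a) a.
Proof.
apply: (@reparametrization_homotopic a _ _ (fun t => 2 * t + -1) (fun t => 1 * t + 0)).
- exact: cont_aff.
- exact: cont_aff.
- by move=> t [h|h]; [left|right]; split; lra.
- by move=> t /=; case: ifP => h //; rewrite loop_base //; left.
- by move=> t; rewrite /comp mul1r addr0.
Qed.

Lemma loop_1mul (a : loop) : loop_homotopic (loop_mul a loop_one) a.
Proof.
apply: (@reparametrization_homotopic a _ _ (fun t => 2 * t + 0) (fun t => 1 * t + 0)).
- exact: cont_aff.
- exact: cont_aff.
- by move=> t [h|h]; [left|right]; split; lra.
- by move=> t /=; case: leP => h //; rewrite loop_base //; right; lra.
- by move=> t; rewrite /comp mul1r addr0.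
Qed.

Lemma loop_mulV (a : loop) : loop_homotopic (loop_mul (loop_inv a) a) loop_one.
Proof.
apply: (@reparametrization_homotopic a _ _
  (fun t => Num.max (-2 * t + 1) (2 * t + -1)) (fun=> 1)).
- by apply: cont_max; exact: cont_aff.
- exact: cst_continuous.
- by move=> t [h|h]; right; split=> //; rewrite le_max; apply/orP; [left|right]; lra.
- move=> t /=; case: leP => h; congr (loop_fun a _).
    by rewrite max_l; lra.
  by rewrite max_r; lra.
- by move=> t /=; rewrite loop_base //; right.
Qed.

Lemma loop_Vmul (a : loop) : loop_homotopic (loop_mul a (loop_inv a)) loop_one.
Proof.
apply: (@reparametrization_homotopic a _ _
  (fun t => Num.min (2 * t + 0) (-2 * t + 2)) (fun=> 0)).
- by apply: cont_min; exact: cont_aff.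
- exact: cst_continuous.
- by move=> t [h|h]; left; split=> //; rewrite ge_min; apply/orP; [left|right]; lra.
- move=> t /=; case: leP => h; congr (loop_fun a _).
    by rewrite min_l; lra.
  by rewrite min_r; lra.
- by move=> t /=; rewrite loop_base //; left.
Qed.

Definition fundamental_group := {eq_quot loop_homotopic_equiv}.
HB.instance Definition _ := Choice.on fundamental_group.
HB.instance Definition _ := EqQuotient.on fundamental_group.

Lemma pi_loopP (a b : loop) :
  \pi_fundamental_group a = \pi_fundamental_group b <-> loop_homotopic a b.
Proof.
split=> [/eqP|h]; first by rewrite eqmodE.
by apply/eqP; rewrite eqmodE.
Qed.

Lemma repr_loopP (a : loop) : loop_homotopic (repr (\pi_fundamental_group a)) a.
Proof. by apply/pi_loopP; rewrite reprK. Qed.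

Definition pi1_mul (u v : fundamental_group) : fundamental_group :=
  \pi_fundamental_group (loop_mul (repr u) (repr v)).
Definition pi1_inv (u : fundamental_group) : fundamental_group :=
  \pi_fundamental_group (loop_inv (repr u)).

Lemma pi1_mul_pi (a b : loop) :
  pi1_mul (\pi_fundamental_group a) (\pi_fundamental_group b)
  = \pi_fundamental_group (loop_mul a b).
Proof. by apply/pi_loopP/loop_mul_homotopic; exact: repr_loopP. Qed.

Lemma pi1_inv_pi (a : loop) :
  pi1_inv (\pi_fundamental_group a) = \pi_fundamental_group (loop_inv a).
Proof. by apply/pi_loopP/loop_inv_homotopic; exact: repr_loopP. Qed.

Lemma pi1_surj (u : fundamental_group) : exists a, u = \pi_fundamental_group a.
Proof. by exists (repr u); rewrite reprK. Qed.

Lemma pi1_mulA : associative pi1_mul.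
Proof.
move=> u v w; have [a ->] := pi1_surj u; have [b ->] := pi1_surj v.
have [c ->] := pi1_surj w; rewrite !pi1_mul_pi; exact/pi_loopP/loop_mulA.
Qed.

Lemma pi1_mul1 : left_id (\pi_fundamental_group loop_one) pi1_mul.
Proof.
by move=> u; have [a ->] := pi1_surj u; rewrite pi1_mul_pi; exact/pi_loopP/loop_mul1.
Qed.

Lemma pi1_1mul : right_id (\pi_fundamental_group loop_one) pi1_mul.
Proof.
by move=> u; have [a ->] := pi1_surj u; rewrite pi1_mul_pi; exact/pi_loopP/loop_1mul.
Qed.

Lemma pi1_mulV : left_inverse (\pi_fundamental_group loop_one) pi1_inv pi1_mul.
Proof.
move=> u; have [a ->] := pi1_surj u; rewrite pi1_inv_pi pi1_mul_pi.
exact/pi_loopP/loop_mulV.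
Qed.

Lemma pi1_Vmul : right_inverse (\pi_fundamental_group loop_one) pi1_inv pi1_mul.
Proof.
move=> u; have [a ->] := pi1_surj u; rewrite pi1_inv_pi pi1_mul_pi.
exact/pi_loopP/loop_Vmul.
Qed.

HB.instance Definition _ := isGroup.Build fundamental_group
  pi1_mulA pi1_mul1 pi1_1mul pi1_mulV pi1_Vmul.

End loops.

Section induced_map.
Variables (T U : topologicalType) (f : T -> U).
Hypothesis cf : continuous f.
Variable x : T.

Program Definition loop_map (a : loop x) : loop (f x) :=
  @Loop _ _ (fun t => f (a t)) _ _.
Next Obligation.
move=> a t; apply: continuous_comp; [exact: loop_continuous|exact: cf].
Qed.
Next Obligation. by move=> a t h; congr f; exact: loop_base. Qed.

Definition pi1_map (u : fundamental_group x) : fundamental_group (f x) :=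
  \pi_(fundamental_group (f x)) (loop_map (repr u)).

End induced_map.

End fundamental_group.

Arguments pi1_map {R T U f} cf x u.

Section smooth_manifolds.
Variable R : realType.

(* f is of class C^oo on the open set U: all its iterated directional
   derivatives exist and are (Frechet) differentiable at the points of U. *)
Definition smooth_on (V W : normedModType R) (U : set V) (f : V -> W) :=
  forall (vs : seq V) x, U x ->
    differentiable (foldr (fun v h => 'D_v h) f vs) x.

Record chart n (X : topologicalType) := Chart {
  chart_dom : set X ;
  chart_map : X -> 'rV[R]_n ;
  chart_inv : 'rV[R]_n -> X }.

Definition chart_im n (X : topologicalType) (c : chart n X) : set 'rV[R]_n :=
  chart_map c @` chart_dom c.

Definition is_chart n (X : topologicalType) (c : chart n X) :=
  [/\ open (chart_dom c), open (chart_im c),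
      {in chart_dom c, cancel (chart_map c) (chart_inv c)},
      {in chart_dom c, continuous (chart_map c)}
    & {in chart_im c, continuous (chart_inv c)}].

Definition smooth_transition n (X : topologicalType) (c d : chart n X) :=
  smooth_on (chart_map c @` (chart_dom c `&` chart_dom d))
            (chart_map d \o chart_inv c).

Record charted n := Charted {
  charted_space :> topologicalType ;
  chart_index : Type ;
  atlas : chart_index -> chart n charted_space }.

Definition dom n (X : charted n) (i : chart_index X) := chart_dom (atlas i).
Definition coords n (X : charted n) (i : chart_index X) := chart_map (atlas i).
Definition param n (X : charted n) (i : chart_index X) := chart_inv (atlas i).

Definition smooth_manifold n (X : charted n) :=
  [/\ forall x : X, exists i, dom i x,
      forall i : chart_index X, is_chart (atlas i),
      forall i j : chart_index X, smooth_transition (atlas i) (atlas j)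
    & @second_countable X].

Definition hausdorff_manifold n (X : charted n) :=
  smooth_manifold X /\ hausdorff_space X.

Definition connected_manifold n (X : charted n) :=
  [/\ hausdorff_manifold X, connected [set: X] & [set: X] !=set0].

Definition prod_chart n m (X Y : topologicalType)
    (c : chart n X) (d : chart m Y) : chart (n + m) (X * Y)%type :=
  {| chart_dom := chart_dom c `*` chart_dom d ;
     chart_map := fun z => row_mx (chart_map c z.1) (chart_map d z.2) ;
     chart_inv := fun v => (chart_inv c (lsubmx v), chart_inv d (rsubmx v)) |}.

Definition prod_charted n m (X : charted n) (Y : charted m) : charted (n + m) :=
  {| charted_space := (X * Y)%type ;
     chart_index := (chart_index X * chart_index Y)%type ;
     atlas := fun ij => prod_chart (atlas ij.1) (atlas ij.2) |}.

Section maps.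
Variables (n m : nat) (X : charted n) (Y : charted m).

Definition local_expr (i : chart_index X) (j : chart_index Y) (f : X -> Y) :=
  coords j \o f \o param i.

Definition smooth_map (U : set X) (f : X -> Y) :=
  {in U, continuous f} /\
  forall i j, smooth_on (coords i @` (U `&` dom i `&` f @^-1` dom j))
                        (local_expr i j f).

End maps.

Definition diffeomorphism n m (X : charted n) (Y : charted m)
    (U : set X) (V : set Y) (f : X -> Y) :=
  exists h : Y -> X,
    [/\ f @` U `<=` V, h @` V `<=` U,
        {in U, cancel f h} /\ {in V, cancel h f},
        smooth_map U f & smooth_map V h].

Definition smooth_function n (X : charted n) (f : X -> R) :=
  forall i : chart_index X,
    smooth_on (chart_im (atlas i)) (f \o param i : 'rV[R]_n -> R^o).

(* Local triviality with typical fiber N. *)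
Definition fiber_bundle n m (E : charted n) (B : charted m) (pr : E -> B) :=
  exists k (N : charted k), hausdorff_manifold N /\
    forall b : B, exists U, [/\ open U, U b &
      exists2 f : E -> prod_charted B N,
        diffeomorphism (Y := prod_charted B N) (pr @^-1` U) (U `*` setT) f &
        forall x, U (pr x) -> (f x).1 = pr x].

End smooth_manifolds.

Section semi_riemannian.
Variable R : realType.

(* metric_field assigns to a point its Gram matrix in each chart. *)
Definition metric_field n (X : charted R n) := chart_index X -> X -> 'M[R]_n.

(* 'J is the Jacobian matrix acting on the right on row vectors, so that the
   pullback of a Gram matrix G is 'J *m G *m 'J^T. *)
Definition preserves_metric n m (X : charted R n) (Y : charted R m)
    (gX : metric_field X) (gY : metric_field Y) (U : set X) (f : X -> Y) :=
  forall i j x, U x -> dom i x -> dom j (f x) ->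
    let J := 'J (local_expr i j f) (coords i x) in
    gX i x = J *m gY j (f x) *m J^T.

(* The index of g is not required to be constant explicitly: this is automatic
   on connected manifolds, and for the factors of a doubly warped product
   isometric to an open subset of a connected manifold. *)
Definition metric_tensor n (X : charted R n) (g : metric_field X) :=
  [/\ forall i x, dom i x -> (g i x)^T = g i x /\ g i x \in unitmx,
      forall i, smooth_on (chart_im (atlas i)) (g i \o param i)
    & preserves_metric g g setT id].

Definition sr_isometry n m (X : charted R n) (gX : metric_field X) (U : set X)
    (Y : charted R m) (gY : metric_field Y) (V : set Y) (f : X -> Y) :=
  diffeomorphism U V f /\ preserves_metric gX gY U f.

Definition positive_smooth n (X : charted R n) (f : X -> R) :=
  (forall x, 0 < f x) /\ smooth_function f.

Definition doubly_warped n m (X : charted R n) (Y : charted R m)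
    (gX : metric_field X) (gY : metric_field Y) (l1 : Y -> R) (l2 : X -> R) :
    metric_field (prod_charted X Y) :=
  fun ij z => block_mx (l1 z.2 ^+ 2 *: gX ij.1 z.1) 0
                       0 (l2 z.1 ^+ 2 *: gY ij.2 z.2).

Definition isometry_group n (X : charted R n) (g : metric_field X)
    (G : set (X -> X)) :=
  [/\ G id, forall f h, G f -> G h -> G (f \o h),
      forall f, G f -> exists h, [/\ G h, cancel f h & cancel h f]
    & forall f, G f -> sr_isometry g setT g setT f].

Definition properly_discontinuous (X : topologicalType) (G : set (X -> X)) :=
  (forall x, exists U, [/\ open U, U x &
     forall f, G f -> f <> id -> f @` U `&` U = set0]) /\
  (forall x y, ~ (exists2 f, G f & f x = y) ->
     exists U V, [/\ open U, open V, U x, V y &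
       forall f h, G f -> G h -> f @` U `&` h @` V = set0]).

(* q exhibits M, with the metric gM, as the quotient of X by G: its fibers are
   the orbits and it is a local isometry. *)
Definition quotient_map n (X : charted R n) (gX : metric_field X)
    (G : set (X -> X)) (M : charted R n) (gM : metric_field M) (q : X -> M) :=
  [/\ forall y, exists x, q x = y,
      forall x y, q x = q y <-> exists2 f, G f & f x = y
    & forall x, exists U, [/\ open U, U x, open (q @` U) &
        sr_isometry gX U gM (q @` U) q]].

End semi_riemannian.

Section foliations.

(* A foliation is given by the set of its leaves. *)
Definition canonical_foliation1 (X Y : Type) : set (set (X * Y)) :=
  [set setT `*` [set b] | b in setT].
Definition canonical_foliation2 (X Y : Type) : set (set (X * Y)) :=
  [set [set a] `*` setT | a in setT].

Definition preserves_foliation (X : Type) (Fol : set (set X)) (f : X -> X) :=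
  forall F, Fol F -> Fol (f @` F).

Definition image_foliation (X Y : Type) (f : X -> Y) (Fol : set (set X)) :
  set (set Y) := [set f @` F | F in Fol].

(* When Fol is a partition, this is the unique leaf through x. *)
Definition leaf (X : Type) (Fol : set (set X)) (x : X) : set X :=
  \bigcup_(F in [set F | Fol F /\ F x]) F.

Section leaf_space.
Variables (X : topologicalType) (Fol : set (set X)).

Definition same_leaf : rel X := [rel x y | `[< leaf Fol x = leaf Fol y >]].

Lemma same_leaf_refl : reflexive same_leaf.
Proof. by move=> x; apply/asboolP. Qed.

Lemma same_leaf_sym : symmetric same_leaf.
Proof. by move=> x y; apply/idP/idP => /asboolP h; exact/asboolP. Qed.

Lemma same_leaf_trans : transitive same_leaf.
Proof. by move=> y x z /asboolP h /asboolP h'; apply/asboolP; rewrite h. Qed.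

Canonical same_leaf_equiv :=
  EquivRel same_leaf same_leaf_refl same_leaf_sym same_leaf_trans.

Definition leaf_space : topologicalType :=
  quotient_topology {eq_quot same_leaf_equiv}.

Definition leaf_proj : X -> leaf_space := \pi_{eq_quot same_leaf_equiv}.

Lemma leaf_proj_continuous : continuous leaf_proj.
Proof. exact: pi_continuous. Qed.

End leaf_space.

Lemma leaf_inclusion_continuous (X : topologicalType) (F : set X) :
  continuous (sval : F -> X).
Proof. exact: initial_continuous. Qed.

Variable R : realType.
Variables (k m : nat) (M : charted R (k + m)) (Fol : set (set M)).

Definition slice (c : chart R (k + m) M) (v : 'rV[R]_m) : set M :=
  [set y | chart_dom c y /\ rsubmx (chart_map c y) = v].

(* Balls of the sup norm of 'rV_(k + m) are cubes, so slices are connected. *)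
Definition adapted_chart (c : chart R (k + m) M) :=
  [/\ is_chart c,
      forall i, smooth_transition c (atlas i) /\ smooth_transition (atlas i) c,
      exists v e, 0 < e /\ chart_im c = ball v e
    & forall F x, Fol F -> F x -> chart_dom c x ->
        slice c (rsubmx (chart_map c x)) `<=` F].

Definition regular_point (x : M) :=
  exists c, [/\ adapted_chart c, chart_dom c x &
    forall F, Fol F -> F `&` chart_dom c !=set0 ->
      exists! v, F `&` chart_dom c = slice c v].

Definition regular_foliation := forall x, regular_point x.

(* The smooth structure of the leaf space: all charts c for which c \o eta is
   a smooth submersion, eta being the projection. *)
Definition leaf_chart (c : chart R m (leaf_space Fol)) :=
  is_chart c /\
  let f := chart_map c \o leaf_proj Fol in
  forall i : chart_index M,
    let U := coords i @` (dom i `&` leaf_proj Fol @^-1` chart_dom c) in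
    smooth_on U (f \o param i) /\
    forall v, U v -> row_full ('J (f \o param i) v).

Definition leaf_manifold : charted R m :=
  {| charted_space := leaf_space Fol ;
     chart_index := {c | leaf_chart c} ;
     atlas := sval |}.

End foliations.

(* Main.v *)
From HB Require Import structures.
Require Import Defs.
From mathcomp Require Import all_boot all_order all_algebra generic_quotient.
From mathcomp Require Import perm ring lra.
From mathcomp Require Import all_classical all_reals all_analysis.
Set Implicit Arguments.
Unset Strict Implicit.
Unset Printing Implicit Defensive.
Import Order.TTheory GRing.Theory Num.Theory.
Import numFieldNormedType.Exports.
Local Open Scope classical_set_scope.
Local Open Scope ring_scope.
Local Open Scope quotient_scope.

(** The group acts on each factor: f = phi x psi. Everything follows from one
    fact about the action on M2: once the first foliation is regular, an
    element whose psi fixes one point of M2 fixes all of M2, and every point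
    of M2 has a neighbourhood V that no psi except the identity maps to a set
    meeting V (base_act_fix, evenly_covered_nbhs). Indeed, in an adapted chart
    at q(a, b) a leaf is a single slice, so q followed by the transverse
    coordinates does not depend on the M1-coordinate. The Jacobian of q in
    product coordinates is therefore block triangular, and so is that of a
    local inverse of q: the M2-coordinate of the inverse is constant along
    slices. Points (a, y) and (a, psi y) close to (a, b) lie in one slice,
    hence y = psi y. The fixed points of a psi with a fixed point thus form an
    open, closed, nonempty subset of the connected manifold M2.

    Consequently M2 covers the leaf space L, which is the quotient of M2 by
    the psi's. The covering carries the manifold structure of M2 over to L, and
    M -> L has smooth local sections for it. A chart of L that is a smooth
    submersion on M has, read in the carried-over charts, an invertible
    Jacobian, so by smoothness of the inverse it is compatible with them: the
    atlas of all submersive charts is a smooth atlas (leaf_manifold_atlas).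

    The leaf N over b0 is the quotient of M1 by the elements that fix M2. Over
    an evenly covered V, both q and the product of the projections M1 -> N and
    V -> L are local diffeomorphisms on M1 x V with the same fibres, so the
    part of M over the image of V is diffeomorphic to that image times N
    (diffeomorphism_of_fibres, leaf_fiber_bundle).

    For the fundamental groups, homotopies are lifted through the two coverings
    M1 x M2 -> M and M2 -> L. A lift (A, B) of a homotopy between loops of the
    leaf is pushed back into the leaf by freezing B, which gives injectivity;
    replacing the second coordinate of a lifted loop by a lifted contraction
    identifies the kernel of pi_1(M) -> pi_1(L) with the image of pi_1(N); and
    a path in M1 closes up the lift of a loop of L, which gives surjectivity.
    The isomorphism is then the first isomorphism theorem (pi1_exact).

    For the second part, a countable basis of evenly covered sets of M2 yields
    an open B that no psi other than the identity maps to a set meeting B, and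
    whose translates are dense (fundamental_domain). The open dense set is
    q(M1 x B), which is N x B; the elements fixing M2 are isometries of M1 that
    preserve l2, unless M2 is a point and l2 is irrelevant to the metric, so
    the metric of M1 and the warping function descend to N. *)

(** * Topological preliminaries *)

Lemma continuous_fst (X Y : topologicalType) : continuous (@fst X Y).
Proof. by move=> [x y]; exact: cvg_fst. Qed.

Lemma continuous_snd (X Y : topologicalType) : continuous (@snd X Y).
Proof. by move=> [x y]; exact: cvg_snd. Qed.

Lemma pair_continuous (T U V : topologicalType) (f : T -> U) (g : T -> V) x :
  {for x, continuous f} -> {for x, continuous g} ->
  {for x, continuous (fun z => (f z, g z))}.
Proof. by move=> cf cg; exact: (cvg_pair cf cg). Qed.

Lemma near_everywhere (X : topologicalType) (x : X) (P : X -> Prop) :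
  (forall y, P y) -> \forall y \near x, P y.
Proof. by move=> h; exact: filterE. Qed.

Lemma near_open (X : topologicalType) (x : X) (P : X -> Prop) :
  (\forall y \near x, P y) -> exists U, [/\ open U, U x & forall y, U y -> P y].
Proof.
move=> h; have : nbhs x [set y | P y] by [].
by rewrite nbhsE => -[U [oU Ux] UP]; exists U.
Qed.

Lemma continuous_near (X Y : topologicalType) (f : X -> Y) (x : X) (y : Y) (P : Y -> Prop) :
  {for x, continuous f} -> f x = y -> (\forall z \near y, P z) ->
  \forall z \near x, P (f z).
Proof. by move=> cf <- nP; exact: cf _ nP. Qed.

Lemma near_fst (X Y : topologicalType) (z : X * Y) (P : X -> Prop) :
  (\forall x \near z.1, P x) -> \forall w \near z, P w.1.
Proof. by move=> h; exact: (continuous_near (@continuous_fst X Y z) erefl h). Qed.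

Lemma near_snd (X Y : topologicalType) (z : X * Y) (P : Y -> Prop) :
  (\forall x \near z.2, P x) -> \forall w \near z, P w.2.
Proof. by move=> h; exact: (continuous_near (@continuous_snd X Y z) erefl h). Qed.

Lemma near_continuous (T U : topologicalType) (f g : T -> U) x :
  (\forall z \near x, f z = g z) -> {for x, continuous f} -> {for x, continuous g}.
Proof.
move=> fg cf; have e := nbhs_singleton fg.
move=> W nW; have nf : nbhs (f x) W by rewrite e.
have n1 : nbhs x (f @^-1` W) := cf _ nf.
have n2 : nbhs x (g @^-1` W) by apply: filterS2 fg n1 => z /= ->.
exact: n2.
Qed.

Lemma if_continuous (T U : topologicalType) (c : T -> bool) (f g : T -> U) x :
  {for x, continuous f} -> {for x, continuous g} -> f x = g x ->
  {for x, continuous (fun z => if c z then f z else g z)}.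
Proof.
move=> cf cg e W nW.
have nf : nbhs (f x) W by move: nW => /=; case: ifP => // _; rewrite e.
have ng : nbhs (g x) W by rewrite -e.
have n1 : nbhs x (f @^-1` W) := cf _ nf; have n2 : nbhs x (g @^-1` W) := cg _ ng.
have n3 : nbhs x ((fun z => if c z then f z else g z) @^-1` W).
  by apply: filterS2 n1 n2 => z /= Wf Wg; case: ifP.
exact: n3.
Qed.

Lemma open_setI_preimage (X Y : topologicalType) (f : X -> Y) (U : set X) (D : set Y) :
  open U -> {in U, continuous f} -> open D -> open (U `&` f @^-1` D).
Proof.
move=> oU cf oD; rewrite openE => x [Ux Dfx].
apply: filterI; first exact: open_nbhs_nbhs.
by apply: (cf x (mem_set Ux)); exact: open_nbhs_nbhs.
Qed.

Lemma continuous_in_comp (X Y Z : topologicalType) (f : X -> Y) (g : Y -> Z) (U : set X) (V : set Y) :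
  {in U, continuous f} -> {in V, continuous g} -> (forall x, U x -> V (f x)) ->
  {in U, continuous (g \o f)}.
Proof.
move=> cf cg UV x Ux; apply: continuous_comp; first exact: cf.
by apply/cg/mem_set/UV; rewrite inE in Ux.
Qed.

Lemma continuous_in_sub (X Y : topologicalType) (f : X -> Y) (U V : set X) :
  V `<=` U -> {in U, continuous f} -> {in V, continuous f}.
Proof. by move=> VU cf x; rewrite inE => /VU Ux; apply/cf/mem_set. Qed.

Lemma open_rectangle (X Y : topologicalType) (U : set X) (V : set Y) :
  open U -> open V -> open (U `*` V).
Proof.
move=> oU oV; rewrite openE => -[a b] [/= Ua Vb].
by exists (U, V) => //=; split; exact: open_nbhs_nbhs.
Qed.

(** The form in which connectedness is used throughout: a property that holds
    somewhere and is open, with open negation, holds everywhere. *)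
Lemma clopen_connected (T : topologicalType) (S : set T) t :
  connected [set: T] -> S t -> open S -> open (~` S) -> forall t', S t'.
Proof.
move=> cT St oS oC t'; suff -> : S = setT by [].
apply: cT; first by exists t.
  by exists S => //; rewrite setTI.
by exists S; [rewrite -openC | rewrite setTI].
Qed.

Lemma second_countable_image (S T : topologicalType) (f : S -> T) :
  continuous f -> (forall U, open U -> open (f @` U)) -> (forall y, exists x, f x = y) ->
  @second_countable S -> @second_countable T.
Proof.
move=> cf of_ sf [B cB [oB bB]].
exists [set f @` U | U in B]; first exact: sub_countable (card_image_le _ _) cB.
split=> [_ [U BU <-]|y]; first exact/of_/oB.
have [x <-] := sf y => W nW.
have [U [BU Ux] UW] := bB x _ (cf x W nW).
exists (f @` U); first by split; [exists U | exists x].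
by move=> _ [z Uz <-]; exact: UW.
Qed.

Lemma set_type_eq (T : Type) (A : set T) (y z : A) : sval y = sval z -> y = z.
Proof. by move=> e; apply: eq_sig_hprop => //= ?; exact: Prop_irrelevance. Qed.

Lemma set_type_map_continuous (T M : topologicalType) (F : set M) (K : T -> M)
    (FK : forall z, F (K z)) :
  continuous K -> continuous (fun z => exist _ (K z) (mem_set (FK z)) : F).
Proof. by move=> cK; apply: continuous_comp_initial. Qed.

Lemma hausdorff_subtype (T : topologicalType) (A : set T) :
  hausdorff_space T -> hausdorff_space A.
Proof.
move=> hT x y cl; apply: set_type_eq; apply: hT => U V nU nV.
have c := @initial_continuous A T set_val.
by have [z [Uz Vz]] := cl _ _ (c x _ nU) (c y _ nV); exists (sval z).
Qed.

Lemma second_countable_subtype (T : topologicalType) (A : set T) :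
  @second_countable T -> @second_countable A.
Proof.
move=> [B cB [oB bB]].
have c := @initial_continuous A T set_val.
exists [set (set_val : A -> T) @^-1` U | U in B]; first exact: sub_countable (card_image_le _ _) cB.
split=> [_ [U BU <-]|x W]; first by apply: open_comp => [? _|]; [exact: c|exact: oB].
rewrite nbhsE => -[_ [[U oU <-] Ux] UW].
have [V [BV Vx] VU] := bB (set_val x) _ (open_nbhs_nbhs (conj oU Ux)).
by exists ((set_val : A -> T) @^-1` V); [split=> //; exists V | move=> z /VU /UW].
Qed.

Lemma hausdorff_prod (X Y : topologicalType) :
  hausdorff_space X -> hausdorff_space Y -> hausdorff_space (X * Y)%type.
Proof.
move=> hX hY [x y] [x' y'] cl; congr pair.
  apply: hX => A B nA nB.
  have nA' : nbhs ((x, y) : X * Y) (fst @^-1` A) by exact: (@continuous_fst X Y (x, y) A nA).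
  have nB' : nbhs ((x', y') : X * Y) (fst @^-1` B) by exact: (@continuous_fst X Y (x', y') B nB).
  by have [z [Az Bz]] := cl _ _ nA' nB'; exists z.1.
apply: hY => A B nA nB.
have nA' : nbhs ((x, y) : X * Y) (snd @^-1` A) by exact: (@continuous_snd X Y (x, y) A nA).
have nB' : nbhs ((x', y') : X * Y) (snd @^-1` B) by exact: (@continuous_snd X Y (x', y') B nB).
by have [z [Az Bz]] := cl _ _ nA' nB'; exists z.2.
Qed.

(** * Calculus of smooth maps between normed spaces *)

Section Cn.
Variable R : realType.

(** Differentiability to order n + 1 in terms of directional derivatives. The
    induction on n is what proves the product, chain and inverse rules, since the derivative of a
    composite involves the composite itself to one order less. *)
Fixpoint Cn (V W : normedModType R) (n : nat) (U : set V) (f : V -> W) : Prop :=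
  (forall x, U x -> differentiable f x) /\
  if n is n'.+1 then forall v, Cn n' U ('D_v f) else True.

Lemma Cn_differentiable (V W : normedModType R) n (U : set V) (f : V -> W) :
  Cn n U f -> forall x, U x -> differentiable f x.
Proof. by case: n => [|n] []. Qed.

(** Iterating foldr on rcons: the last direction is differentiated first. *)
Lemma smooth_on_derive (V W : normedModType R) (U : set V) (f : V -> W) v :
  smooth_on U f -> smooth_on U ('D_v f).
Proof. by move=> fU vs x Ux; have := fU (rcons vs v) x Ux; rewrite foldr_rcons. Qed.

Lemma smooth_on_Cn (V W : normedModType R) (U : set V) (f : V -> W) :
  smooth_on U f <-> forall n, Cn n U f.
Proof.
split=> [fU n|fU vs x Ux].
  elim: n f fU => [|n IH] f fU; split=> //; try exact: (fU [::]).
  by move=> v; apply/IH/smooth_on_derive.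
suff {fU} : forall f : V -> W, Cn (size vs) U f ->
    differentiable (foldr (fun v h => 'D_v h) f vs) x by apply; exact: fU.
elim/last_ind: vs => [|vs v IH] {}f fU; first exact: (Cn_differentiable fU Ux).
by rewrite foldr_rcons; apply: IH; move: fU; rewrite size_rcons => -[_ h]; exact: h.
Qed.

Lemma eq_on_near (V : topologicalType) (W : Type) (U : set V) (f g : V -> W) x :
  open U -> U x -> (forall y, U y -> f y = g y) -> \forall y \near x, f y = g y.
Proof. by move=> oU Ux fg; apply: filterS (open_nbhs_nbhs (conj oU Ux)) => y /fg. Qed.

Lemma near_eq_differentiable (V W : normedModType R) (f g : V -> W) x :
  (\forall y \near x, f y = g y) -> differentiable f x -> differentiable g x.
Proof.
move=> fg df; have fgx := nbhs_singleton fg.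
apply/diff_locallyP.
have e : g \o shift x = cst (g x) + 'd f x +o_ 0 id.
  apply/eqaddoP => _/posnumP[e].
  have /diff_locally/eqaddoP/(_ e%:num [gt0 of e%:num]) := df.
  have fg0 : \forall h \near 0, f (h + x) = g (h + x).
    by move: fg; rewrite (near_shift 0 x) /=; apply: filterS => y /=; rewrite subr0.
  apply: filterS2 fg0 => h e1.
  have -> // : (f \o shift x - (cst (f x) + 'd f x)) h =
     (g \o shift x - (cst (g x) + 'd f x)) h by rewrite !fctE /= e1 fgx.
have dfc := diff_continuous df.
by rewrite (diff_unique dfc e).
Qed.

Lemma Cn_eq (V W : normedModType R) n (U : set V) (f g : V -> W) :
  open U -> (forall y, U y -> f y = g y) -> Cn n U f -> Cn n U g.
Proof.
move=> oU; elim: n f g => [|n IH] f g fg [df hf]; split=> //.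
- by move=> x Ux; apply: (near_eq_differentiable _ (df x Ux)); exact: eq_on_near fg.
- by move=> x Ux; apply: (near_eq_differentiable _ (df x Ux)); exact: eq_on_near fg.
- move=> v; apply: IH (hf v) => y Uy; apply: near_eq_derive.
  exact: eq_on_near fg.
Qed.

Lemma CnW (V W : normedModType R) n (U : set V) (f : V -> W) :
  Cn n.+1 U f -> Cn n U f.
Proof.
elim: n f => [|n IH] f [df hf]; split=> // v; apply: IH; exact: hf.
Qed.

Lemma Cn_cst (V W : normedModType R) n (U : set V) (a : W) :
  open U -> Cn n U (fun _ : V => a).
Proof.
move=> oU; elim: n a => [|n IH] a; split=> //.
move=> v; apply: (Cn_eq oU _ (IH 0)) => y _; by rewrite derive_cst.
Qed.

Lemma CnD (V W : normedModType R) n (U : set V) (f g : V -> W) :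
  open U -> Cn n U f -> Cn n U g -> Cn n U (fun x => f x + g x).
Proof.
move=> oU; elim: n f g => [|n IH] f g [df hf] [dg hg]; split=> //.
- by move=> x Ux; apply: differentiableD; auto.
- by move=> x Ux; apply: differentiableD; auto.
- move=> v; apply: (Cn_eq oU _ (IH _ _ (hf v) (hg v))) => y Uy.
  by rewrite -deriveD //; apply: diff_derivable; auto.
Qed.

Lemma Cn_lin (V W W' : normedModType R) n (U : set V) (f : V -> W)
    (L : {linear W -> W'}) :
  open U -> continuous L -> Cn n U f -> Cn n U (L \o f).
Proof.
move=> oU cL; elim: n f => [|n IH] f [df hf]; split=> //.
- by move=> x Ux; apply: differentiable_comp; [exact: df|exact: linear_differentiable].
- by move=> x Ux; apply: differentiable_comp; [exact: df|exact: linear_differentiable].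
- move=> v; apply: (Cn_eq oU _ (IH _ (hf v))) => y Uy /=.
  have dL := linear_differentiable (f y) cL.
  have dLf := differentiable_comp (df y Uy) dL.
  rewrite (deriveE _ dLf) (deriveE _ (df y Uy)) (diff_comp (df y Uy) dL) /=.
  by have := congr1 (fun h => h ('d f y v)) (diff_lin (f y) cL).
Qed.

Lemma Cn_linear (V W : normedModType R) n (U : set V) (L : {linear V -> W}) :
  open U -> continuous L -> Cn n U L.
Proof.
move=> oU cL; have dL x : differentiable L x by exact: linear_differentiable.
case: n => [|n]; split=> // v.
apply: (Cn_eq oU _ (Cn_cst n (L v) oU)) => y _.
by rewrite deriveE //; have := congr1 (fun h => h v) (diff_lin y cL).
Qed.

Lemma scale_is_bilinear (W : normedModType R) :
  bilinear_for
    (GRing.Scale.Law.clone _ _ *:%R _) (GRing.Scale.Law.clone _ _ *:%R _)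
    (fun (a : R^o) (w : W) => a *: w).
Proof.
split=> [u'|u] a x y /=.
- by rewrite scalerDl scalerA.
- by rewrite scalerDr !scalerA mulrC.
Qed.

Lemma diff_scale (V W : normedModType R) (a : V -> R^o) (f : V -> W) x :
  differentiable a x -> differentiable f x ->
  differentiable (fun y => a y *: f y) x /\
  forall v, 'd (fun y => a y *: f y) x v = a x *: 'd f x v + 'd a x v *: f x.
Proof.
move=> da df.
pose bM := bilinear_isBilinear.Build _ _ _ _ _ _ _ (@scale_is_bilinear W).
pose b : {bilinear R^o -> W -> W} := HB.pack (fun (a : R^o) (w : W) => a *: w) bM.
have bc : continuous (fun p : R^o * W => b p.1 p.2) by exact: scale_continuous.
have db := @differentiable_bilin _ _ _ _ b (a x, f x) bc.
have dp := differentiable_pair da df.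
have E : (fun y => a y *: f y) = (fun p => b p.1 p.2) \o (fun y => (a y, f y)) by [].
split; first by rewrite E; exact: differentiable_comp.
move=> v; rewrite E (diff_comp dp db) /=.
have /= -> := congr1 (fun h => h ('d (fun y => (a y, f y)) x v)) (diff_bilin (a x, f x) bc).
by have /= -> := congr1 (fun h => h v) (diff_pair da df).
Qed.

Lemma CnZ (V W : normedModType R) n (U : set V) (a : V -> R^o) (f : V -> W) :
  open U -> Cn n U a -> Cn n U f -> Cn n U (fun x => a x *: f x).
Proof.
move=> oU; elim: n a f => [|n IH] a f Ca Cf; have [da ha] := Ca; have [df hf] := Cf.
  by split=> // x Ux; case: (diff_scale (da x Ux) (df x Ux)).
split=> [x Ux|v]; first by case: (diff_scale (da x Ux) (df x Ux)).
apply: (Cn_eq oU _ (CnD oU (IH _ _ (CnW Ca) (hf v)) (IH _ _ (ha v) (CnW Cf)))) => y Uy.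
have [d1 E] := diff_scale (da y Uy) (df y Uy).
by rewrite (deriveE _ d1) E (deriveE _ (da y Uy)) (deriveE _ (df y Uy)).
Qed.

Lemma Cn_sum (V W : normedModType R) (I : Type) (r : seq I) n (U : set V) (f : I -> V -> W) :
  open U -> (forall i, Cn n U (f i)) -> Cn n U (fun x => \sum_(i <- r) f i x).
Proof.
move=> oU Cf; elim: r => [|i r IH].
  by apply: (Cn_eq oU _ (Cn_cst n 0 oU)) => y _; rewrite big_nil.
apply: (Cn_eq oU _ (CnD oU (Cf i) IH)) => y _; by rewrite big_cons.
Qed.

Lemma Cn_prod (V : normedModType R) (I : Type) (r : seq I) n (U : set V) (f : I -> V -> R^o) :
  open U -> (forall i, Cn n U (f i)) ->
  Cn n U ((fun x => \prod_(i <- r) (f i x : R)) : V -> R^o).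
Proof.
move=> oU Cf; elim: r => [|i r IH].
  by apply: (Cn_eq oU _ (Cn_cst n (1 : R^o) oU)) => y _; rewrite big_nil.
by apply: (Cn_eq oU _ (CnZ oU (Cf i) IH)) => y _; rewrite big_cons.
Qed.

Lemma CnV (V : normedModType R) n (U : set V) (f : V -> R^o) :
  open U -> (forall x, U x -> f x != 0) -> Cn n U f ->
  Cn n U ((fun x => (f x : R)^-1) : V -> R^o).
Proof.
move=> oU f0; elim: n => [|n IH] Cf; have [df hf] := Cf.
  by split=> // x Ux; apply: differentiableV; auto.
split=> [x Ux|v]; first by apply: differentiableV; auto.
have Ci := IH (CnW Cf).
have C2 := CnZ oU (Cn_cst n (-1 : R^o) oU) (CnZ oU (CnZ oU Ci Ci) (hf v)).
apply: (Cn_eq oU _ C2) => y Uy; apply/esym.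
have dV := differentiableV (df y Uy) (f0 y Uy).
rewrite (deriveE _ dV) diffV //; auto; rewrite (deriveE _ (df y Uy)) /=.
by rewrite /GRing.scale /= mulN1r mulNr -exprVn expr2 ?mulrA.
Qed.

Lemma sum_continuous (X : topologicalType) (W : normedModType R) (I : Type) (r : seq I)
    (f : I -> X -> W) x :
  (forall i, {for x, continuous (f i)}) ->
  {for x, continuous (fun y => \sum_(i <- r) f i y)}.
Proof.
move=> cf; elim: r => [|i r IH].
  have -> : (fun y => \sum_(i <- [::]) f i y) = (fun=> 0).
    by apply/funext => y; rewrite big_nil.
  exact: cst_continuous.
have -> : (fun y => \sum_(i <- i :: r) f i y) = (fun y => f i y + \sum_(i <- r) f i y).
  by apply/funext => y; rewrite big_cons.
exact: continuousD.
Qed.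

Lemma linear_rV_continuous m (W : normedModType R) (L : {linear 'rV[R]_m -> W}) :
  continuous L.
Proof.
move=> x.
have -> : (L : 'rV[R]_m -> W) = fun x => \sum_(j < m) x 0 j *: L 'e_j.
  apply/funext => y; rewrite [in LHS](row_sum_delta y) linear_sum.
  by apply: eq_bigr => j _; rewrite linearZ.
apply: sum_continuous => j.
have c := @coord_continuous R 1 m 0 j x.
exact: (@cvgZr_tmp R W _ (nbhs x) (nbhs_filter x) (fun y : 'rV[R]_m => y 0 j) _ (L 'e_j) c).
Qed.

Lemma coord_linear m k i j : {L : {linear 'M[R]_(m, k) -> R^o} |
  continuous L /\ forall A, L A = A i j}.
Proof.
have lc : linear (fun A : 'M[R]_(m, k) => A i j : R^o) by move=> a A B; rewrite !mxE.
pose cM := GRing.isLinear.Build _ _ _ _ _ lc.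
pose c : {linear 'M[R]_(m, k) -> R^o} := HB.pack (fun A : 'M[R]_(m, k) => A i j : R^o) cM.
by exists c; split=> //; exact: coord_continuous.
Qed.

Lemma Cn_coord (V : normedModType R) m k n (U : set V) (f : V -> 'M[R]_(m, k)) i j :
  open U -> Cn n U f -> Cn n U ((fun x => f x i j) : V -> R^o).
Proof.
move=> oU Cf; have [c [cc cE]] := @coord_linear m k i j.
by apply: (Cn_eq oU _ (Cn_lin oU cc Cf)) => y _ /=; rewrite cE.
Qed.

Lemma Cn_mx (V : normedModType R) m k n (U : set V) (f : V -> 'M[R]_(m, k)) :
  open U -> (forall i j, Cn n U ((fun x => f x i j) : V -> R^o)) -> Cn n U f.
Proof.
move=> oU Cf.
have C : Cn n U (fun x => \sum_(i < m) \sum_(j < k) f x i j *: delta_mx i j : 'M[R]_(m, k)).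
  apply: Cn_sum => // i; apply: Cn_sum => // j; apply: CnZ => //; exact: Cn_cst.
by apply: (Cn_eq oU _ C) => y _; rewrite -matrix_sum_delta.
Qed.

(** By the chain rule D_v (g o f) is the sum over j of (D_v f)_j (D_(e_j) g o f),
    to which the rules for sums and products and the induction hypothesis apply. *)
Lemma Cn_comp (V : normedModType R) m (W : normedModType R) n (U : set V)
    (U' : set 'rV[R]_m) (f : V -> 'rV[R]_m) (g : 'rV[R]_m -> W) :
  open U -> open U' -> (forall x, U x -> U' (f x)) ->
  Cn n U f -> Cn n U' g -> Cn n U (g \o f).
Proof.
move=> oU oU' fU; elim: n f g fU => [|n IH] f g fU Cf Cg; have [df hf] := Cf; have [dg hg] := Cg.
  by split=> // x Ux; apply: differentiable_comp; auto.
split=> [x Ux|v]; first by apply: differentiable_comp; auto.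
have C : Cn n U (fun x => \sum_(j < m) ('D_v f x) 0 j *: ('D_('e_j) g \o f) x).
  apply: Cn_sum => // j; apply: CnZ => //; first exact: Cn_coord (hf v).
  by apply: IH => //; [exact: CnW|exact: hg].
apply: (Cn_eq oU _ C) => y Uy.
have d1 := df y Uy; have d2 := dg _ (fU _ Uy).
have d3 := differentiable_comp d1 d2.
rewrite (deriveE _ d3) diff_comp //= -(deriveE _ d1) [in RHS](row_sum_delta ('D_v f y)).
rewrite linear_sum; apply: eq_bigr => j _ /=.
by rewrite linearZ (deriveE _ d2).
Qed.

End Cn.

Section local_smooth.
Variable R : realType.
Implicit Types V W : normedModType R.

Lemma smooth_on_eq V W (U : set V) (f g : V -> W) :
  open U -> (forall y, U y -> f y = g y) -> smooth_on U f -> smooth_on U g.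
Proof. by move=> oU fg /smooth_on_Cn sf; apply/smooth_on_Cn => n; exact: Cn_eq fg _. Qed.

Lemma smooth_on_sub V W (U U' : set V) (f : V -> W) :
  U' `<=` U -> smooth_on U f -> smooth_on U' f.
Proof. by move=> UU sf vs x /UU; exact: sf. Qed.

Lemma smooth_on_local V W (U : set V) (f : V -> W) :
  (forall x, U x -> exists O, O x /\ smooth_on O f) -> smooth_on U f.
Proof. by move=> h vs x /h [Q [Qx]]; apply. Qed.

Lemma smooth_on_comp V m W (U : set V) (U' : set 'rV[R]_m) (f : V -> 'rV[R]_m)
    (g : 'rV[R]_m -> W) :
  open U -> open U' -> (forall x, U x -> U' (f x)) ->
  smooth_on U f -> smooth_on U' g -> smooth_on U (g \o f).
Proof.
move=> oU oU' fU /smooth_on_Cn sf /smooth_on_Cn sg; apply/smooth_on_Cn => n.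
exact: Cn_comp fU _ _.
Qed.

Lemma smooth_on_linear V W (U : set V) (L : {linear V -> W}) :
  open U -> continuous L -> smooth_on U L.
Proof. by move=> oU cL; apply/smooth_on_Cn => n; exact: Cn_linear. Qed.

Lemma smooth_on_cst V W (U : set V) (a : W) : open U -> smooth_on U (fun _ : V => a).
Proof. by move=> oU; apply/smooth_on_Cn => n; exact: Cn_cst. Qed.

Lemma smooth_on_id V (U : set V) : open U -> smooth_on U (fun x : V => x).
Proof. by move=> oU; apply: (@smooth_on_linear _ _ _ idfun) => // x; exact: cvg_id. Qed.

Lemma smooth_on_differentiable V W (U : set V) (f : V -> W) x :
  smooth_on U f -> U x -> differentiable f x.
Proof. by move=> sf; exact: (sf [::]). Qed.

Lemma smooth_on_continuous V W (U : set V) (f : V -> W) x :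
  smooth_on U f -> U x -> {for x, continuous f}.
Proof. by move=> sf Ux; apply: differentiable_continuous; exact: smooth_on_differentiable sf Ux. Qed.

Lemma smooth_on_row_mx V m k (U : set V) (f : V -> 'rV[R]_m) (g : V -> 'rV[R]_k) :
  open U -> smooth_on U f -> smooth_on U g ->
  smooth_on U (fun x => row_mx (f x) (g x)).
Proof.
move=> oU /smooth_on_Cn sf /smooth_on_Cn sg; apply/smooth_on_Cn => n.
apply: Cn_mx => // i j; case: (split_ordP j) => j' ->.
  by apply: Cn_eq (Cn_coord i j' oU (sf n)) => // x _; rewrite row_mxEl.
by apply: Cn_eq (Cn_coord i j' oU (sg n)) => // x _; rewrite row_mxEr.
Qed.

(** * Jacobian matrices and smooth inverses *)

Lemma jacobianE n m (f : 'rV[R]_n -> 'rV[R]_m) x v : 'd f x v = v *m 'J f x.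
Proof. by rewrite /jacobian mul_rV_lin1. Qed.

Lemma jacobian_coord n m (f : 'rV[R]_n -> 'rV[R]_m) x i j :
  differentiable f x -> 'J f x i j = ('D_('e_i) f x) 0 j.
Proof. by move=> df; rewrite (deriveE _ df) /jacobian mxE. Qed.

Lemma jacobian_comp n m k (f : 'rV[R]_n -> 'rV[R]_m) (g : 'rV[R]_m -> 'rV[R]_k) x :
  differentiable f x -> differentiable g (f x) ->
  'J (g \o f) x = 'J f x *m 'J g (f x).
Proof.
move=> df dg; apply/row_matrixP => i; rewrite !rowE mulmxA -!jacobianE.
by rewrite (diff_comp df dg).
Qed.

Lemma near_eq_jacobian n m (f g : 'rV[R]_n -> 'rV[R]_m) x :
  (\forall y \near x, f y = g y) -> differentiable f x -> 'J f x = 'J g x.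
Proof.
move=> fg df; have dg := near_eq_differentiable fg df.
apply/matrixP => i j; apply: (etrans (jacobian_coord i j df)).
by rewrite (near_eq_derive 'e_i fg); apply/esym; exact: jacobian_coord.
Qed.

Lemma jacobian_linear n m (L : {linear 'rV[R]_n -> 'rV[R]_m}) x : 'J L x = lin1_mx L.
Proof.
apply/row_matrixP => i; rewrite !rowE -jacobianE mul_rV_lin1.
by have := congr1 (fun h => h 'e_i) (diff_lin x (@linear_rV_continuous _ _ _ L)).
Qed.

Lemma jacobian_id n x : 'J (fun y : 'rV[R]_n => y) x = 1%:M.
Proof.
have -> := @jacobian_linear n n idfun x.
by apply/row_matrixP => i; rewrite !rowE mul_rV_lin1 mulmx1.
Qed.

Lemma Cn_det n (V : normedModType R) (U : set V) (A : V -> 'M[R]_n) k :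
  open U -> (forall i j, Cn k U ((fun x => A x i j) : V -> R^o)) ->
  Cn k U ((fun x => \det (A x)) : V -> R^o).
Proof.
move=> oU CA; rewrite /determinant; apply: Cn_sum => // s.
have C := CnZ oU (Cn_cst k ((-1 : R) ^+ s : R^o) oU)
  (Cn_prod (index_enum _) oU (fun i => CA i (s i))).
exact: Cn_eq C.
Qed.

(** Cramer's rule: the entries are cofactors divided by the determinant. *)
Lemma Cn_invmx n (V : normedModType R) (U : set V) (A : V -> 'M[R]_n) k :
  open U -> (forall x, U x -> A x \in unitmx) ->
  (forall i j, Cn k U ((fun x => A x i j) : V -> R^o)) ->
  forall i j, Cn k U ((fun x => invmx (A x) i j) : V -> R^o).
Proof.
move=> oU uA CA i j.
have C1 : Cn k U ((fun x => cofactor (A x) j i) : V -> R^o).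
  suff C : Cn k U ((fun x => \det (row' j (col' i (A x)))) : V -> R^o).
    by apply: Cn_eq (CnZ oU (Cn_cst k ((-1 : R) ^+ (j + i) : R^o) oU) C).
  apply: Cn_det => // i' j'.
  by apply: Cn_eq (CA (lift j i') (lift i j')) => // x _; rewrite !mxE.
have C2 : Cn k U ((fun x => (\det (A x))^-1) : V -> R^o).
  apply: CnV => //; last exact: Cn_det.
  by move=> x /uA; rewrite unitmxE unitfE.
apply: Cn_eq (CnZ oU C2 C1) => // x Ux.
by rewrite /invmx (uA _ Ux) !mxE.
Qed.

(** The estimate behind the inverse function theorem, for a map already known
    to have a continuous local inverse: with u the increment of h and k the
    increment of the variable, k = f' u + o(u) gives u = L k + o(u), first
    hence u = O(k) and then u = L k + o(k). *)
Lemma inverse_differentiable V W (f : V -> W) (h : W -> V) (y : W)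
    (L : {linear W -> V}) :
  {for y, continuous h} -> (\forall z \near y, f (h z) = z) ->
  differentiable f (h y) -> continuous L -> (forall v, L ('d f (h y) v) = v) ->
  differentiable h y.
Proof.
move=> ch fh df cL Ldf.
have fhy := nbhs_singleton fh.
apply/diff_locallyP.
have E : h \o shift y = cst (h y) + L +o_ 0 id.
  have [C C0 LC] := linear_lipschitz cL.
  apply/eqaddoP => e e0.
  pose d := Num.min (2 * C)^-1 (e / (2 * C * C)).
  have d0 : 0 < d.
    by rewrite /d lt_min invr_gt0 divr_gt0 ?mulr_gt0.
  have Cd : C * d <= 2^-1.
    have h1 : d <= (2 * C)^-1 by rewrite /d ge_min lexx.
    apply: le_trans (ler_wpM2l (ltW C0) h1) _.
    by rewrite invfM mulrCA divff ?mulr1 // gt_eqF.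
  have Cde : 2 * C * C * d <= e.
    have h1 : d <= e / (2 * C * C) by rewrite /d ge_min lexx orbT.
    have c0 : 0 < 2 * C * C by rewrite !mulr_gt0.
    apply: le_trans (ler_wpM2l (ltW c0) h1) _.
    by rewrite mulrCA divff ?mulr1 // gt_eqF.
  have /diff_locally/eqaddoP/(_ d d0) N1 := df.
  have N2 : \forall k \near 0, f (h (k + y)) = k + y.
    by move: fh; rewrite (near_shift 0 y) /=; apply: filterS => z /=; rewrite subr0.
  have N3 : \forall k \near 0, `|(f \o shift (h y) - (cst (f (h y)) + 'd f (h y)))
        (h (k + y) - h y)| <= d * `|id (h (k + y) - h y)|.
    have c0 : (fun k => h (k + y) - h y) @ 0 --> 0.
      rewrite -(subrr (h y)); apply: cvgB; last exact: cvg_cst.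
      have -> : (fun k => h (k + y)) = h \o shift y by [].
      by apply: (cvg_trans _ ch); rewrite -[X in _ @ X]/(nbhs 0) cvg_comp_shift add0r.
    exact: c0 _ N1.
  apply: filterS2 N2 N3 => k e1 b.
  set u := h (k + y) - h y in b.
  have ek : (f \o shift (h y) - (cst (f (h y)) + 'd f (h y))) u = k - 'd f (h y) u.
    by rewrite !fctE /= /u subrK e1 fhy opprD addrA addrK.
  rewrite ek in b.
  have -> : (h \o shift y - (cst (h y) + L)) k = u - L k.
    by rewrite !fctE /= /u opprD addrA.
  have b1 : `|u - L k| <= C * d * `|u|.
    rewrite -mulrA; apply: le_trans (ler_wpM2l (ltW C0) b).
    apply: le_trans (LC _); rewrite linearB Ldf distrC //.
  have b2 : `|u| <= 2 * C * `|k|.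
    have h1 : `|u| <= `|u - L k| + `|L k|.
      by rewrite -[X in `|X| <= _](subrK (L k) u) ler_normD.
    have h2 := LC k.
    have h3 : C * d * `|u| <= 2^-1 * `|u| by apply: ler_wpM2r.
    by move: b1 h1 h2 h3; set a := `|u|; set b' := `|k|; set c := `|u - L k|; set e' := `|L k|; lra.
  have h4 : C * d * `|u| <= C * d * (2 * C * `|k|).
    by apply: ler_wpM2l => //; rewrite mulr_ge0 // ltW.
  apply: le_trans b1 _; apply: le_trans h4 _.
  have -> : C * d * (2 * C * `|k|) = 2 * C * C * d * `|k| by ring.
  exact: ler_wpM2r.
by rewrite (diff_unique cL E).
Qed.

(** A continuous inverse is differentiable with D_v h = v (J f (h y))^-1, so an
    inverse of class Cn n has derivatives of class Cn n: the regularity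
    bootstraps. *)
Lemma inverse_smooth n (U U' : set 'rV[R]_n) (f h : 'rV[R]_n -> 'rV[R]_n) :
  open U -> open U' -> (forall y, U' y -> U (h y)) ->
  (forall y, U' y -> {for y, continuous h}) ->
  (forall y, U' y -> f (h y) = y) ->
  smooth_on U f -> (forall x, U x -> 'J f x \in unitmx) ->
  smooth_on U' h.
Proof.
move=> oU oU' hU ch fh sf uJ.
have dh y : U' y -> differentiable h y.
  move=> U'y; have [Uy df] := (hU _ U'y, smooth_on_differentiable sf (hU _ U'y)).
  pose L := mulmxr (invmx ('J f (h y))) : {linear 'rV[R]_n -> 'rV[R]_n}.
  apply: (@inverse_differentiable _ _ f h y L) => //.
  - exact: ch.
  - exact: (eq_on_near oU' U'y fh).
  - exact: linear_rV_continuous.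
  - by move=> v; rewrite /L /= jacobianE mulmxK // uJ.
have Dh v y : U' y -> 'D_v h y = v *m invmx ('J f (h y)).
  move=> U'y; have [Uy df] := (hU _ U'y, smooth_on_differentiable sf (hU _ U'y)).
  rewrite (deriveE _ (dh _ U'y)).
  have dfh : 'd f (h y) ('d h y v) = v.
    have := congr1 (fun g => g v) (diff_comp (dh _ U'y) df).
    rewrite /= => <-.
    have nid : \forall z \near y, (fun z => z) z = (f \o h) z.
      by have := eq_on_near oU' U'y fh; apply: filterS => z /= ->.
    have did : differentiable (fun z : 'rV[R]_n => z) y by [].
    rewrite -(deriveE _ (near_eq_differentiable nid did)) -(near_eq_derive _ nid).
    by rewrite derive_id.
  have E : 'd h y v *m 'J f (h y) = v by exact: (etrans (esym (jacobianE _ _ _)) dfh).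
  have /(mulmxK) K : 'J f (h y) \in unitmx by exact: uJ.
  exact: (etrans (esym (K _ _)) (congr1 (mulmx^~ _) E)).
have Cinv k i j : Cn k U ((fun x => invmx ('J f x) i j) : _ -> R^o).
  apply: Cn_invmx => // i' j'.
  have Cd : Cn k U ('D_('e_i') f) by move/smooth_on_Cn: sf => /(_ k.+1) [_]; apply.
  apply: Cn_eq (Cn_coord 0 j' oU Cd) => // x Ux.
  by rewrite jacobian_coord //; exact: smooth_on_differentiable sf Ux.
apply/smooth_on_Cn; elim => [|k IH]; split=> // v.
have Ch i j := Cn_comp oU' oU hU IH (Cinv k i j).
apply: (@Cn_eq _ _ _ _ _ (fun y => v *m invmx ('J f (h y)))) => //.
  by move=> y /Dh ->.
apply: Cn_mx => // i j.
have C : Cn k U' ((fun y => \sum_l (v i l * invmx ('J f (h y)) l j)) : _ -> R^o).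
  apply: Cn_sum => // l.
  exact: (CnZ oU' (Cn_cst k (v i l : R^o) oU') (Ch l j)).
by apply: Cn_eq C => // y _; rewrite mxE.
Qed.

(** The mean value theorem, coordinate by coordinate. *)
Lemma derive0_segment n m (P : set 'rV[R]_n) (f : 'rV[R]_n -> 'rV[R]_m)
    (x w : 'rV[R]_n) :
  (forall t : R, 0 <= t <= 1 -> P (x + t *: w)) ->
  (forall y, P y -> differentiable f y) -> (forall y, P y -> 'D_w f y = 0) ->
  f (x + w) = f x.
Proof.
move=> xP df Df; apply/rowP => j.
pose p (t : R) : R := f (x + t *: w) 0 j.
have dp (t : R) : 0 <= t <= 1 -> is_derive t 1 p 0.
  move=> /xP Pt.
  have dl : is_diff t (fun t : R^o => x + t *: w) (fun s => s *: w).
    by apply: is_diff_eq; apply/funext => s /=; rewrite add0r.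
  have d1 := df _ Pt.
  have [c [cc cE]] := @coord_linear R 1 m 0 j.
  have d2 := linear_differentiable (f (x + t *: w)) cc.
  have dd := differentiable_comp (ex_diff (is_diff_def := dl)) d1.
  have d3 := differentiable_comp dd d2.
  have pE : p = c \o (f \o (fun t : R^o => x + t *: w)).
    by apply/funext => s /=; rewrite cE.
  rewrite pE; apply: DeriveDef; first exact: diff_derivable.
  rewrite (deriveE _ d3) (diff_comp dd d2) /=.
  rewrite (diff_comp (ex_diff (is_diff_def := dl)) d1) /= diff_val scale1r.
  rewrite -(deriveE _ d1) (Df _ Pt).
  by have /= -> := congr1 (fun h => h 0) (diff_lin (f (x + t *: w)) cc); rewrite linear0.
have c01 : {within `[0, 1], continuous p}.
  apply: derivable_within_continuous => t; rewrite in_itv /= => /dp.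
  by move=> h; exact: ex_derive.
have dp' (t : R) : t \in `]0, 1[%R -> is_derive t 1 p ((cst 0 : R -> R) t).
  by rewrite in_itv /= => /andP[t0 t1]; apply: dp; rewrite !ltW.
have [t _] := MVT ltr01 dp' c01.
by rewrite /p mul0r scale1r scale0r addr0 => /eqP; rewrite subr_eq0 => /eqP.
Qed.

End local_smooth.

(** * Charts and smooth maps *)

Section manifold_maps.
Variable R : realType.

Section charts.
Variables (n : nat) (X : topologicalType) (c : chart R n X).
Hypothesis cP : is_chart c.

Lemma chart_dom_open : open (chart_dom c). Proof. by case: cP. Qed.

Lemma chart_mapK x : chart_dom c x -> chart_inv c (chart_map c x) = x.
Proof. by case: cP => _ _ K _ _ cx; apply/K/mem_set. Qed.

Lemma chart_map_continuous : {in chart_dom c, continuous (chart_map c)}.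
Proof. by case: cP. Qed.

Lemma chart_image_open (U : set X) :
  open U -> open (chart_map c @` (U `&` chart_dom c)).
Proof.
move=> oU; case: (cP) => od oi K cm ci.
have -> : chart_map c @` (U `&` chart_dom c) =
    chart_im c `&` chart_inv c @^-1` U.
  apply/seteqP; split=> [v [x [Ux cx] <-]|v [[x cx <-]]] /=.
    by split; [exists x | rewrite chart_mapK].
  by rewrite chart_mapK // => Ux; exists x.
exact: open_setI_preimage.
Qed.

Lemma chart_invK v : chart_im c v -> chart_map c (chart_inv c v) = v.
Proof. by move=> [x cx <-]; rewrite chart_mapK. Qed.

End charts.

(** The part of the notion of manifold that smoothness of maps depends on;
    unlike second countability, it is inherited by every construction below
    without further work. *)
Definition smooth_atlas n (X : charted R n) :=
  [/\ forall x : X, exists i, dom i x,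
      forall i : chart_index X, is_chart (atlas i)
    & forall i j : chart_index X, smooth_transition (atlas i) (atlas j)].

Lemma smooth_manifold_atlas n (X : charted R n) : smooth_manifold X -> smooth_atlas X.
Proof. by case. Qed.

Definition smooth_at n m (X : charted R n) (Y : charted R m) (f : X -> Y) (x : X) :=
  exists U, [/\ open U, U x & smooth_map U f].

Section smooth_at.
Variables (n m : nat) (X : charted R n) (Y : charted R m).
Implicit Types f : X -> Y.

Lemma smooth_mapP (U : set X) f :
  open U -> smooth_map U f <-> forall x, U x -> smooth_at f x.
Proof.
move=> oU; split=> [sf x Ux|sf]; first by exists U.
split=> [x|i j]; first by rewrite inE => /sf [V [oV Vx [cf _]]]; apply/cf/mem_set.
apply: smooth_on_local => v [x [[Ux ix] jfx] <-].
have [V [oV Vx [_ sV]]] := sf x Ux; exists (coords i @` (V `&` dom i `&` f @^-1` dom j)).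
by split; [exists x | exact: sV].
Qed.

Lemma smooth_at_continuous f x : smooth_at f x -> {for x, continuous f}.
Proof. by move=> [U [oU Ux [cf _]]]; apply/cf/mem_set. Qed.

Lemma near_smooth_at f x : smooth_at f x -> \forall y \near x, smooth_at f y.
Proof.
move=> [U [oU Ux sf]]; apply: filterS (open_nbhs_nbhs (conj oU Ux)) => y Uy.
by exists U.
Qed.

Hypotheses (aX : smooth_atlas X) (aY : smooth_atlas Y).

Lemma chart_at x : exists i : chart_index X, dom i x.
Proof. by case: aX. Qed.

Lemma atlas_chart (i : chart_index X) : is_chart (atlas i).
Proof. by case: aX. Qed.

Lemma dom_open (i : chart_index X) : open (dom i).
Proof. exact: chart_dom_open (atlas_chart i). Qed.

Lemma coords_image_open (i : chart_index X) (U : set X) :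
  open U -> U `<=` dom i -> open (coords i @` U).
Proof.
move=> oU Ui; have := chart_image_open (atlas_chart i) oU.
by rewrite setIidl.
Qed.

Lemma paramK (i : chart_index X) x : dom i x -> param i (coords i x) = x.
Proof. exact: chart_mapK (atlas_chart i) x. Qed.

End smooth_at.

Section smooth_at_criteria.
Variables (n m : nat) (X : charted R n) (Y : charted R m).
Implicit Types f : X -> Y.
Hypotheses (aX : smooth_atlas X) (aY : smooth_atlas Y).

(** In other charts the local expression is conjugated by transition maps. *)
Lemma smooth_map_chart (U : set X) (i : chart_index X) (j : chart_index Y) f :
  open U -> U `<=` dom i -> (forall x, U x -> dom j (f x)) ->
  {in U, continuous f} -> smooth_on (coords i @` U) (local_expr i j f) ->
  smooth_map U f.
Proof.
move=> oU Ui Uj cf sf; split=> // i' j'.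
have [_ _ tX] := aX; have [_ _ tY] := aY.
pose U' := U `&` dom i' `&` f @^-1` dom j'.
have oU' : open U'.
  rewrite /U' setIAC; apply: openI; last exact: dom_open.
  by apply: open_setI_preimage => //; exact: dom_open.
have oS : open (coords i' @` U') by apply: coords_image_open => // x [[]].
have oA : open (coords i @` U') by apply: coords_image_open => // x [[/Ui]].
have odj : open (coords j @` (dom j `&` dom j')).
  by apply: coords_image_open => //; apply: openI; exact: dom_open.
have s1 : smooth_on (coords i' @` U') (coords i \o param i').
  apply: smooth_on_sub (tX i' i) => v [x [[Ux i'x] _] <-].
  by exists x => //; split=> //; exact: Ui.
have s2 : smooth_on (coords i @` U') (local_expr i j f).
  by apply: smooth_on_sub sf => v [x [[Ux _] _] <-]; exists x.
have s3 := tY j j'.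
have h1 v : (coords i' @` U') v -> (coords i @` U') ((coords i \o param i') v).
  by move=> [x [[Ux i'x] j'x] <-] /=; rewrite (paramK aX i'x); exists x.
have s12 := smooth_on_comp oS oA h1 s1 s2.
apply: (@smooth_on_eq _ _ _ _ (coords j' \o param j \o (local_expr i j f \o (coords i \o param i')))) => //.
- move=> v [x [[Ux i'x] j'x] <-]; rewrite /local_expr /=.
  by rewrite (paramK aX i'x) (paramK aX (Ui _ Ux)) (paramK aY (Uj _ Ux)).
- apply: smooth_on_comp oS odj _ s12 s3 => v [x [[Ux i'x] j'x] <-] /=.
  rewrite (paramK aX i'x); exists (f x) => //; first by split=> //; exact: Uj.
  by rewrite /local_expr /= (paramK aX (Ui _ Ux)).
Qed.

Lemma smooth_at_chart f x i j : dom i x -> dom j (f x) ->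
  (\forall y \near x, {for y, continuous f}) ->
  (exists2 V, open V /\ V (coords i x) & smooth_on V (local_expr i j f)) ->
  smooth_at f x.
Proof.
move=> ix jx /near_open[U [oU Ux cf]] [V [oV Vx] sV].
have cfU : {in U, continuous f} by move=> y; rewrite inE => /cf.
pose W := (U `&` f @^-1` dom j) `&` (dom i `&` coords i @^-1` V).
have oW : open W.
  apply: openI; first by apply: open_setI_preimage => //; exact: dom_open.
  apply: open_setI_preimage => //; first exact: dom_open.
  exact: chart_map_continuous (atlas_chart aX i).
exists W; split=> //; apply: (smooth_map_chart (i := i) (j := j)) => //.
- by move=> y [_ []].
- by move=> y [[]].
- by apply: continuous_in_sub cfU => y [[]].
- by apply: smooth_on_sub sV => v [y [_ [_ Vy]] <-].
Qed.

Lemma smooth_at_local_expr f x (i : chart_index X) (j : chart_index Y) :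
  smooth_at f x -> dom i x -> dom j (f x) ->
  exists V, [/\ open V, V (coords i x),
    forall v, V v -> chart_im (atlas i) v /\ dom j (f (param i v))
    & smooth_on V (local_expr i j f)].
Proof.
move=> [U [oU Ux [cf sf]]] ix jx.
exists (coords i @` (U `&` dom i `&` f @^-1` dom j)); split.
- apply: coords_image_open => //; last by move=> y [[]].
  rewrite setIAC; apply: openI; last exact: dom_open.
  by apply: open_setI_preimage => //; exact: dom_open.
- by exists x.
- move=> v [y [[Uy iy] jy] <-]; split; first by exists y.
  by rewrite (paramK aX iy).
- exact: sf.
Qed.

Lemma smooth_at_eq f g x :
  (\forall y \near x, f y = g y) -> smooth_at f x -> smooth_at g x.
Proof.
move=> fg sf; have [i ix] := chart_at aX x; have [j jx] := chart_at aY (f x).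
have [V [oV Vx Vi sV]] := smooth_at_local_expr sf ix jx.
have jgx : dom j (g x) by rewrite -(nbhs_singleton fg).
apply: (smooth_at_chart ix jgx).
  have [W [oW Wx fgW]] := near_open fg.
  have [U [oU Ux sU]] := near_open (near_smooth_at sf).
  apply: filterS (open_nbhs_nbhs (conj (openI oU oW) (conj Ux Wx))) => y [Uy Wy].
  have e := eq_on_near oW Wy fgW.
  suff cg : g z @[z --> y] --> f y by move: cg; rewrite (nbhs_singleton e).
  apply: (cvg_trans _ (smooth_at_continuous (sU y Uy))).
  exact: near_eq_cvg.
have [W [oW Wx fgW]] := near_open fg.
have oi : open (coords i @` (W `&` dom i)).
  by apply: coords_image_open => //; apply: openI => //; exact: dom_open.
exists (V `&` coords i @` (W `&` dom i)).
  by split; [exact: openI | split=> //; exists x].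
apply: (@smooth_on_eq _ _ _ _ (local_expr i j f)); first exact: openI.
- by move=> v [_ [y [Wy iy] <-]]; rewrite /local_expr /= (paramK aX iy) fgW.
- by apply: smooth_on_sub sV => ? [].
Qed.

End smooth_at_criteria.

Lemma smooth_at_id n (X : charted R n) (x : X) :
  smooth_atlas X -> smooth_at (fun y : X => y) x.
Proof.
move=> aX; have [i ix] := chart_at aX x.
apply: (smooth_at_chart aX aX ix ix); first by apply: nearW => y; exact: cvg_id.
have oi : open (chart_im (atlas i)) by case: (atlas_chart aX i).
exists (chart_im (atlas i)); first by split=> //; exists x.
apply: (@smooth_on_eq _ _ _ _ (fun v => v)) => //; last exact: smooth_on_id.
by move=> v [y iy <-]; rewrite /local_expr /= (paramK aX iy).
Qed.

Lemma smooth_at_cst n m (X : charted R n) (Y : charted R m) (x : X) (b : Y) :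
  smooth_atlas X -> smooth_atlas Y -> smooth_at (fun _ : X => b) x.
Proof.
move=> aX aY; have [i ix] := chart_at aX x; have [j jb] := chart_at aY b.
apply: (smooth_at_chart aX aY ix jb); first by apply: nearW => y; exact: cst_continuous.
exists setT; first by split=> //; exact: openT.
by apply: smooth_on_cst; exact: openT.
Qed.

Lemma smooth_at_comp n m k (X : charted R n) (Y : charted R m) (Z : charted R k)
    (f : X -> Y) (g : Y -> Z) x :
  smooth_atlas X -> smooth_atlas Y -> smooth_atlas Z ->
  smooth_at f x -> smooth_at g (f x) -> smooth_at (g \o f) x.
Proof.
move=> aX aY aZ sf sg; have [i ix] := chart_at aX x.
have [j jx] := chart_at aY (f x); have [l lx] := chart_at aZ (g (f x)).
have [V [oV Vx Vi sV]] := smooth_at_local_expr aX aY sf ix jx.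
have [W [oW Wx Wj sW]] := smooth_at_local_expr aY aZ sg jx lx.
have cfx := smooth_at_continuous sf.
apply: (smooth_at_chart aX aZ ix lx).
  have n1 := cfx _ (near_smooth_at sg).
  apply: filterS2 (near_smooth_at sf) n1 => y /smooth_at_continuous cf /smooth_at_continuous cg.
  exact: continuous_comp.
have cl : {in V, continuous (local_expr i j f)}.
  by move=> v; rewrite inE => Vv; exact: smooth_on_continuous sV Vv.
have oVW := open_setI_preimage oV cl oW.
exists (V `&` local_expr i j f @^-1` W).
  by split=> //; split=> //=; rewrite /local_expr /= (paramK aX ix).
apply: (@smooth_on_eq _ _ _ _ (local_expr j l g \o local_expr i j f)) => //.
  by move=> v [/Vi [_ jv] _]; rewrite /local_expr /= (paramK aY jv).
apply: (smooth_on_comp oVW oW _ _ sW) => [v []//|].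
by apply: smooth_on_sub sV => ? [].
Qed.

(** * Products of manifolds *)

Section products.
Variables (n m : nat) (X : charted R n) (Y : charted R m).
Hypotheses (aX : smooth_atlas X) (aY : smooth_atlas Y).

Lemma row_mx_continuous (T : topologicalType) k l (f : T -> 'rV[R]_k) (g : T -> 'rV[R]_l) x :
  {for x, continuous f} -> {for x, continuous g} ->
  {for x, continuous (fun y => row_mx (f y) (g y))}.
Proof.
move=> cf cg; apply/cvg_ballP => e e0.
have /cvg_ballP/(_ e e0) nf := cf; have /cvg_ballP/(_ e e0) ng := cg.
apply: filterS2 nf ng => y [_ fy] [_ gy]; split=> // i j.
by case: (split_ordP j) => j' ->; rewrite ?row_mxEl ?row_mxEr.
Qed.

Lemma prod_is_chart (c : chart R n X) (d : chart R m Y) :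
  is_chart c -> is_chart d -> is_chart (prod_chart c d).
Proof.
move=> cP dP; have [oc oic Kc cc ic] := cP; have [od oid Kd cd id_] := dP.
have imE : chart_im (prod_chart c d) = [set v | chart_im c (lsubmx v) /\ chart_im d (rsubmx v)].
  apply/seteqP; split=> [v [[x y] [/= cx dy] <-]|v /= [[x cx ex] [y dy ey]]] /=.
    by rewrite row_mxKl row_mxKr; split; [exists x|exists y].
  by exists (x, y) => //=; rewrite ex ey hsubmxK.
have cl : continuous (lsubmx : 'rV[R]_(n + m) -> 'rV[R]_n) by exact: continuous_lsubmx.
have cr : continuous (rsubmx : 'rV[R]_(n + m) -> 'rV[R]_m) by exact: continuous_rsubmx.
split.
- rewrite openE => -[x y] [/= cx dy].
  exists (chart_dom c, chart_dom d) => //=; split; exact: open_nbhs_nbhs.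
- rewrite imE; apply: openI.
    by apply: (@open_comp _ _ (lsubmx : 'rV[R]_(n + m) -> 'rV[R]_n)) => // v _; exact: cl.
  by apply: (@open_comp _ _ (rsubmx : 'rV[R]_(n + m) -> 'rV[R]_m)) => // v _; exact: cr.
- move=> [x y]; rewrite inE => -[/= cx dy]; rewrite row_mxKl row_mxKr.
  by rewrite chart_mapK // chart_mapK.
- move=> [x y]; rewrite inE => -[/= cx dy].
  apply: (@row_mx_continuous (X * Y)%type n m (fun z => chart_map c z.1)
    (fun z => chart_map d z.2) (x, y)).
    by apply: continuous_comp; [exact: cvg_fst | apply/cc/mem_set].
  by apply: continuous_comp; [exact: cvg_snd | apply/cd/mem_set].
- move=> v; rewrite imE inE => -[/= cv dv].
  have c1 := continuous_comp (cl v) (ic _ (mem_set cv)).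
  have c2 := continuous_comp (cr v) (id_ _ (mem_set dv)).
  exact: (cvg_pair c1 c2).
Qed.

Lemma smooth_on_lsubmx (U : set 'rV[R]_(n + m)) : open U ->
  smooth_on U (lsubmx : 'rV[R]_(n + m) -> 'rV[R]_n).
Proof. by move=> oU; apply: smooth_on_linear => //; exact: continuous_lsubmx. Qed.

Lemma smooth_on_rsubmx (U : set 'rV[R]_(n + m)) : open U ->
  smooth_on U (rsubmx : 'rV[R]_(n + m) -> 'rV[R]_m).
Proof. by move=> oU; apply: smooth_on_linear => //; exact: continuous_rsubmx. Qed.

Lemma prod_smooth_atlas : smooth_atlas (prod_charted X Y).
Proof.
have cP (ij : chart_index (prod_charted X Y)) : is_chart (atlas ij).
  by apply: prod_is_chart; exact: atlas_chart.
split=> // [[x y]|[i j] [i' j']].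
  have [i ix] := chart_at aX x; have [j jy] := chart_at aY y.
  by exists (i, j).
have [_ _ tX] := aX; have [_ _ tY] := aY.
have oI := @coords_image_open _ _ aX i (dom i `&` dom i') (openI (dom_open aX i) (dom_open aX i')) (@subIsetl _ _ _).
have oJ := @coords_image_open _ _ aY j (dom j `&` dom j') (openI (dom_open aY j) (dom_open aY j')) (@subIsetl _ _ _).
rewrite /smooth_transition; set S := _ @` _.
have oS : open S.
  rewrite /S setIC; apply: (chart_image_open (cP (i, j))).
  exact: (chart_dom_open (cP (i', j'))).
have S1 v : S v -> (coords i @` (dom i `&` dom i')) (lsubmx v).
  by move=> [[x y] [[/= ix jy] [/= i'x j'y]] <-]; rewrite row_mxKl; exists x.
have S2 v : S v -> (coords j @` (dom j `&` dom j')) (rsubmx v).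
  by move=> [[x y] [[/= ix jy] [/= i'x j'y]] <-]; rewrite row_mxKr; exists y.
apply: (@smooth_on_row_mx _ _ _ _ S
  ((coords i' \o param i) \o (lsubmx : 'rV[R]_(n + m) -> 'rV[R]_n))
  ((coords j' \o param j) \o (rsubmx : 'rV[R]_(n + m) -> 'rV[R]_m))) => //.
- by apply: (smooth_on_comp oS oI) => //; [exact: smooth_on_lsubmx | exact: tX].
- by apply: (smooth_on_comp oS oJ) => //; [exact: smooth_on_rsubmx | exact: tY].
Qed.

Lemma smooth_at_fst z : smooth_at (Y := X) (fun z : prod_charted X Y => z.1) z.
Proof.
have [i ix] := chart_at aX z.1; have [j jy] := chart_at aY z.2.
have aP := prod_smooth_atlas.
have ij : @dom _ _ (prod_charted X Y) (i, j) z by [].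
apply: (smooth_at_chart aP aX ij ix); first by apply: (@near_everywhere (prod_charted X Y) z) => z'; exact: (@continuous_fst X Y z').
have oi : open (chart_im (@atlas _ _ (prod_charted X Y) (i, j))) by case: (atlas_chart aP (i, j)).
exists (chart_im (@atlas _ _ (prod_charted X Y) (i, j))); first by split=> //; exists z.
apply: smooth_on_eq (smooth_on_lsubmx oi) => //.
move=> v [[x' y'] [/= ix' jy'] <-]; rewrite /local_expr /= row_mxKl.
by congr coords; apply/esym; exact: (paramK aX ix').
Qed.

Lemma smooth_at_snd z : smooth_at (Y := Y) (fun z : prod_charted X Y => z.2) z.
Proof.
have [i ix] := chart_at aX z.1; have [j jy] := chart_at aY z.2.
have aP := prod_smooth_atlas.
have ij : @dom _ _ (prod_charted X Y) (i, j) z by [].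
apply: (smooth_at_chart aP aY ij jy); first by apply: (@near_everywhere (prod_charted X Y) z) => z'; exact: (@continuous_snd X Y z').
have oi : open (chart_im (@atlas _ _ (prod_charted X Y) (i, j))) by case: (atlas_chart aP (i, j)).
exists (chart_im (@atlas _ _ (prod_charted X Y) (i, j))); first by split=> //; exists z.
apply: smooth_on_eq (smooth_on_rsubmx oi) => //.
move=> v [[x' y'] [/= ix' jy'] <-]; rewrite /local_expr /= row_mxKr.
by congr coords; apply/esym; exact: (paramK aY jy').
Qed.

Lemma smooth_at_pair k (Z : charted R k) (f : Z -> X) (g : Z -> Y) z :
  smooth_atlas Z -> smooth_at f z -> smooth_at g z ->
  smooth_at (Y := prod_charted X Y) (fun z => (f z, g z)) z.
Proof.
move=> aZ sf sg; have [l lz] := chart_at aZ z.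
have [i ix] := chart_at aX (f z); have [j jy] := chart_at aY (g z).
have ij : @dom _ _ (prod_charted X Y) (i, j) (f z, g z) by [].
apply: (smooth_at_chart aZ prod_smooth_atlas lz ij).
  apply: filterS2 (near_smooth_at sf) (near_smooth_at sg).
  by move=> y /smooth_at_continuous cf /smooth_at_continuous cg; exact: cvg_pair.
have [V [oV Vx Vi sV]] := smooth_at_local_expr aZ aX sf lz ix.
have [W [oW Wx Wj sW]] := smooth_at_local_expr aZ aY sg lz jy.
exists (V `&` W); first by split=> //; exact: openI.
apply: (@smooth_on_row_mx _ _ _ _ (V `&` W) (local_expr l i f) (local_expr l j g)).
- exact: openI.
- by apply: smooth_on_sub sV => ? [].
- by apply: smooth_on_sub sW => ? [].
Qed.

End products.

End manifold_maps.

(** * Local diffeomorphisms *)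

Section local_diffeomorphisms.
Variable R : realType.

Definition local_diffeo n m (X : charted R n) (Y : charted R m) (f : X -> Y) (x : X) :=
  smooth_at f x /\ exists h : Y -> X, [/\ smooth_at h (f x),
    \forall y \near x, h (f y) = y & \forall z \near f x, f (h z) = z].

Section basics.
Variables (n m k l : nat) (X : charted R n) (Y : charted R m) (Z : charted R k) (T : charted R l).
Hypotheses (aX : smooth_atlas X) (aY : smooth_atlas Y) (aZ : smooth_atlas Z) (aT : smooth_atlas T).

Lemma local_diffeo_comp (f : X -> Y) (g : Y -> Z) x :
  local_diffeo f x -> local_diffeo g (f x) -> local_diffeo (g \o f) x.
Proof.
move=> [sf [h [sh hf fh]]] [sg [h' [sh' hg gh]]].
split; first exact: smooth_at_comp.
have cf := smooth_at_continuous sf; have cg := smooth_at_continuous sg.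
have ch' := smooth_at_continuous sh'.
have e : h' (g (f x)) = f x := nbhs_singleton hg.
exists (h \o h'); split.
- by apply: smooth_at_comp => //; rewrite /= e.
- have n1 := continuous_near cf erefl hg; apply: filterS2 n1 hf => y /= -> //.
- have n1 := continuous_near ch' e fh.
  by apply: filterS2 n1 gh => z /= ->.
Qed.

Lemma local_diffeo_open (D : set X) (f : X -> Y) :
  open D -> (forall x, D x -> local_diffeo f x) -> open (f @` D).
Proof.
move=> oD df; rewrite openE => _ [x Dx <-].
have [sf [h [sh hf fh]]] := df x Dx; have e : h (f x) = x := nbhs_singleton hf.
have n1 := continuous_near (smooth_at_continuous sh) e (open_nbhs_nbhs (conj oD Dx)).
by apply: filterS2 n1 fh => z Dz <-; exists (h z).
Qed.

Lemma local_diffeo_inj (f : X -> Y) x : local_diffeo f x ->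
  exists U, [/\ open U, U x & {in U &, injective f}].
Proof.
move=> [sf [h [sh hf fh]]]; have [U [oU Ux hfU]] := near_open hf.
exists U; split=> // y z; rewrite !inE => Uy Uz e.
by rewrite -(hfU y Uy) -(hfU z Uz) e.
Qed.

Lemma diffeomorphism_local (U : set X) (V : set Y) (f : X -> Y) x :
  open U -> open V -> diffeomorphism U V f -> U x -> local_diffeo f x.
Proof.
move=> oU oV [h [fU hV [hf fh] sf sh]] Ux.
have Vfx : V (f x) by apply: fU; exists x.
split; first by exists U.
exists h; split; first by exists V.
- apply: filterS (open_nbhs_nbhs (conj oU Ux)) => y Uy; exact/hf/mem_set.
- apply: filterS (open_nbhs_nbhs (conj oV Vfx)) => y Vy; exact/fh/mem_set.
Qed.

End basics.

Definition map_prod n m k l (X : charted R n) (Y : charted R m) (Z : charted R k)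
    (T : charted R l) (f : X -> Y) (g : Z -> T) : prod_charted X Z -> prod_charted Y T :=
  fun z => (f z.1, g z.2).

Definition swap_prod n m (X : charted R n) (Y : charted R m) (z : prod_charted X Y) :
  prod_charted Y X := (z.2, z.1).

Lemma smooth_at_prod n m k l (X : charted R n) (Y : charted R m) (Z : charted R k)
    (T : charted R l) (f : X -> Y) (g : Z -> T) (z : prod_charted X Z) :
  smooth_atlas X -> smooth_atlas Y -> smooth_atlas Z -> smooth_atlas T ->
  smooth_at f z.1 -> smooth_at g z.2 -> smooth_at (map_prod f g) z.
Proof.
move=> aX aY aZ aT sf sg; have aP := prod_smooth_atlas aX aZ.
apply: (smooth_at_pair aY aT aP).
  apply: (@smooth_at_comp _ _ _ _ (prod_charted X Z) X Y (fun z => z.1) f) => //.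
  exact: smooth_at_fst.
apply: (@smooth_at_comp _ _ _ _ (prod_charted X Z) Z T (fun z => z.2) g) => //.
exact: smooth_at_snd.
Qed.

Lemma local_diffeo_prod n m k l (X : charted R n) (Y : charted R m) (Z : charted R k)
    (T : charted R l) (f : X -> Y) (g : Z -> T) (z : prod_charted X Z) :
  smooth_atlas X -> smooth_atlas Y -> smooth_atlas Z -> smooth_atlas T ->
  local_diffeo f z.1 -> local_diffeo g z.2 -> local_diffeo (map_prod f g) z.
Proof.
move=> aX aY aZ aT [sf [h [sh hf fh]]] [sg [h' [sh' hg gh]]].
split; first exact: smooth_at_prod.
exists (map_prod h h'); split; first exact: smooth_at_prod.
- have n1 := @near_fst X Z z _ hf; have n2 := @near_snd X Z z _ hg.
  by apply: filterS2 n1 n2 => -[y1 y2] /= e1 e2; rewrite /map_prod /= e1 e2.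
- have n1 := @near_fst Y T (map_prod f g z) _ fh; have n2 := @near_snd Y T (map_prod f g z) _ gh.
  by apply: filterS2 n1 n2 => -[y1 y2] /= e1 e2; rewrite /map_prod /= e1 e2.
Qed.

Lemma local_diffeo_swap n m (X : charted R n) (Y : charted R m) (z : prod_charted X Y) :
  smooth_atlas X -> smooth_atlas Y -> local_diffeo (@swap_prod _ _ X Y) z.
Proof.
have smooth_swap n' m' (X' : charted R n') (Y' : charted R m') (z' : prod_charted X' Y') :
    smooth_atlas X' -> smooth_atlas Y' -> smooth_at (@swap_prod _ _ X' Y') z'.
  move=> aX' aY'; apply: (smooth_at_pair aY' aX' (prod_smooth_atlas aX' aY')).
    exact: smooth_at_snd.
  exact: smooth_at_fst.
move=> aX aY; split; first exact: smooth_swap.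
exists (@swap_prod _ _ Y X); split; first exact: smooth_swap.
- by apply: (@near_everywhere (prod_charted X Y)) => -[].
- by apply: (@near_everywhere (prod_charted Y X)) => -[].
Qed.

(** Two local diffeomorphisms a and b with the same fibres on D factor through
    the same quotient, which both identify with an open image; hence b o a^-1
    is a diffeomorphism between the images. *)
Lemma diffeomorphism_of_fibres n m k (X : charted R n) (Y : charted R m) (Z : charted R k)
    (D : set X) (a : X -> Y) (b : X -> Z) (F : Y -> Z) :
  smooth_atlas X -> smooth_atlas Y -> smooth_atlas Z ->
  open D -> D !=set0 ->
  (forall x, D x -> local_diffeo a x) -> (forall x, D x -> local_diffeo b x) ->
  (forall x y, D x -> D y -> a x = a y <-> b x = b y) ->
  (forall x, D x -> F (a x) = b x) ->
  diffeomorphism (a @` D) (b @` D) F.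
Proof.
move=> aX aY aZ oD [x0 Dx0] da db ab Fab.
have key n' m' (Y' : charted R n') (Z' : charted R m') (c : X -> Y') (d : X -> Z') (G : Y' -> Z') :
    smooth_atlas Y' -> smooth_atlas Z' ->
    (forall x, D x -> local_diffeo c x) -> (forall x, D x -> local_diffeo d x) ->
    (forall x, D x -> G (c x) = d x) -> smooth_map (c @` D) G.
  move=> aY' aZ' dc dd Gcd; apply/smooth_mapP; first exact: local_diffeo_open oD dc.
  move=> _ [x Dx <-]; have [sc [h [sh hc ch]]] := dc x Dx.
  have e : h (c x) = x := nbhs_singleton hc.
  have [sd _] := dd x Dx.
  apply: (@smooth_at_eq _ _ _ _ _ aY' aZ' (d \o h)).
    have n1 := continuous_near (smooth_at_continuous sh) e (open_nbhs_nbhs (conj oD Dx)).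
    by apply: filterS2 n1 ch => z Dz {2}<-; rewrite /= Gcd.
  by apply: smooth_at_comp => //; rewrite e.
have [h hP] : {h : Z -> X | forall x, D x -> D (h (b x)) /\ b (h (b x)) = b x}.
  have /choice[h hP] : forall z, exists x, forall y, D y -> b y = z -> D x /\ b x = z.
    move=> z; have [[x [Dx xz]]|nx] := pselect (exists x, D x /\ b x = z).
      by exists x.
    by exists x0 => y Dy yz; exfalso; apply: nx; exists y.
  by exists h => x Dx; exact: hP Dx erefl.
have Gba x : D x -> a (h (b x)) = a x.
  by move=> Dx; have [Dh e] := hP x Dx; apply/ab.
exists (a \o h); split.
- by move=> _ [_ [x Dx <-] <-]; rewrite Fab //; exists x.
- by move=> _ [_ [x Dx <-] <-] /=; rewrite Gba //; exists x.
- split=> y; rewrite inE => -[x Dx <-] /=; first by rewrite Fab // Gba.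
  by rewrite Gba // Fab.
- exact: (key _ _ _ _ a b).
- exact: (key _ _ _ _ b a).
Qed.

End local_diffeomorphisms.

(** * Local isometries *)

Section metrics.
Variable R : realType.

Definition isometric_at n m (X : charted R n) (Y : charted R m)
    (gX : metric_field X) (gY : metric_field Y) (f : X -> Y) (x : X) :=
  forall i j, dom i x -> dom j (f x) ->
    gX i x = 'J (local_expr i j f) (coords i x) *m gY j (f x)
             *m ('J (local_expr i j f) (coords i x))^T.

Lemma preserves_metricP n m (X : charted R n) (Y : charted R m)
    (gX : metric_field X) (gY : metric_field Y) (U : set X) (f : X -> Y) :
  preserves_metric gX gY U f <-> forall x, U x -> isometric_at gX gY f x.
Proof.
by split=> [h x Ux i j ix jx|h i j x Ux ix jx]; [exact: (h i j x)|exact: (h x Ux i j)].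
Qed.

Section jacobians.
Variables (n m k : nat) (X : charted R n) (Y : charted R m) (Z : charted R k).
Hypotheses (aX : smooth_atlas X) (aY : smooth_atlas Y) (aZ : smooth_atlas Z).

Lemma local_expr_differentiable (f : X -> Y) x i j :
  smooth_at f x -> dom i x -> dom j (f x) ->
  differentiable (local_expr i j f) (coords i x).
Proof.
move=> sf ix jx; have [V [oV Vx _ sV]] := smooth_at_local_expr aX aY sf ix jx.
exact: smooth_on_differentiable sV Vx.
Qed.

Lemma local_expr_near (i : chart_index X) x (P : X -> Prop) : dom i x ->
  (\forall z \near x, P z) -> \forall v \near coords i x, chart_im (atlas i) v /\ P (param i v).
Proof.
move=> ix /near_open[U [oU Ux PU]].
have oi : open (coords i @` (U `&` dom i)).
  by apply: coords_image_open => //; apply: openI => //; exact: dom_open.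
have Vx : (coords i @` (U `&` dom i)) (coords i x) by exists x.
apply: filterS (open_nbhs_nbhs (conj oi Vx)) => _ [z [Uz iz] <-].
by split; [exists z|rewrite (paramK aX iz); exact: PU].
Qed.

Lemma near_eq_local_expr (f g : X -> Y) x i j : dom i x ->
  (\forall z \near x, f z = g z) ->
  \forall v \near coords i x, local_expr i j f v = local_expr i j g v.
Proof.
move=> ix fg; apply: filterS (local_expr_near ix fg) => v [_ e].
by rewrite /local_expr /= e.
Qed.

Lemma jacobian_local_expr_comp (f : X -> Y) (g : Y -> Z) x i j l :
  smooth_at f x -> smooth_at g (f x) -> dom i x -> dom j (f x) -> dom l (g (f x)) ->
  'J (local_expr i l (g \o f)) (coords i x) =
  'J (local_expr i j f) (coords i x) *m 'J (local_expr j l g) (coords j (f x)).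
Proof.
move=> sf sg ix jx lx.
have [V [oV Vx Vi sV]] := smooth_at_local_expr aX aY sf ix jx.
have E : local_expr i j f (coords i x) = coords j (f x).
  by rewrite /local_expr /= (paramK aX ix).
have df := local_expr_differentiable sf ix jx.
have [W [oW Wx Wi sW]] := smooth_at_local_expr aY aZ sg jx lx.
have dg := smooth_on_differentiable sW Wx; rewrite -E in dg.
rewrite -E -(jacobian_comp df dg); apply/esym.
apply: near_eq_jacobian (differentiable_comp df dg).
apply: eq_on_near oV Vx _ => v /Vi [_ jv].
by rewrite /local_expr /= (paramK aY jv).
Qed.

End jacobians.

Section isometries.
Variables (n : nat) (X Y Z : charted R n).
Variables (gX : metric_field X) (gY : metric_field Y) (gZ : metric_field Z).
Hypotheses (aX : smooth_atlas X) (aY : smooth_atlas Y) (aZ : smooth_atlas Z).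

Lemma isometric_at_eq (f g : X -> Y) x : smooth_at f x ->
  (\forall z \near x, f z = g z) -> isometric_at gX gY f x -> isometric_at gX gY g x.
Proof.
move=> sf fg If i j ix; rewrite -(nbhs_singleton fg) => jx.
have nE := near_eq_local_expr aX j ix fg.
rewrite -(near_eq_jacobian nE (local_expr_differentiable aX aY sf ix jx)).
exact: If.
Qed.

Lemma isometric_at_comp (f : X -> Y) (g : Y -> Z) x :
  smooth_at f x -> smooth_at g (f x) ->
  isometric_at gX gY f x -> isometric_at gY gZ g (f x) -> isometric_at gX gZ (g \o f) x.
Proof.
move=> sf sg If Ig i l ix lx; have [j jx] := chart_at aY (f x).
rewrite (jacobian_local_expr_comp aX aY aZ sf sg ix jx lx) (If i j ix jx) (Ig j l jx lx).
by rewrite trmx_mul !mulmxA.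
Qed.

Lemma jacobian_local_expr_id (i : chart_index X) x : dom i x ->
  'J (local_expr i i (fun z : X => z)) (coords i x) = 1%:M.
Proof.
move=> ix; rewrite -(jacobian_id (coords i x)); apply/esym.
apply: near_eq_jacobian => //.
have n0 : \forall z \near x, True by exact: filterE.
apply: filterS (local_expr_near aX ix n0) => v [iv _].
by rewrite /local_expr /=; apply/esym; exact: chart_invK (atlas_chart aX i) v iv.
Qed.

End isometries.

Section inverse.
Variables (n : nat) (X Y : charted R n) (gX : metric_field X) (gY : metric_field Y).
Hypotheses (aX : smooth_atlas X) (aY : smooth_atlas Y).

Lemma jacobian_inverse (f : X -> Y) (h : Y -> X) x i j :
  smooth_at f x -> smooth_at h (f x) -> (\forall z \near x, h (f z) = z) ->
  dom i x -> dom j (f x) ->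
  'J (local_expr i j f) (coords i x) *m 'J (local_expr j i h) (coords j (f x)) = 1%:M.
Proof.
move=> sf sh hf ix jx; have e := nbhs_singleton hf.
have ihx : dom i (h (f x)) by rewrite e.
rewrite -(jacobian_local_expr_comp aX aY aX sf sh ix jx ihx).
rewrite -(jacobian_local_expr_id aX ix); apply: near_eq_jacobian.
  exact: near_eq_local_expr.
by apply: (local_expr_differentiable aX aX (smooth_at_comp aX aY aX sf sh)).
Qed.

Lemma isometric_at_inverse (f : X -> Y) (h : Y -> X) x :
  smooth_at f x -> smooth_at h (f x) ->
  (\forall z \near x, h (f z) = z) -> isometric_at gX gY f x ->
  isometric_at gY gX h (f x).
Proof.
move=> sf sh hf If j i jx ihx; have e := nbhs_singleton hf.
have ix : dom i x by rewrite -e.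
have /mulmx1C K := jacobian_inverse sf sh hf ix jx.
rewrite [X in gX i X]e (If i j ix jx) !mulmxA K mul1mx -mulmxA -trmx_mul K trmx1.
by rewrite mulmx1.
Qed.

End inverse.

(** * Products of local isometries *)

Lemma diff_comp_apply (U V W : normedModType R) (f : U -> V) (g : V -> W) x u :
  differentiable f x -> differentiable g (f x) ->
  'd (g \o f) x u = 'd g (f x) ('d f x u).
Proof. by move=> df dg; exact: (congr1 (fun h => h u) (diff_comp df dg)). Qed.

Lemma diff_lin_apply (V W : normedModType R) (L : {linear V -> W}) x u :
  continuous L -> 'd L x u = L u.
Proof. by move=> cL; exact: (congr1 (fun h => h u) (diff_lin x cL)). Qed.

Lemma jacobian_row_mx n m k l (F : 'rV[R]_n -> 'rV[R]_m) (G : 'rV[R]_k -> 'rV[R]_l)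
    (v : 'rV[R]_(n + k)) :
  differentiable F (lsubmx v) -> differentiable G (rsubmx v) ->
  'J (fun v : 'rV[R]_(n + k) => row_mx (F (lsubmx v)) (G (rsubmx v))) v =
  block_mx ('J F (lsubmx v)) 0 0 ('J G (rsubmx v)).
Proof.
move=> dF dG.
pose L : {linear 'rV[R]_m -> 'rV[R]_(m + l)} := mulmxr (row_mx 1%:M 0).
pose L' : {linear 'rV[R]_l -> 'rV[R]_(m + l)} := mulmxr (row_mx 0 1%:M).
have dl : differentiable (lsubmx : 'rV[R]_(n + k) -> 'rV[R]_n) v by exact: differentiable_lsubmx.
have dr : differentiable (rsubmx : 'rV[R]_(n + k) -> 'rV[R]_k) v by exact: differentiable_rsubmx.
have dFl := differentiable_comp dl dF; have dGr := differentiable_comp dr dG.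
have cL := @linear_rV_continuous _ _ _ L; have cL' := @linear_rV_continuous _ _ _ L'.
have d1 := differentiable_comp dFl (linear_differentiable (F (lsubmx v)) cL).
have d2 := differentiable_comp dGr (linear_differentiable (G (rsubmx v)) cL').
have E : (fun v : 'rV[R]_(n + k) => row_mx (F (lsubmx v)) (G (rsubmx v))) =
   (L \o (F \o lsubmx)) \+ (L' \o (G \o rsubmx)).
  apply/funext => w /=; rewrite /L /L' /= !mul_mx_row !mulmx0 !mulmx1.
  by rewrite add_row_mx addr0 add0r.
have JE (w : 'rV[R]_(n + k)) : w *m 'J (fun v : 'rV[R]_(n + k) => row_mx (F (lsubmx v)) (G (rsubmx v))) v =
    row_mx (lsubmx w *m 'J F (lsubmx v)) (rsubmx w *m 'J G (rsubmx v)).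
  have D1 : 'd (L \o (F \o lsubmx)) v w = L (lsubmx w *m 'J F (lsubmx v)).
    apply: (etrans (diff_comp_apply w dFl (linear_differentiable _ cL))).
    apply: (etrans (diff_lin_apply _ _ cL)); congr (L _).
    apply: (etrans (diff_comp_apply w dl dF)).
    apply: (etrans (congr1 ('d F (lsubmx v)) (diff_lin_apply v w (@continuous_lsubmx R 1 n k)))).
    exact: jacobianE.
  have D2 : 'd (L' \o (G \o rsubmx)) v w = L' (rsubmx w *m 'J G (rsubmx v)).
    apply: (etrans (diff_comp_apply w dGr (linear_differentiable _ cL'))).
    apply: (etrans (diff_lin_apply _ _ cL')); congr (L' _).
    apply: (etrans (diff_comp_apply w dr dG)).
    apply: (etrans (congr1 ('d G (rsubmx v)) (diff_lin_apply v w (@continuous_rsubmx R 1 n k)))).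
    exact: jacobianE.
  apply: (etrans (esym (jacobianE _ _ _))); rewrite E.
  apply: (etrans (congr1 (fun h => h w) (diffD d1 d2))).
  apply: (etrans (f_equal2 +%R D1 D2)).
  by rewrite /L /L' /= !mul_mx_row !mulmx0 !mulmx1 add_row_mx addr0 add0r.
apply/row_matrixP => i; rewrite !rowE JE.
by rewrite -{3}(hsubmxK (delta_mx 0 i)) mul_row_block !mulmx0 addr0 add0r.
Qed.

Section warped.
Variables (n m : nat) (X Y : charted R n) (Z T : charted R m).
Variables (gX : metric_field X) (gY : metric_field Y) (gZ : metric_field Z) (gT : metric_field T).
Hypotheses (aX : smooth_atlas X) (aY : smooth_atlas Y) (aZ : smooth_atlas Z) (aT : smooth_atlas T).

Lemma jacobian_map_prod (f : X -> Y) (h : Z -> T) (z : prod_charted X Z)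
    i i' j j' : smooth_at f z.1 -> smooth_at h z.2 ->
  dom i z.1 -> dom i' z.2 -> dom j (f z.1) -> dom j' (h z.2) ->
  'J (@local_expr _ _ _ (prod_charted X Z) (prod_charted Y T) (i, i') (j, j') (map_prod f h))
     (@coords _ _ (prod_charted X Z) (i, i') z) =
  block_mx ('J (local_expr i j f) (coords i z.1)) 0 0 ('J (local_expr i' j' h) (coords i' z.2)).
Proof.
move=> sf sh ix iz jx jz.
have dF := local_expr_differentiable aX aY sf ix jx.
have dG := local_expr_differentiable aZ aT sh iz jz.
set v := coords _ z.
have vl : lsubmx v = coords i z.1 by rewrite /v /coords /= row_mxKl.
have vr : rsubmx v = coords i' z.2 by rewrite /v /coords /= row_mxKr.
rewrite -vl in dF *; rewrite -vr in dG *.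
exact: (jacobian_row_mx dF dG).
Qed.

Lemma isometric_at_prod (f : X -> Y) (h : Z -> T) (z : prod_charted X Z) l1 l2 l1' l2' :
  smooth_at f z.1 -> smooth_at h z.2 ->
  isometric_at gX gY f z.1 -> isometric_at gZ gT h z.2 ->
  l1' (h z.2) = l1 z.2 -> m = 0%N \/ l2' (f z.1) = l2 z.1 ->
  isometric_at (doubly_warped gX gZ l1 l2) (doubly_warped gY gT l1' l2') (map_prod f h) z.
Proof.
move=> sf sh If Ih e1 e2 [i i'] [j j'] [/= ix iz] [/= jx jz].
rewrite (jacobian_map_prod sf sh ix iz jx jz) /doubly_warped /=.
rewrite tr_block_mx !trmx0 !mulmx_block !(mulmx0, mul0mx, addr0, add0r).
rewrite -!scalemxAr -!scalemxAl -(If i j ix jx) -(Ih i' j' iz jz) e1.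
congr block_mx; case: e2 => [m0|-> //].
by apply/matrixP => a; have := ltn_ord a; rewrite {2}m0.
Qed.

(** Both sides are block diagonal, so the metric condition on the product splits
    into one condition for each factor. *)
Lemma map_prod_isometric_at (f : X -> Y) (h : Z -> T) (z : prod_charted X Z) l1 l2 l1' l2' :
  smooth_at f z.1 -> smooth_at h z.2 ->
  isometric_at (doubly_warped gX gZ l1 l2) (doubly_warped gY gT l1' l2') (map_prod f h) z ->
  (forall i j, dom i z.1 -> dom j (f z.1) -> l1 z.2 ^+ 2 *: gX i z.1 =
     l1' (h z.2) ^+ 2 *: ('J (local_expr i j f) (coords i z.1) *m gY j (f z.1)
                 *m ('J (local_expr i j f) (coords i z.1))^T)) /\
  (forall i j, dom i z.2 -> dom j (h z.2) -> l2 z.1 ^+ 2 *: gZ i z.2 =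
     l2' (f z.1) ^+ 2 *: ('J (local_expr i j h) (coords i z.2) *m gT j (h z.2)
                 *m ('J (local_expr i j h) (coords i z.2))^T)).
Proof.
move=> sf sh I.
have key i i' j j' : dom i z.1 -> dom i' z.2 -> dom j (f z.1) -> dom j' (h z.2) -> _ := 
  fun ix iz jx jz => I (i, i') (j, j') (conj ix iz) (conj jx jz).
split=> [i j ix jx|i' j' iz jz].
  have [i' iz] := chart_at aZ z.2; have [j' jz] := chart_at aT (h z.2).
  have := key i i' j j' ix iz jx jz.
  rewrite (jacobian_map_prod sf sh ix iz jx jz) /doubly_warped /=.
  rewrite tr_block_mx !trmx0 !mulmx_block !(mulmx0, mul0mx, addr0, add0r).
  by rewrite -!scalemxAr -!scalemxAl => /eq_block_mx[].
have [i ix] := chart_at aX z.1; have [j jx] := chart_at aY (f z.1).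
have := key i i' j j' ix iz jx jz.
rewrite (jacobian_map_prod sf sh ix iz jx jz) /doubly_warped /=.
rewrite tr_block_mx !trmx0 !mulmx_block !(mulmx0, mul0mx, addr0, add0r).
by rewrite -!scalemxAr -!scalemxAl => /eq_block_mx[].
Qed.

End warped.

End metrics.

(** * Manifolds obtained from etale maps *)

Section etale.
Variable R : realType.

(** A surjection from the open part D of X that is locally a homeomorphism, and
    whose identifications are locally smooth and isometric. It covers at once a
    quotient by a group of isometries and an open subset of X. The identifying
    maps phi are only asked for pointwise and as germs: for a group they are
    group elements, for an open subset the identity. *)
Record etale n (X : charted R n) (g : metric_field X) (N : topologicalType)
    (D : set X) (e : X -> N) : Prop := Etale {
  etale_dom_open : open D ;
  etale_continuous : {in D, continuous e} ;
  etale_open : forall U, open U -> U `<=` D -> open (e @` U) ;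
  etale_surj : forall y, exists2 x, D x & e x = y ;
  etale_inj : forall x, D x -> exists U, [/\ open U, U x & {in U &, injective e}] ;
  etale_transition : forall x y, D x -> D y -> e x = e y ->
    exists phi : X -> X, [/\ smooth_at phi x, isometric_at g g phi x, phi x = y
      & \forall z \near x, D (phi z) /\ e (phi z) = e z] }.

Section etale_quotient.
Variables (n : nat) (X : charted R n) (g : metric_field X).
Variables (N : topologicalType) (D : set X) (e : X -> N).
Hypotheses (aX : smooth_atlas X) (eE : etale g D e).

(** A chart of the quotient is a chart of X restricted to an open set on which e
    is injective. *)
Definition etale_index := {p : chart_index X * set X |
  [/\ open p.2, p.2 `<=` D `&` dom p.1 & {in p.2 &, injective e}]}.

Definition sheet (p : etale_index) : set X := (sval p).2.
Definition sheet_chart (p : etale_index) : chart_index X := (sval p).1.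

Lemma sheet_open p : open (sheet p). Proof. by case: (svalP p). Qed.
Lemma sheet_dom p : sheet p `<=` dom (sheet_chart p).
Proof. by case: (svalP p) => _ h _ x /h []. Qed.
Lemma sheet_sub p : sheet p `<=` D.
Proof. by case: (svalP p) => _ h _ x /h []. Qed.
Lemma sheet_inj p : {in sheet p &, injective e}. Proof. by case: (svalP p). Qed.

Lemma sheet_section_subproof (p : etale_index) y :
  exists x, [/\ D x, e x = y & (e @` sheet p) y -> sheet p x].
Proof.
have [[x px <-]|ny] := pselect ((e @` sheet p) y).
  by exists x; split=> //; exact: sheet_sub px.
by have [x Dx xy] := etale_surj eE y; exists x; split.
Qed.

Definition sheet_section p y : X := sval (cid (sheet_section_subproof p y)).

Lemma sheet_sectionP p y : [/\ D (sheet_section p y), e (sheet_section p y) = y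
  & (e @` sheet p) y -> sheet p (sheet_section p y)].
Proof. by rewrite /sheet_section; case: cid. Qed.

Lemma sheet_sectionK p x : sheet p x -> sheet_section p (e x) = x.
Proof.
move=> px; have [_ ex pex] := sheet_sectionP p (e x).
by apply: (@sheet_inj p) ex; apply/mem_set => //; apply: pex; exists x.
Qed.

Lemma sheet_image_open p : open (e @` sheet p).
Proof. by apply: (etale_open eE); [exact: sheet_open|exact: sheet_sub]. Qed.

Lemma sheet_section_continuous p : {in e @` sheet p, continuous (sheet_section p)}.
Proof.
move=> y; rewrite inE => -[x px <-] W.
rewrite sheet_sectionK // nbhsE => -[V [oV Vx] VW].
have oe : open (e @` (V `&` sheet p)).
  by apply: (etale_open eE); [apply: openI => //; exact: sheet_open | move=> ? [_ /sheet_sub]].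
have ex : (e @` (V `&` sheet p)) (e x) by exists x.
apply: filterS (open_nbhs_nbhs (conj oe ex)) => _ [z [Vz pz] <-].
by rewrite /= sheet_sectionK //; exact: VW.
Qed.

Definition etale_chart (p : etale_index) : chart R n N :=
  {| chart_dom := e @` sheet p ;
     chart_map := coords (sheet_chart p) \o sheet_section p ;
     chart_inv := e \o param (sheet_chart p) |}.

Definition etale_quotient : charted R n :=
  {| charted_space := N ; chart_index := etale_index ; atlas := etale_chart |}.

Lemma etale_chart_im p : chart_im (etale_chart p) = coords (sheet_chart p) @` sheet p.
Proof.
apply/seteqP; split=> [v [_ [x px <-] <-]|_ [x px <-]] /=.
  by rewrite sheet_sectionK //; exists x.
by exists (e x); [exists x|rewrite /= sheet_sectionK].
Qed.

Lemma sheet_coords_open p : open (coords (sheet_chart p) @` sheet p).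
Proof. by apply: coords_image_open => //; [exact: sheet_open | exact: sheet_dom]. Qed.

Lemma etale_is_chart p : is_chart (etale_chart p).
Proof.
split.
- exact: sheet_image_open.
- by rewrite etale_chart_im; exact: sheet_coords_open.
- move=> y; rewrite inE => -[x px <-] /=; rewrite sheet_sectionK //.
  by rewrite (paramK aX) //; exact: sheet_dom.
- have ps : {in sheet p, continuous (coords (sheet_chart p))}.
    apply: continuous_in_sub (@sheet_dom p) _.
    exact: chart_map_continuous (atlas_chart aX _).
  apply: continuous_in_comp (@sheet_section_continuous p) ps _.
  by move=> y py; have [_ _] := sheet_sectionP p y; apply.
- move=> v; rewrite etale_chart_im inE => -[x px <-] /=.
  have [_ _ _ _ ci] := atlas_chart aX (sheet_chart p).
  apply: continuous_comp.
    by apply/ci/mem_set; exists x => //; exact: sheet_dom.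
  rewrite -/(param _) (paramK aX) //; last exact: sheet_dom.
  by apply: (etale_continuous eE); apply/mem_set; exact: sheet_sub px.
Qed.

Lemma etale_sheet x : D x -> exists p, sheet p x.
Proof.
move=> Dx; have [i ix] := chart_at aX x.
have [U [oU Ux iU]] := etale_inj eE Dx.
have h : [/\ open (U `&` (D `&` dom i)), U `&` (D `&` dom i) `<=` D `&` dom i
           & {in U `&` (D `&` dom i) &, injective e}].
  split=> //.
    by apply: openI => //; apply: openI; [exact: etale_dom_open eE|exact: dom_open].
  move=> y z; rewrite !inE => -[Uy _] [Uz _]; apply: iU; exact/mem_set.
by exists (exist _ (i, U `&` (D `&` dom i)) h).
Qed.

(** Changing from one sheet to another is locally one of the identifying maps of
    X, which is why transition functions are smooth and isometric. *)
Lemma sheet_transition p' x : D x -> (e @` sheet p') (e x) ->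
  exists phi : X -> X, [/\ smooth_at phi x, isometric_at g g phi x, phi x = sheet_section p' (e x)
    & \forall z \near x, sheet_section p' (e z) = phi z].
Proof.
move=> Dx p'x; have [Dy ey p'y] := sheet_sectionP p' (e x).
have [phi [sp Ip px' np]] := etale_transition eE Dx Dy (esym ey).
exists phi; split=> //.
have n1 := continuous_near (smooth_at_continuous sp) px'
  (open_nbhs_nbhs (conj (sheet_open p') (p'y p'x))).
by apply: filterS2 n1 np => z p'z [_ <-]; rewrite sheet_sectionK.
Qed.

Lemma etale_smooth_atlas : smooth_atlas etale_quotient.
Proof.
split=> [y|p|p p'].
- have [x Dx <-] := etale_surj eE y; have [p px] := etale_sheet Dx.
  by exists p; exists x.
- exact: etale_is_chart.
- apply: smooth_on_local => v [_ [[x px <-] p'x] <-].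
  have [phi [sp _ px' np]] := sheet_transition (sheet_sub px) p'x.
  have [_ _ p'y] := sheet_sectionP p' (e x).
  have ix := sheet_dom px.
  have jy : dom (sheet_chart p') (phi x) by rewrite px'; exact/sheet_dom/p'y.
  have [V [oV Vx Vi sV]] := smooth_at_local_expr aX aX sp ix jy.
  have [W [oW Wx npW]] := near_open np.
  pose W' := W `&` dom (sheet_chart p).
  have oW' : open (coords (sheet_chart p) @` W').
    apply: coords_image_open => //; last by move=> ? [].
    by apply: openI => //; exact: dom_open.
  exists (V `&` coords (sheet_chart p) @` W'); split.
    by rewrite /= sheet_sectionK //; split=> //; exists x.
  apply: (@smooth_on_eq _ _ _ _ (local_expr (sheet_chart p) (sheet_chart p') phi)).
  + exact: openI.
  + by move=> _ [_ [z [Wz iz] <-]]; rewrite /local_expr /= -/(param _) (paramK aX iz) npW.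
  + by apply: smooth_on_sub sV => ? [].
Qed.

Lemma etale_local_diffeo x : D x -> local_diffeo (Y := etale_quotient) e x.
Proof.
move=> Dx; have [p px] := etale_sheet Dx.
have ip := sheet_dom px; have aN := etale_smooth_atlas.
have pex : @dom _ _ etale_quotient p (e x) by exists x.
have oim := @sheet_coords_open p.
split.
  apply: (smooth_at_chart aX aN ip pex).
    apply: filterS (open_nbhs_nbhs (conj (etale_dom_open eE) Dx)) => z Dz.
    exact/(etale_continuous eE)/mem_set.
  exists (coords (sheet_chart p) @` sheet p); first by split=> //; exists x.
  apply: (@smooth_on_eq _ _ _ _ (fun v => v)) => //; last exact: smooth_on_id.
  move=> _ [z pz <-]; rewrite /local_expr /= /coords /= -/(coords _) -/(param _).
  by rewrite (paramK aX (sheet_dom pz)) sheet_sectionK.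
exists (sheet_section p); split.
- have ip' : dom (sheet_chart p) (sheet_section p (e x)) by rewrite sheet_sectionK.
  apply: (smooth_at_chart (X := etale_quotient) aN aX pex ip').
    apply: filterS (open_nbhs_nbhs (conj (sheet_image_open p) pex)) => z pz.
    exact/(@sheet_section_continuous p)/mem_set.
  exists (coords (sheet_chart p) @` sheet p).
    by split=> //; exists x => //; rewrite /coords /= sheet_sectionK.
  apply: (@smooth_on_eq _ _ _ _ (fun v => v)) => //; last exact: smooth_on_id.
  move=> _ [z pz <-]; rewrite /local_expr /param /= -/(coords _) -/(param _).
  by rewrite (paramK aX (sheet_dom pz)) sheet_sectionK.
- apply: filterS (open_nbhs_nbhs (conj (sheet_open p) px)) => z pz.
  exact: sheet_sectionK.
- apply: filterS (open_nbhs_nbhs (conj (sheet_image_open p) pex)) => z pz.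
  by have [] := sheet_sectionP p z.
Qed.

Lemma etale_smooth_function (w : X -> R) (u : N -> R) :
  (forall x, D x -> u (e x) = w x) -> smooth_function w ->
  smooth_function (X := etale_quotient) u.
Proof.
move=> uw sw p; rewrite etale_chart_im.
have sw' : smooth_on (coords (sheet_chart p) @` sheet p)
    (w \o param (sheet_chart p) : 'rV[R]_n -> R^o).
  apply: smooth_on_sub (sw (sheet_chart p)) => _ [x px <-].
  by exists x => //; exact: sheet_dom.
apply: smooth_on_eq sw'; first exact: sheet_coords_open.
move=> _ [x px <-]; rewrite /param /= -/(param _) (paramK aX (sheet_dom px)).
by rewrite uw //; exact: sheet_sub px.
Qed.

Definition etale_metric : metric_field etale_quotient :=
  fun p y => g (sheet_chart p) (sheet_section p y).

Lemma etale_isometric_at x : D x -> isometric_at g etale_metric e x.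
Proof.
move=> Dx i p ix px.
have [phi [sp Ip px' np]] := sheet_transition Dx px.
have [_ _ py] := sheet_sectionP p (e x).
have jx : dom (sheet_chart p) (phi x) by rewrite px'; exact/sheet_dom/py.
have nE : \forall v \near coords i x,
    local_expr (Y := etale_quotient) i p e v = local_expr i (sheet_chart p) phi v.
  by apply: filterS (local_expr_near aX ix np) => v [_ e']; rewrite /local_expr /= -e'.
have sN : smooth_at (Y := etale_quotient) e x by have [] := etale_local_diffeo Dx.
rewrite (near_eq_jacobian nE (local_expr_differentiable aX etale_smooth_atlas sN ix px)).
by rewrite (Ip i _ ix jx) /etale_metric px'.
Qed.

Lemma etale_metric_tensor : metric_tensor g -> metric_tensor etale_metric.
Proof.
move=> [symg smg _]; split.
- by move=> p _ [x px <-]; rewrite /etale_metric sheet_sectionK //; apply/symg/sheet_dom.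
- move=> p; rewrite etale_chart_im.
  have sg : smooth_on (coords (sheet_chart p) @` sheet p) (g (sheet_chart p) \o param (sheet_chart p)).
    apply: smooth_on_sub (smg (sheet_chart p)) => _ [x px <-].
    by exists x => //; exact: sheet_dom.
  apply: smooth_on_eq sg; first exact: sheet_coords_open.
  move=> _ [x px <-]; rewrite /etale_metric /param /= -/(param _) (paramK aX (sheet_dom px)).
  by rewrite sheet_sectionK.
- apply/preserves_metricP => y _.
  have [x Dx <-] := etale_surj eE y.
  have [se [h [sh he eh]]] := etale_local_diffeo Dx.
  have aN := etale_smooth_atlas.
  have Ie := etale_isometric_at Dx.
  have Ih := isometric_at_inverse aX aN se sh he Ie.
  have hx : h (e x) = x := nbhs_singleton he.
  have se' : smooth_at (Y := etale_quotient) e (h (e x)) by rewrite hx.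
  apply: (@isometric_at_eq _ _ etale_quotient etale_quotient _ _ aN aN (e \o h)) => //.
    exact: smooth_at_comp.
  by apply: (isometric_at_comp aN aX aN sh se' Ih); rewrite hx.
Qed.

End etale_quotient.

End etale.

(** * Coverings and lifts of homotopies *)

Section lifting.
Variable R : realType.

Lemma min_continuous (T : topologicalType) (f g : T -> R) x :
  {for x, continuous f} -> {for x, continuous g} ->
  {for x, continuous (fun z => Num.min (f z) (g z))}.
Proof. by move=> cf cg; exact: continuous_min. Qed.

Lemma max_continuous (T : topologicalType) (f g : T -> R) x :
  {for x, continuous f} -> {for x, continuous g} ->
  {for x, continuous (fun z => Num.max (f z) (g z))}.
Proof. by move=> cf cg; exact: continuous_max. Qed.

(** Every point over U lies on a section over U that is also a local inverse of r
    near that point; this is all that lifting needs from an even covering. *)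
Record covering (Y B : topologicalType) (r : Y -> B) : Prop := Covering {
  covering_continuous : continuous r ;
  covering_sheet : forall b, exists U, [/\ open U, U b & forall y, U (r y) ->
    exists s : B -> Y, [/\ {in U, continuous s}, forall b', U b' -> r (s b') = b',
      s (r y) = y & \forall y' \near y, s (r y') = y'] ] }.

(** Over r(V), with r injective on V, the sections are the translates of the
    inverse of r on V. *)
Lemma covering_of_orbits (Y B : topologicalType) (r : Y -> B) (H : set (Y -> Y)) :
  continuous r -> (forall U, open U -> open (r @` U)) -> (forall b, exists y, r y = b) ->
  (forall h, H h -> continuous h /\ exists h', [/\ continuous h', cancel h h' & cancel h' h]) ->
  (forall h y, H h -> r (h y) = r y) ->
  (forall y z, r y = r z -> exists2 h, H h & h y = z) ->
  (forall y, exists V, [/\ open V, V y & {in V &, injective r}]) ->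
  covering r.
Proof.
move=> cr or sr cH rH orbH inj; split=> // b.
have [y0 <-] := sr b; have [V [oV Vy0 rV]] := inj y0.
exists (r @` V); split; [exact: or|by exists y0|move=> y [v Vv rvy]].
have [h Hh hv] := orbH v y rvy; have [ch [h' [ch' hK h'K]]] := cH h Hh.
have [t tP] : {t : B -> Y | forall v, V v -> t (r v) = v}.
  have /choice[t tP] : forall b, exists v, forall v', V v' -> r v' = b -> v = v'.
    move=> b'; have [[v' [Vv' vb]]|nb] := pselect (exists v', V v' /\ r v' = b').
      by exists v' => w Vw rw; apply: rV; rewrite ?inE // vb rw.
    by exists y0 => w Vw rw; exfalso; apply: nb; exists w.
  by exists t => w Vw; exact: tP Vw erefl.
exists (h \o t); split.
- move=> _ /set_mem[w Vw <-]; apply: continuous_comp; last exact: ch.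
  move=> W; rewrite (tP _ Vw) nbhsE => -[V' [oV' V'w] V'W].
  have rw : (r @` (V' `&` V)) (r w) by exists w.
  apply: filterS (open_nbhs_nbhs (conj (or _ (openI oV' oV)) rw)) => _ [z [V'z Vz] <-].
  by rewrite /= tP //; exact: V'W.
- by move=> _ [w Vw <-]; rewrite /= tP // rH.
- by rewrite -rvy /= tP.
- have Vh'y : V (h' y) by rewrite -hv hK.
  have n1 := continuous_near (ch' y) erefl (open_nbhs_nbhs (conj oV Vh'y)).
  by apply: filterS n1 => z Vz; rewrite -{1}(h'K z) rH //= tP // h'K.
Qed.

Lemma connected_real : connected [set: R].
Proof. by apply/connected_intervalP => x y _ _ z _. Qed.

(** Two lifts agree on an open set, because r has local inverses, and disagree
    on an open set, because Y is Hausdorff. *)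
Lemma lift_unique (Z Y B : topologicalType) (r : Y -> B) (g h : Z -> Y) z0 :
  covering r -> hausdorff_space Y -> connected [set: Z] ->
  continuous g -> continuous h -> (forall z, r (g z) = r (h z)) -> g z0 = h z0 ->
  forall z, g z = h z.
Proof.
move=> cr hY cZ cg ch rgh gh0.
apply: (@clopen_connected _ [set z | g z = h z] z0) => //.
  rewrite openE => z /= e.
  have [U [oU Uz US]] := covering_sheet cr (r (g z)).
  have [s [_ _ _ ns]] := US _ Uz.
  have n1 := continuous_near (cg z) erefl ns.
  have n2 := continuous_near (ch z) (esym e) ns.
  by apply: filterS2 n1 n2 => w /= <- <-; rewrite rgh.
rewrite openE => z /= ne.
have gh : g z != h z by exact/eqP.
move: (hY); rewrite open_hausdorff => /(_ _ _ gh) [[A A'] /= [Ag Ah] [oA oA' /eqP AA]].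
rewrite !inE in Ag Ah.
have n1 := continuous_near (cg z) erefl (open_nbhs_nbhs (conj oA Ag)).
have n2 := continuous_near (ch z) erefl (open_nbhs_nbhs (conj oA' Ah)).
apply: filterS2 n1 n2 => w /= Aw A'w e.
by have : (A `&` A') (g w) by [split=> //; rewrite e]; rewrite AA.
Qed.

Definition clamp (v : R) : R := Num.max 0 (Num.min v 1).

Lemma clamp_min v : clamp (Num.min v 1) = clamp v.
Proof. by rewrite /clamp -minA minxx. Qed.

Lemma clamp_le0 v : v <= 0 -> clamp v = 0.
Proof. by move=> v0; rewrite /clamp max_l // ge_min v0. Qed.

Lemma clamp_ge1 v : 1 <= v -> clamp v = 1.
Proof. by move=> v1; rewrite /clamp min_r // max_r. Qed.

Lemma clamp_id v : 0 <= v -> v <= 1 -> clamp v = v.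
Proof. by move=> v0 v1; rewrite /clamp min_l // max_r. Qed.

Section lift.
Variables (Z Y B : topologicalType) (r : Y -> B).
Hypotheses (cr : covering r) (hY : hausdorff_space Y).
Variables (P : R * Z -> B) (y : Z -> Y).
Hypotheses (cP : continuous P) (cy : continuous y) (y0 : forall z, r (y z) = P (0, z)).

(** A lift of P on ]-oo, u] x W for a neighbourhood W of z0, extended constantly
    below 0 and above u so that it is defined, and continuous, on all of R x W. *)
Definition partial_lift (z0 : Z) (u : R) := exists (W : set Z) (G : R * Z -> Y),
  [/\ open W /\ W z0, forall v z, W z -> {for (v, z), continuous G},
   forall v z, W z -> r (G (v, z)) = P (Num.max 0 (Num.min v u), z)
   & forall v z, W z -> v <= 0 -> G (v, z) = y z].

Lemma partial_lift_le z0 u u' : u' <= u -> partial_lift z0 u -> partial_lift z0 u'.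
Proof.
move=> uu [W [G [oW cG rG G0]]]; exists W, (fun z => G (Num.min z.1 u', z.2)); split=> //=.
- move=> v z Wz.
  apply: (@continuous_comp _ _ _ (fun z : R * Z => (Num.min z.1 u', z.2)) G); last exact: cG.
  apply: pair_continuous; last exact: (@continuous_snd R Z (v, z)).
  by apply: min_continuous; [exact: (@continuous_fst R Z (v, z)) | exact: cst_continuous].
- by move=> v z Wz; rewrite rG // -minA (min_idPl uu).
- by move=> v z Wz v0; apply: G0 => //; rewrite ge_min v0.
Qed.

Lemma partial_lift0 z0 u : u <= 0 -> partial_lift z0 u.
Proof.
move=> u0; exists setT, (fun z => y z.2); split=> //.
- by split=> //; exact: openT.
- move=> v z _; apply: continuous_comp; [exact: (@continuous_snd R Z (v, z)) | exact: cy].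
- by move=> v z _ /=; rewrite y0 max_l // ge_min u0 orbT.
Qed.

(** P is evenly covered near (u, z0); a lift up to time u0 is continued by the
    section through its value at (u0, z0), after shrinking W. As the size d of
    the step depends only on u, the set of times with a partial lift is both
    open and closed. *)
Lemma partial_lift_step z0 u : exists2 d, 0 < d & forall u0 u1,
  `|u - u0| < d -> `|u - u1| < d -> partial_lift z0 u0 -> partial_lift z0 u1.
Proof.
have cmax : continuous (fun w : R => Num.max 0 w).
  by move=> w; apply: max_continuous; [exact: cst_continuous | exact: cvg_id].
pose Q (w : R * Z) := P (Num.max 0 w.1, w.2).
have cQ : continuous Q.
  move=> w; apply: (@continuous_comp _ _ _ (fun w : R * Z => (Num.max 0 w.1, w.2)) P); last exact: cP.
  apply: pair_continuous; last exact: (@continuous_snd R Z w).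
  by apply: (@continuous_comp _ _ _ (@fst R Z)); [exact: (@continuous_fst R Z w) | exact: cmax].
have [U [oU Ub US]] := covering_sheet cr (Q (u, z0)).
have := cQ (u, z0) _ (open_nbhs_nbhs (conj oU Ub)).
case=> -[N1 N2] [/= /nbhs_ballP[d /= d0 dN1] nN2] NU.
exists d => // u0 u1 du0 du1 [W [G [[oW Wz0] cG rG G0]]].
have [u10|u01] := leP u1 u0.
  by apply: (partial_lift_le u10); exists W, G.
have Uball v z : `|u - v| < d -> N2 z -> U (Q (v, z)).
  by move=> dv Nz; apply: NU; split=> //=; apply: dN1; rewrite -ball_normE.
have N2z0 : N2 z0 := nbhs_singleton nN2.
have rGu z : W z -> r (G (u0, z)) = Q (u0, z).
  by move=> Wz; rewrite rG // minxx.
have [s [cs rs sG ns]] : exists s : B -> Y, [/\ {in U, continuous s},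
    forall b', U b' -> r (s b') = b', s (r (G (u0, z0))) = G (u0, z0)
    & \forall y' \near G (u0, z0), s (r y') = y'].
  by apply: US; rewrite rGu //; exact: Uball.
have cGu : {for z0, continuous (fun z => G (u0, z))}.
  apply: (@continuous_comp _ _ _ (fun z : Z => (u0, z)) G); last exact: cG.
  by apply: pair_continuous; [exact: cst_continuous | exact: cvg_id].
have n1 := continuous_near cGu erefl ns.
have : \forall z \near z0, [/\ W z, N2 z & s (r (G (u0, z))) = G (u0, z)].
  have nW := open_nbhs_nbhs (conj oW Wz0).
  by near=> z; split; near: z.
move=> /near_open[W' [oW' W'z0 W'P]].
pose G' (w : R * Z) := if w.1 <= u0 then G w else s (Q (Num.min w.1 u1, w.2)).
have mind v : u0 <= v -> `|u - Num.min v u1| < d.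
  move=> v0; have [m1 m2] : u0 <= Num.min v u1 /\ Num.min v u1 <= u1.
    by rewrite le_min v0 ltW // ge_min lexx orbT.
  move: du0 du1; rewrite !ltr_norml => /andP[a1 a2] /andP[b1 b2].
  by apply/andP; split; lra.
have cs' v z : W' z -> u0 <= v -> {for (v, z), continuous (fun w => s (Q (Num.min w.1 u1, w.2)))}.
  move=> W'z v0; have [Wz Nz _] := W'P z W'z.
  apply: (@continuous_comp _ _ _ (fun w : R * Z => Q (Num.min w.1 u1, w.2)) s).
    apply: (@continuous_comp _ _ _ (fun w : R * Z => (Num.min w.1 u1, w.2)) Q); last exact: cQ.
    apply: pair_continuous; last exact: (@continuous_snd R Z (v, z)).
    by apply: min_continuous; [exact: (@continuous_fst R Z (v, z)) | exact: cst_continuous].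
  by apply/cs/mem_set; apply: Uball => //; exact: mind.
exists W', G'; split=> //.
- move=> v z W'z; have [Wz Nz sz] := W'P z W'z.
  case: (ltgtP v u0) => vu0.
  + apply: (@near_continuous _ _ G); last exact: cG.
    have nv : \forall w \near ((v, z) : R * Z), w.1 < u0.
      by apply: (@near_fst R Z (v, z) (fun w => w < u0)); exact: lt_nbhsl.
    by apply: filterS nv => w wu; rewrite /G' ltW.
  + apply: (@near_continuous _ _ (fun w => s (Q (Num.min w.1 u1, w.2)))); last by apply: cs' => //; exact: ltW.
    have nv : \forall w \near ((v, z) : R * Z), u0 < w.1.
      by apply: (@near_fst R Z (v, z) (fun w => u0 < w)); exact: lt_nbhsr.
    by apply: filterS nv => w wu; rewrite /G' leNgt wu.
  + apply: if_continuous; [exact: cG|by apply: cs' => //; rewrite vu0|].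
    by rewrite /= vu0 min_l ?ltW // -rGu.
- move=> v z W'z; have [Wz Nz sz] := W'P z W'z; rewrite /G' /=; case: leP => vu0.
    by rewrite rG // (min_idPl vu0) min_l //; lra.
  by rewrite rs //; apply: Uball => //; apply: mind; exact: ltW.
- move=> v z W'z v0; have [Wz Nz sz] := W'P z W'z; rewrite /G' /=; case: leP => vu0.
    exact: G0.
  have u00 : u0 <= 0 by lra.
  rewrite -(G0 u0 z Wz u00) -sz rGu // /Q /= !max_l //.
  by rewrite ge_min v0.
Unshelve. all: by end_near. Qed.

Lemma partial_lift_all z0 u : partial_lift z0 u.
Proof.
apply: (@clopen_connected _ [set u | partial_lift z0 u] 0); first exact: connected_real.
- exact: partial_lift0.
- rewrite openE => v /= Lv; have [d d0 h] := partial_lift_step z0 v.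
  apply/nbhs_ballP; exists d => //= w; rewrite -ball_normE /= => dw.
  by apply: (h v w) => //; rewrite subrr normr0.
- rewrite openE => v /= Lv; have [d d0 h] := partial_lift_step z0 v.
  apply/nbhs_ballP; exists d => //= w; rewrite -ball_normE /= => dw Lw; apply: Lv.
  by apply: (h w v) => //; rewrite subrr normr0.
Qed.

(** The local lifts at different z0 agree where both are defined by uniqueness
    of path lifting, so they glue. *)
Lemma lift_exists : exists G : R * Z -> Y, [/\ continuous G,
  forall v z, r (G (v, z)) = P (clamp v, z)
  & forall v z, v <= 0 -> G (v, z) = y z].
Proof.
have /choice[W /choice[G GP]] := fun z => partial_lift_all z 1.
have GG z0 z v : W z0 z -> G z (v, z) = G z0 (v, z).
  move=> Wz; have [[oW Wz0] cG rG G0] := GP z0; have [[_ Wzz] cGz rGz Gz0] := GP z.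
  have cpair : continuous (fun v : R => (v, z)).
    by move=> w; apply: pair_continuous; [exact: cvg_id | exact: cst_continuous].
  apply: (@lift_unique R Y B r (fun v => G z (v, z)) (fun v => G z0 (v, z)) 0) => //.
  - exact: connected_real.
  - by move=> w; apply: (@continuous_comp _ _ _ (fun v : R => (v, z)) (G z)); [exact: cpair|exact: cGz].
  - by move=> w; apply: (@continuous_comp _ _ _ (fun v : R => (v, z)) (G z0)); [exact: cpair|exact: cG].
  - by move=> w; rewrite rG // rGz.
  - by rewrite G0 // Gz0.
exists (fun w => G w.2 w); split.
- move=> [v z0]; have [[oW Wz0] cG _ _] := GP z0.
  apply: (@near_continuous _ _ (G z0)); last exact: cG.
  have nW : \forall w \near ((v, z0) : R * Z), W z0 w.2.
    by apply: (@near_snd R Z (v, z0)); exact: open_nbhs_nbhs.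
  by apply: filterS nW => -[w z] /= Wz; rewrite (GG z0).
- by move=> v z /=; have [[_ Wz] _ rG _] := GP z; exact: rG.
- by move=> v z /=; have [[_ Wz] _ _ G0] := GP z; exact: G0.
Qed.

End lift.

(** The loop parameter t, not the homotopy parameter s, is the one lifted along.
    The endpoints of the lifts at t = 1 form a lift of a constant path, hence do
    not depend on s. *)
Lemma homotopy_lift (Y B : topologicalType) (r : Y -> B) (H : R * R -> B) y0 :
  covering r -> hausdorff_space Y -> continuous H ->
  (forall s t, t <= 0 \/ 1 <= t -> H (s, t) = r y0) ->
  exists G : R * R -> Y, [/\ continuous G, forall z, r (G z) = H z,
    forall s t, t <= 0 -> G (s, t) = y0 & forall s t, 1 <= t -> G (s, t) = G (0, 1)].
Proof.
move=> cr hY cH Hx.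
pose P (w : R * R) := H (w.2, w.1).
have cP : continuous P.
  move=> w; apply: (@continuous_comp _ _ _ (fun w : R * R => (w.2, w.1)) H); last exact: cH.
  by apply: pair_continuous; [exact: (@continuous_snd R R w)|exact: (@continuous_fst R R w)].
have e0 z : r y0 = P (0, z) by rewrite /P /= Hx //; left.
have cy : continuous (fun _ : R => y0) by move=> ?; exact: cst_continuous.
have [G [cG rG G0]] := lift_exists cr hY cP cy e0.
pose K (w : R * R) := G (Num.min w.2 1, w.1).
have cK : continuous K.
  move=> w; apply: (@continuous_comp _ _ _ (fun w : R * R => (Num.min w.2 1, w.1)) G); last exact: cG.
  apply: pair_continuous; last exact: (@continuous_fst R R w).
  by apply: min_continuous; [exact: (@continuous_snd R R w)|exact: cst_continuous].
have rK z : r (K z) = H z.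
  case: z => s t; rewrite /K rG /P /=.
  rewrite clamp_min.
  have [t0|t0] := leP t 0; first by rewrite clamp_le0 // !Hx //; left.
  have [t1|t1] := leP 1 t; first by rewrite clamp_ge1 // !Hx //; right.
  by rewrite clamp_id // ltW.
have K1 s : K (s, 1) = K (0, 1).
  have cpair : continuous (fun s : R => (s, 1 : R)).
    by move=> w; apply: pair_continuous; [exact: cvg_id | exact: cst_continuous].
  apply: (@lift_unique R Y B r (fun s => K (s, 1)) (fun _ => K (0, 1)) 0) => //.
  - exact: connected_real.
  - by move=> w; apply: (@continuous_comp _ _ _ (fun s : R => (s, 1 : R)) K); [exact: cpair|exact: cK].
  - by move=> w; exact: cst_continuous.
  - by move=> w; rewrite !rK !Hx //; right.
exists K; split=> //.
- by move=> s t t0; rewrite /K /= G0 // ge_min t0.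
- by move=> s t t1; rewrite -(K1 s) /K /= minxx min_r.
Qed.

End lifting.

(** * Fundamental groups of a space covered by a product *)

(** Stated for a set S, so that the normal subgroup can be given as the image of
    another homomorphism. *)
Lemma first_isomorphism (G H : groupType) (f : G -> H) (S : set G) :
  {morph f : a b / (a * b)%g} -> (forall h, exists g, f g = h) ->
  (forall g, S g <-> f g = 1%g) ->
  exists2 N : normal_subgroup G, normal_set N = S &
    exists theta : quotient_group N -> H,
      [/\ bijective theta, {morph theta : a b / (a * b)%g}
        & forall u, theta (\pi_(quotient_group N) u) = f u].
Proof.
move=> fM fS SK.
have f1 : f 1%g = 1%g by apply: (@mulgI _ (f 1%g)); rewrite -fM !mulg1.
have fV a : f (a^-1)%g = ((f a)^-1)%g.
  by apply: (@mulgI _ (f a)); rewrite -fM !mulgV f1.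
have S1 : S 1%g by apply/SK.
have SM a b : S a -> S b -> S (a * b)%g.
  by move=> /SK ea /SK eb; apply/SK; rewrite fM ea eb mulg1.
have SV a : S a -> S (a^-1)%g.
  by move=> /SK ea; apply/SK; rewrite fV ea invg1.
have SJ a b : S a -> S (b^-1 * a * b)%g.
  by move=> /SK ea; apply/SK; rewrite !fM ea mulg1 fV mulVg.
pose N := NormalSubgroup S1 SM SV SJ; exists N => //.
have thE u : f (repr (\pi_(quotient_group N) u)) = f u.
  have /SK := repr_cosetP N u; rewrite fM fV => /(congr1 (fun z => f u * z)%g).
  by rewrite mulgA mulgV mul1g mulg1.
pose theta (c : quotient_group N) := f (repr c).
exists theta; split=> [|c d|u]; last exact: thE.
- have /choice[h hP] := fS.
  exists (fun z => \pi_(quotient_group N) (h z)) => [c|z]; last by rewrite /theta thE hP.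
  rewrite /theta -[RHS]reprK; apply/pi_cosetP/SK.
  by rewrite fM fV hP mulVg.
- have [a ->] := pi_surj c; have [b ->] := pi_surj d.
  have -> : (\pi_(quotient_group N) a * \pi_(quotient_group N) b)%g = \pi_(quotient_group N) (a * b)%g.
    exact: quotient_mul_pi.
  by rewrite /theta !thE.
Qed.

Section pi1.
Variable R : realType.

Lemma loop_eq_homotopic (T : topologicalType) (x : T) (a b : loop R x) :
  (forall t, a t = b t) -> loop_homotopic a b.
Proof.
move=> ab; apply/loop_homotopicP; exists (fun z => a z.2); split=> //.
- move=> z; apply: continuous_comp; [exact: (@continuous_snd R R z)|exact: loop_continuous].
- by move=> s t /loop_base.
Qed.

Section map.
Variables (T U : topologicalType) (f : T -> U) (cf : continuous f) (x : T).

Lemma loop_map_homotopic (a b : loop R x) :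
  loop_homotopic a b -> loop_homotopic (loop_map cf a) (loop_map cf b).
Proof.
move=> /loop_homotopicP[H [cH H0 H1 Hx]]; apply/loop_homotopicP.
exists (f \o H); split=> [z|t|t|s t h] /=.
- by apply: continuous_comp; [exact: cH|exact: cf].
- by rewrite H0.
- by rewrite H1.
- by rewrite Hx.
Qed.

Lemma pi1_map_pi (a : loop R x) :
  pi1_map cf x (\pi_(fundamental_group R x) a) = \pi_(fundamental_group R (f x)) (loop_map cf a).
Proof. by apply/pi_loopP/loop_map_homotopic; exact: repr_loopP. Qed.

Lemma pi1_mapM : {morph (pi1_map cf x : fundamental_group R x -> fundamental_group R (f x)) :
  u v / (u * v)%g}.
Proof.
move=> u v; have [a ->] := pi1_surj u; have [b ->] := pi1_surj v.
have -> : (\pi_(fundamental_group R x) a * \pi_(fundamental_group R x) b)%g =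
    \pi_(fundamental_group R x) (loop_mul a b) by exact: pi1_mul_pi.
rewrite !pi1_map_pi.
have -> : (\pi_(fundamental_group R (f x)) (loop_map cf a) *
    \pi_(fundamental_group R (f x)) (loop_map cf b))%g =
    \pi_(fundamental_group R (f x)) (loop_mul (loop_map cf a) (loop_map cf b)) by exact: pi1_mul_pi.
by apply/pi_loopP/loop_eq_homotopic => t /=; case: ifP.
Qed.

End map.

Section covered_bundle.
Variables (X1 X2 M L : topologicalType) (q : X1 * X2 -> M) (r : X2 -> L) (eta : M -> L).
Hypotheses (cq : covering q) (cr : covering r) (h1 : hausdorff_space X1) (h2 : hausdorff_space X2).
Hypotheses (ceta : continuous eta) (eta_q : forall a b, eta (q (a, b)) = r b).
Variables (a0 : X1) (b0 : X2) (F : set M).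
Hypotheses (F_slice : forall a, F (q (a, b0))) (eta_F : forall y, F y -> eta y = r b0).
Hypothesis path_deck : forall b, r b = r b0 -> exists (a : X1) (alpha : R -> X1),
  [/\ continuous alpha, forall t, t <= 0 -> alpha t = a0,
      forall t, 1 <= t -> alpha t = a & q (a, b) = q (a0, b0)].
Variables (x : M) (xF : x \in F).
Hypothesis xE : q (a0, b0) = x.

Let hX : hausdorff_space (X1 * X2)%type := hausdorff_prod h1 h2.
Let i : fundamental_group R (exist _ x xF : F) -> fundamental_group R x :=
  pi1_map (@leaf_inclusion_continuous M F) (exist _ x xF).
Let etas : fundamental_group R x -> fundamental_group R (eta x) := pi1_map ceta x.

Let eta_qE z : eta (q z) = r z.2. Proof. by case: z => a b; exact: eta_q. Qed.

Let etax : eta x = r b0. Proof. by rewrite -xE eta_q. Qed.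

Let slice_continuous (g : R * R -> X1 * X2) (b : X2) :
  continuous g -> continuous (fun z => q ((g z).1, b)).
Proof.
move=> cg z; apply: (@continuous_comp _ _ _ (fun z => ((g z).1, b)) q); last exact: covering_continuous.
apply: pair_continuous; last exact: cst_continuous.
by apply: continuous_comp; [exact: cg|exact: continuous_fst].
Qed.

Let line_continuous (T : topologicalType) (s : R) (G : R * R -> T) :
  continuous G -> continuous (fun t => G (s, t)).
Proof.
move=> cG t; apply: (@continuous_comp _ _ _ (fun t : R => (s, t)) G); last exact: cG.
by apply: pair_continuous; [exact: cst_continuous | exact: cvg_id].
Qed.

(** A homotopy in M between loops of F lifts to (A, B) in X1 * X2, and B is
    constant over both loops; freezing the second coordinate pushes the
    homotopy into F. *)
Lemma pi1_fibre_injective : injective i.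
Proof.
move=> u v; have [g ->] := pi1_surj u; have [g' ->] := pi1_surj v.
rewrite /i !pi1_map_pi => /pi_loopP/loop_homotopicP[H [cH H0 H1 Hx]].
have Hb s t : t <= 0 \/ 1 <= t -> H (s, t) = q (a0, b0) by move=> h; rewrite xE Hx.
have [G [cG qG G0 G1]] := homotopy_lift cq hX cH Hb.
have rG z : r (G z).2 = eta (H z) by rewrite -qG eta_qE.
have cG2 s : continuous (fun t => (G (s, t)).2).
  by move=> t; apply: continuous_comp; [exact: (line_continuous (s := s) cG) | exact: continuous_snd].
have edge s : (forall t, F (H (s, t))) -> forall t, (G (s, t)).2 = b0.
  move=> FH; apply: (@lift_unique R _ _ r _ (fun=> b0) 0 cr h2) => //.
  - exact: connected_real.
  - by move=> t; exact: cst_continuous.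
  - by move=> t; rewrite rG eta_F.
  - by rewrite G0.
have e0 : forall t, (G (0, t)).2 = b0.
  by apply: edge => t; rewrite H0 /=; exact/set_mem/(svalP (g t)).
have e1 : forall t, (G (1, t)).2 = b0.
  by apply: edge => t; rewrite H1 /=; exact/set_mem/(svalP (g' t)).
pose K z : F := exist _ (q ((G z).1, b0)) (mem_set (F_slice (G z).1)).
have KE (y : F) z : q ((G z).1, b0) = sval y -> K z = y.
  by move=> e; exact: set_type_eq.
apply/pi_loopP/loop_homotopicP; exists K; split.
- exact/set_type_map_continuous/slice_continuous.
- by move=> t; apply: KE; rewrite -(e0 t) -surjective_pairing qG H0.
- by move=> t; apply: KE; rewrite -(e1 t) -surjective_pairing qG H1.
- move=> s t h; apply: KE => /=; case: h => h; first by rewrite G0.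
  by rewrite (G1 _ _ h) -(e0 1) -surjective_pairing qG Hx //; right.
Qed.

(** Let (alpha, beta) lift g, and let B lift a contraction of the image of g in L.
    By uniqueness of lifts B starts at beta, and it ends at the constant b0, so
    q(alpha, B) deforms g into a loop of F. *)
Lemma pi1_fibre_kernel u : range i u <-> etas u = 1%g.
Proof.
split=> [[w _ <-]|].
  have [g ->] := pi1_surj w; rewrite /i /etas !pi1_map_pi.
  apply/pi_loopP/loop_eq_homotopic => t /=.
  by rewrite eta_F ?etax //; exact/set_mem/(svalP (g t)).
have [g ->] := pi1_surj u; rewrite /etas pi1_map_pi.
move=> /pi_loopP/loop_homotopicP[H [cH H0 H1 Hx]].
have cg : continuous (fun z : R * R => g z.2).
  by move=> z; apply: continuous_comp; [exact: continuous_snd | exact: loop_continuous].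
have gb (s t : R) : t <= 0 \/ 1 <= t -> g (s, t).2 = q (a0, b0) by move=> h; rewrite xE /= loop_base.
have [G [cG qG G0 G1]] := homotopy_lift cq hX cg gb.
have Hb s t : t <= 0 \/ 1 <= t -> H (s, t) = r b0 by move=> h; rewrite -etax Hx.
have [B [cB rB B0 B1]] := homotopy_lift cr h2 cH Hb.
have e0 : forall t, (G (0, t)).2 = B (0, t).
  apply: (@lift_unique R _ _ r _ (fun t => B (0, t)) 0 cr h2) => //.
  - exact: connected_real.
  - by move=> t; apply: continuous_comp; [exact: (line_continuous (s := 0) cG) | exact: continuous_snd].
  - exact: (line_continuous (s := 0) cB).
  - by move=> t; rewrite rB H0 /= -eta_qE qG.
  - by rewrite G0 // B0.
have e1 : forall t, B (1, t) = b0.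
  apply: (@lift_unique R _ _ r _ (fun=> b0) 0 cr h2) => //.
  - exact: connected_real.
  - exact: (line_continuous (s := 1) cB).
  - by move=> t; exact: cst_continuous.
  - by move=> t; rewrite rB H1 /= etax.
  - by rewrite B0.
have G01 : (G (0, 1)).2 = b0 by rewrite e0 -(B1 1 1) // e1.
have qG01 : q ((G (0, 1)).1, b0) = x.
  by rewrite -G01 -surjective_pairing qG /= loop_base //; right.
have cG1 : continuous (fun t => (G (0, t)).1).
  by move=> t; apply: continuous_comp; [exact: (line_continuous (s := 0) cG) | exact: continuous_fst].
pose d t := q ((G (0, t)).1, b0).
have cd : continuous d.
  move=> t; apply: (@continuous_comp _ _ _ (fun t => ((G (0, t)).1, b0)) q); last exact: covering_continuous.
  by apply: pair_continuous; [exact: cG1 | exact: cst_continuous].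
have dx t : t <= 0 \/ 1 <= t -> d t = x.
  by case=> h; rewrite /d; [rewrite G0 | rewrite (G1 _ _ h)].
pose dF (t : R) : F := exist _ (d t) (mem_set (F_slice (G (0, t)).1)).
have cdF : continuous dF by exact: set_type_map_continuous.
have dFx t : t <= 0 \/ 1 <= t -> dF t = exist _ x xF.
  by move=> h; apply: set_type_eq; exact: dx.
exists (\pi_(fundamental_group R _) (Loop cdF dFx)) => //.
rewrite /i pi1_map_pi; apply/pi_loopP; rewrite loop_homotopic_sym.
apply/loop_homotopicP; exists (fun z => q ((G (0, z.2)).1, B z)); split.
- move=> z; apply: (@continuous_comp _ _ _ (fun z => ((G (0, z.2)).1, B z)) q); last exact: covering_continuous.
  apply: pair_continuous; last exact: cB.
  apply: (@continuous_comp _ _ _ (@snd R R) (fun t => (G (0, t)).1)); last exact: cG1.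
  exact: continuous_snd.
- by move=> t /=; rewrite -e0 -surjective_pairing qG.
- by move=> t /=; rewrite e1.
- move=> s t h /=; case: h => h; first by rewrite G0 // B0.
  by rewrite (G1 _ _ h) (B1 _ _ h) -(B1 1 1) // e1.
Qed.

(** The lift to X2 of a loop of L ends at a translate of b0; a path in X1 to the
    corresponding translate of a0 makes the pair a loop of M. *)
Lemma pi1_base_surjective w : exists u, etas u = w.
Proof.
have [d ->] := pi1_surj w.
have cd : continuous (fun z : R * R => d z.2).
  by move=> z; apply: continuous_comp; [exact: continuous_snd | exact: loop_continuous].
have db (s t : R) : t <= 0 \/ 1 <= t -> d (s, t).2 = r b0 by move=> h; rewrite -etax /= loop_base.
have [B [cB rB B0 B1]] := homotopy_lift cr h2 cd db.
have rb : r (B (0, 1)) = r b0 by rewrite rB -(db 0 1) //; right.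
have [a [alpha [ca al0 al1 qa]]] := path_deck rb.
pose g t := q (alpha t, B (0, t)).
have cg : continuous g.
  move=> t; apply: (@continuous_comp _ _ _ (fun t => (alpha t, B (0, t))) q); last exact: covering_continuous.
  by apply: pair_continuous; [exact: ca | exact: (line_continuous (s := 0) cB)].
have gx t : t <= 0 \/ 1 <= t -> g t = x.
  by case=> h; rewrite /g; [rewrite al0 // B0 | rewrite al1 // (B1 _ _ h) qa].
exists (\pi_(fundamental_group R x) (Loop cg gx)).
rewrite /etas pi1_map_pi; apply/pi_loopP/loop_eq_homotopic => t /=.
by rewrite /g eta_q rB.
Qed.

Lemma pi1_exact : injective i /\
  exists2 N : normal_subgroup (fundamental_group R x), normal_set N = range i &
    exists theta : quotient_group N -> fundamental_group R (eta x),
      [/\ bijective theta, {morph theta : a b / (a * b)%g} &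
          forall u, theta (\pi_(quotient_group N) u) = etas u].
Proof.
split; first exact: pi1_fibre_injective.
apply: first_isomorphism; [exact: pi1_mapM | exact: pi1_base_surjective | exact: pi1_fibre_kernel].
Qed.

End covered_bundle.
End pi1.

(** * Slices: block triangular matrices, balls and an added chart *)

Section linear_algebra.
Variable R : realType.

(** If A maps the first coordinate subspace to itself, its diagonal block there is
    invertible, hence the inverse also preserves the subspace. *)
Lemma inverse_block_triangular n m (A B : 'M[R]_(n + m)) :
  A *m B = 1%:M -> (forall u : 'rV_n, rsubmx (row_mx u 0 *m A) = 0) ->
  forall u : 'rV_n, rsubmx (row_mx u 0 *m B) = 0.
Proof.
move=> AB A0.
have rE (C : 'M[R]_(n + m)) (u : 'rV_n) : rsubmx (row_mx u 0 *m C) = u *m ursubmx C.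
  by rewrite -{1}(submxK C) mul_row_block !mul0mx !addr0 row_mxKr.
have A12 : ursubmx A = 0.
  by apply/row_matrixP => i; rewrite rowE -rE A0 row0.
have := AB; rewrite -{1}(submxK A) -{1}(submxK B) mulmx_block A12 !mul0mx !addr0.
rewrite scalar_mx_block => /eq_block_mx[/mulmx1_unit[uA _] A11B12 _ _] u.
by rewrite rE -(mulKmx uA (ursubmx B)) A11B12 mulmx0 mulmx0.
Qed.

Lemma ball_segment n (w0 w w' : 'rV[R]_n) e (t : R) :
  ball w0 e w -> ball w0 e w' -> 0 <= t <= 1 -> ball w0 e (w + t *: (w' - w)).
Proof.
rewrite mx_norm_ball /ball_ /= => b b' /andP[t0 t1].
have -> : w0 - (w + t *: (w' - w)) = (1 - t) *: (w0 - w) + t *: (w0 - w').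
  rewrite !scalerBr !scalerBl !scale1r opprD opprB.
  by apply/rowP => i; rewrite !mxE; ring.
apply: le_lt_trans (ler_normD _ _) _; rewrite !normrZ (ger0_norm t0) ger0_norm ?subr_ge0 //.
set x := `|_|; set y := `|_| in b' *.
have [->|t'] := eqVneq t 0; first by rewrite subr0 mul1r mul0r addr0.
have tp : 0 < t by rewrite lt_neqAle eq_sym t'.
have s1 : t * y < t * e by rewrite ltr_pM2l.
have s2 : (1 - t) * x <= (1 - t) * e by apply: ler_wpM2l; [rewrite subr_ge0|exact: ltW].
by apply: lt_le_trans (ler_ltD s2 s1) _; rewrite -mulrDl subrK mul1r.
Qed.

End linear_algebra.

Section add_chart.
Variables (R : realType) (n : nat) (X : charted R n) (c : chart R n X).
Hypotheses (aX : smooth_atlas X) (cP : is_chart c).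
Hypothesis cX : forall i, smooth_transition c (@atlas R n X i) /\ smooth_transition (@atlas R n X i) c.

(** With an adapted chart of a foliation added to the atlas, the general results
    on local expressions apply to it. *)
Definition add_chart : charted R n :=
  {| charted_space := X ; chart_index := option (chart_index X) ;
     atlas := fun o => if o is Some i then @atlas R n X i else c |}.

Lemma chart_self_transition : smooth_transition c c.
Proof.
have oim : open (chart_map c @` (chart_dom c `&` chart_dom c)) by rewrite setIid; case: cP.
apply: smooth_on_eq (smooth_on_id oim) => // v [x [cx _] <-] /=.
by rewrite chart_mapK.
Qed.

Lemma add_chart_atlas : smooth_atlas add_chart.
Proof.
have [cov isc tr] := aX; split.
- by move=> x; have [i ix] := cov x; exists (Some i).
- by case=> [i|]; [exact: isc | exact: cP].
- case=> [i|] [j|].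
  + exact: tr.
  + exact: (cX i).2.
  + exact: (cX j).1.
  + exact: chart_self_transition.
Qed.

Lemma add_chart_local_diffeo x : local_diffeo (Y := add_chart) (fun y : X => y) x.
Proof.
have aX' := add_chart_atlas; have [i ix] := chart_at aX x.
have i'x : @dom _ _ add_chart (Some i) x by exact: ix.
have oi : open (chart_im (@atlas R n X i)) by case: (atlas_chart aX i).
have cid : continuous (fun y : X => y) by move=> y; exact: cvg_id.
have sid : exists2 V, open V /\ V (coords i x) & smooth_on V (fun v => coords i (param i v)).
  exists (chart_im (@atlas R n X i)); first by split=> //; exists x.
  apply: smooth_on_eq (smooth_on_id oi) => // v iv.
  by apply/esym; exact: chart_invK (atlas_chart aX i) v iv.
split.
  by apply: (smooth_at_chart aX aX' ix i'x) => //; apply: near_everywhere => y; exact: cid.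
exists (fun y => y); split; [|exact: near_everywhere|exact: near_everywhere].
by apply: (smooth_at_chart aX' aX i'x ix) => //; apply: near_everywhere => y; exact: cid.
Qed.

End add_chart.

(** * Paths in connected manifolds *)

Section paths.
Variable R : realType.

Definition joined (T : topologicalType) (a b : T) := exists alpha : R -> T,
  [/\ continuous alpha, forall t : R, t <= 0 -> alpha t = a & forall t : R, 1 <= t -> alpha t = b].

Lemma joined_refl (T : topologicalType) (a : T) : joined a a.
Proof. by exists (fun=> a); split=> // t; exact: cst_continuous. Qed.

Lemma joined_sym (T : topologicalType) (a b : T) : joined a b -> joined b a.
Proof.
move=> [al [ca a0 a1]]; exists (fun t => al (-1 * t + 1)); split=> [t|t t0|t t1].
- exact: (@continuous_comp _ _ _ (fun t : R => -1 * t + 1) al t (@cont_aff R _ _ t) (ca _)).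
- by apply: a1; lra.
- by apply: a0; lra.
Qed.

Lemma joined_trans (T : topologicalType) (b a c : T) : joined a b -> joined b c -> joined a c.
Proof.
move=> [al [ca a0 a1]] [be [cb b0 b1]].
exists (fun t => if 2 * t + -1 <= 0 then al (2 * t + 0) else be (2 * t + -1)); split.
- apply: glue_continuous; first exact: cont_aff.
  + by move=> t; exact: (@continuous_comp _ _ _ (fun t : R => 2 * t + 0) al t (@cont_aff R _ _ t) (ca _)).
  + by move=> t; exact: (@continuous_comp _ _ _ (fun t : R => 2 * t + -1) be t (@cont_aff R _ _ t) (cb _)).
  + by move=> t h; rewrite a1 ?b0 //; lra.
- move=> t t0; rewrite ifT; last by lra.
  by apply: a0; lra.
- move=> t t1; case: ifP => h; last by apply: b1; lra.
  by exfalso; lra.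
Qed.

Lemma clamp_continuous : continuous (@clamp R).
Proof.
move=> t; apply: (@max_continuous R R (fun=> 0) (fun t => Num.min t 1)); first exact: cst_continuous.
by apply: (@min_continuous R R idfun (fun=> 1)); [exact: cvg_id | exact: cst_continuous].
Qed.

(** Segments in a ball contained in the image of a chart. *)
Lemma near_joined n (X : charted R n) (a : X) : smooth_atlas X -> \forall b \near a, joined a b.
Proof.
move=> aX; have [i ia] := chart_at aX a.
have [od oi _ cm ci] := atlas_chart aX i.
have /nbhs_ballP[e /= e0 eB] : nbhs (coords i a) (chart_im (atlas i)).
  by apply: open_nbhs_nbhs; split=> //; exists a.
have nb : \forall b \near a, dom i b /\ ball (coords i a) e (coords i b).
  have N1 := open_nbhs_nbhs (conj od (ia : chart_dom (atlas i) a)).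
  have N2 := cm a (mem_set ia) _ (nbhsx_ballx _ _ e0).
  by apply: filterS2 N1 N2 => b.
apply: filterS nb => b [ib bb].
pose line t := coords i a + clamp t *: (coords i b - coords i a).
have c01 t : 0 <= clamp t <= 1.
  by rewrite /clamp le_max lexx /= ge_max ler01 ge_min lexx orbT.
have lin t : chart_im (atlas i) (line t).
  by apply: eB; apply: ball_segment => //; exact: ballxx.
have cl : continuous line.
  move=> t; have c1 := @cvgZr_tmp R _ _ (nbhs t) (nbhs_filter t) (@clamp R) _
    (coords i b - coords i a) (clamp_continuous (x := t)).
  have c0 : {for t, continuous (fun _ : R => coords i a)} by exact: cst_continuous.
  exact: (cvgD c0 c1).
exists (param i \o line); split=> [t|t t0|t t1].
- by apply: continuous_comp; [exact: cl | apply/ci/mem_set].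
- by rewrite /= /line clamp_le0 // scale0r addr0 (paramK aX ia).
- by rewrite /= /line clamp_ge1 // scale1r addrC subrK (paramK aX ib).
Qed.

Lemma connected_manifold_joined n (X : charted R n) (a b : X) : connected_manifold X -> joined a b.
Proof.
move=> [[/smooth_manifold_atlas aX _] cX _].
apply: (@clopen_connected _ [set b | joined a b] a cX (joined_refl a)).
  rewrite openE => c /= ac; apply: filterS (near_joined c aX) => d.
  exact: joined_trans.
rewrite openE => c /= ac; apply: filterS (near_joined c aX) => d cd ad.
exact/ac/(joined_trans ad)/joined_sym.
Qed.

End paths.

Section quotient_geometry.
Variables (R : realType) (n1 n2 : nat).
Variables (M1 : charted R n1) (g1 : metric_field M1) (M2 : charted R n2) (g2 : metric_field M2).
Variables (l1 : M2 -> R) (l2 : M1 -> R).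
Variable Gam : set (prod_charted M1 M2 -> prod_charted M1 M2).
Variables (M : charted R (n1 + n2)) (g : metric_field M) (q : prod_charted M1 M2 -> M).
Let F1 := image_foliation q (@canonical_foliation1 M1 M2).
Let X := prod_charted M1 M2.
Let gX := doubly_warped g1 g2 l1 l2.

Hypotheses (cM1 : connected_manifold M1) (cM2 : connected_manifold M2) (cM : connected_manifold M).
Hypotheses (mg1 : metric_tensor g1) (mg2 : metric_tensor g2).
Hypotheses (pl1 : positive_smooth l1) (pl2 : positive_smooth l2).
Hypotheses (isoG : isometry_group gX Gam).
Hypothesis folG : forall f, Gam f -> preserves_foliation (@canonical_foliation1 M1 M2) f /\
                      preserves_foliation (@canonical_foliation2 M1 M2) f.
Hypothesis qM : quotient_map gX Gam g q.
Hypothesis regF : regular_foliation F1.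

Lemma M1_atlas : smooth_atlas M1. Proof. by have [[/smooth_manifold_atlas]] := cM1. Qed.
Lemma M2_atlas : smooth_atlas M2. Proof. by have [[/smooth_manifold_atlas]] := cM2. Qed.
Lemma M_atlas : smooth_atlas M. Proof. by have [[/smooth_manifold_atlas]] := cM. Qed.
Lemma product_atlas : smooth_atlas X. Proof. exact: prod_smooth_atlas M1_atlas M2_atlas. Qed.
Lemma hausdorff1 : hausdorff_space M1. Proof. by have [[]] := cM1. Qed.
Lemma hausdorff2 : hausdorff_space M2. Proof. by have [[]] := cM2. Qed.

(** * The group and the quotient map *)

Lemma q_surj y : exists z, q z = y. Proof. by have [h _ _] := qM; exact: h. Qed.

Lemma q_fibre z z' : q z = q z' <-> exists2 f, Gam f & f z = z'.
Proof. by have [_ h _] := qM; exact: h. Qed.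

Lemma q_Gam f z : Gam f -> q (f z) = q z.
Proof. by move=> Gf; apply/esym/q_fibre; exists f. Qed.

Lemma q_local z : local_diffeo q z /\ isometric_at gX g q z.
Proof.
have [_ _ /(_ z)[U [oU Uz oqU [dq /preserves_metricP Iq]]]] := qM.
by split; [exact: diffeomorphism_local oU oqU dq Uz | exact: Iq].
Qed.

Lemma q_smooth z : smooth_at q z. Proof. by have [[]] := q_local z. Qed.

Lemma q_continuous : continuous q.
Proof. by move=> z; exact: smooth_at_continuous (q_smooth z). Qed.

Lemma q_open U : open U -> open (q @` U).
Proof. by move=> oU; apply: local_diffeo_open oU _ => z _; have [] := q_local z. Qed.

Lemma Gam_smooth f z : Gam f -> smooth_at f z.
Proof.
have [_ _ _ h] := isoG; move=> /h[[k [_ _ _ sf _]] _].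
by exists setT; split=> //; exact: openT.
Qed.

Lemma Gam_isometric f z : Gam f -> isometric_at gX gX f z.
Proof. by have [_ _ _ h] := isoG; move=> /h[_ /preserves_metricP]; apply. Qed.

Lemma Gam_id : Gam id. Proof. by case: isoG. Qed.

Lemma Gam_comp f h : Gam f -> Gam h -> Gam (f \o h).
Proof. by case: isoG => _ h' _ _; exact: h'. Qed.

Lemma Gam_inv f : Gam f -> exists h, [/\ Gam h, cancel f h & cancel h f].
Proof. by case: isoG => _ _ h' _; exact: h'. Qed.

Lemma Gam_snd f a a' b : Gam f -> (f (a, b)).2 = (f (a', b)).2.
Proof.
move=> /folG[h _]; have [|b' _ e] := h ([set: M1] `*` [set b]); first by exists b.
have im a'' : (f @` ([set: M1] `*` [set b])) (f (a'', b)) by exists (a'', b).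
by have := im a; have := im a'; rewrite -e => -[_ /= ->] [_ /= ->].
Qed.

Lemma Gam_fst f a b b' : Gam f -> (f (a, b)).1 = (f (a, b')).1.
Proof.
move=> /folG[_ h]; have [|a' _ e] := h ([set a] `*` [set: M2]); first by exists a.
have im b'' : (f @` ([set a] `*` [set: M2])) (f (a, b'')) by exists (a, b'').
by have := im b; have := im b'; rewrite -e => -[/= -> _] [/= -> _].
Qed.

(** * Leaves *)

Lemma leafE a b : leaf F1 (q (a, b)) = q @` ([set: M1] `*` [set b]).
Proof.
apply/seteqP; split=> [y [F [[_ [b' _ <-] <-] [[a1 b1] [/= _ e1] eq]] [[a2 b2] [/= _ e2] <-]]|y Fy].
- move: e1 e2 eq => -> -> eq {b1 b2}.
  have [f Gf fe] := (q_fibre (a1, b') (a, b)).1 eq.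
  exists (f (a2, b')); last exact: q_Gam.
  by split=> //=; rewrite (Gam_snd a2 a1 b' Gf) fe.
- exists (q @` ([set: M1] `*` [set b])) => //; split; last by exists (a, b).
  by exists ([set: M1] `*` [set b]) => //; exists b.
Qed.

Lemma leaf_projE a b a' b' :
  leaf_proj F1 (q (a, b)) = leaf_proj F1 (q (a', b')) <->
  exists2 f, Gam f & (f (a, b)).2 = b'.
Proof.
have -> : leaf_proj F1 (q (a, b)) = leaf_proj F1 (q (a', b')) <->
    leaf F1 (q (a, b)) = leaf F1 (q (a', b')).
  rewrite /leaf_proj; split=> [/eqmodP/asboolP //|e].
  by apply/eqmodP/asboolP.
rewrite !leafE; split=> [e|[f Gf fb]].
  have : (q @` ([set: M1] `*` [set b'])) (q (a, b)) by rewrite -e; exists (a, b).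
  move=> [[a'' b''] [/= _ ->] /esym/q_fibre[f Gf fe]].
  by exists f => //; rewrite fe.
apply/seteqP; split=> _ [[x y] [/= _ ->] <-].
  exists (f (x, b)); last exact: q_Gam.
  by split=> //=; rewrite (Gam_snd x a b Gf).
have [h [Gh fK hK]] := Gam_inv Gf.
exists (h (x, b')); last exact: q_Gam.
split=> //=.
rewrite (Gam_snd x (f (a, b)).1 b' Gh) -fb -surjective_pairing fK //.
Qed.

Variable a0 : M1.

(** The action psi on M2 of f = phi x psi, read off at a reference point a0. *)
Definition base_act (f : X -> X) (b : M2) : M2 := (f (a0, b)).2.

Lemma base_actE f a b : Gam f -> (f (a, b)).2 = base_act f b.
Proof. exact: Gam_snd. Qed.

Lemma base_act_comp f h b : Gam f -> base_act (f \o h) b = base_act f (base_act h b).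
Proof.
move=> Gf; rewrite -(base_actE (h (a0, b)).1 (base_act h b) Gf).
by rewrite /base_act -surjective_pairing.
Qed.

Lemma base_act_inv f : Gam f -> exists h, [/\ Gam h, cancel (base_act f) (base_act h)
  & cancel (base_act h) (base_act f)].
Proof.
move=> Gf; have [h [Gh fK hK]] := Gam_inv Gf; exists h; split=> // b.
  by rewrite -base_act_comp // /base_act /= fK.
by rewrite -base_act_comp // /base_act /= hK.
Qed.

Lemma base_act_smooth f b : Gam f -> smooth_at (base_act f) b.
Proof.
move=> Gf.
have s1 : smooth_at (Y := X) (fun b : M2 => (a0, b)) b.
  apply: (smooth_at_pair M1_atlas M2_atlas M2_atlas); last exact: smooth_at_id M2_atlas.
  exact: smooth_at_cst M2_atlas M1_atlas.
have s2 := smooth_at_comp M2_atlas product_atlas product_atlas s1 (Gam_smooth _ Gf).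
exact: (smooth_at_comp M2_atlas product_atlas M2_atlas s2 (smooth_at_snd M1_atlas M2_atlas _)).
Qed.

Lemma base_act_continuous f : Gam f -> continuous (base_act f).
Proof. by move=> Gf b; exact: smooth_at_continuous (base_act_smooth b Gf). Qed.

(** The covering of the leaf space by M2. By base_projE it does not depend on the
    reference point. *)
Definition base_proj (b : M2) : leaf_space F1 := leaf_proj F1 (q (a0, b)).

Lemma base_projE a b : leaf_proj F1 (q (a, b)) = base_proj b.
Proof. by apply/leaf_projE; exists id => //; exact: Gam_id. Qed.

Lemma base_proj_fibre b b' : base_proj b = base_proj b' <->
  exists2 f, Gam f & base_act f b = b'.
Proof. exact: leaf_projE. Qed.

Lemma leaf_base b : leaf F1 (q (a0, b)) = leaf_proj F1 @^-1` [set base_proj b].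
Proof.
rewrite leafE; apply/seteqP; split=> [_ [[a b'] [/= _ ->] <-]|y /=].
  by rewrite /= base_projE.
have [[a b'] <-] := q_surj y; rewrite base_projE => /base_proj_fibre[f Gf fb].
exists (f (a, b')); last exact: q_Gam.
by split=> //=; rewrite base_actE.
Qed.

(** * Regularity: holonomy is trivial *)

(** The transverse coordinate of q(a, y) in an adapted chart determines y: two
    points with the same transverse coordinate differ along a slice, and the
    M2-coordinate of a local inverse of q is constant along slices. *)
Lemma base_act_return_fixed b : exists V, [/\ open V, V b &
  forall f y, Gam f -> V y -> V (base_act f y) -> base_act f y = y].
Proof.
have [c [[cP cX _ _] cx sl]] := regF (q (a0, b)).
pose M' := add_chart c.
have aM' : smooth_atlas M' := add_chart_atlas M_atlas cP cX.
have [k ka] := chart_at M1_atlas a0; have [j jb] := chart_at M2_atlas b.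
pose kj : chart_index X := (k, j).
pose z0 : X := (a0, b).
have dq : local_diffeo (Y := M') q z0.
  have [d1 _] := q_local z0.
  exact: local_diffeo_comp product_atlas M_atlas aM' _ _ z0 d1 (add_chart_local_diffeo M_atlas cP cX _).
have [sq [h [sh hq qh]]] := dq.
pose C (m : M') := @coords _ _ M' None m.
have hx : h (q z0) = z0 := nbhs_singleton hq.
have cq := smooth_at_continuous sq; have ch := smooth_at_continuous sh.
(* regularity: points of one leaf in the domain of c lie in one slice *)
have tr z z' : (exists2 f, Gam f & base_act f z.2 = z'.2) ->
    chart_dom c (q z) -> chart_dom c (q z') -> rsubmx (C (q z)) = rsubmx (C (q z')).
  move=> [f Gf fz] cz cz'.
  pose F := q @` ([set: M1] `*` [set z'.2]).
  have FF : F1 F by exists ([set: M1] `*` [set z'.2]) => //; exists z'.2.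
  have Fz : F (q z).
    exists (f z); last exact: q_Gam.
    by split=> //=; rewrite -fz (surjective_pairing z) base_actE.
  have Fz' : F (q z') by exists z' => //; split.
  have [|v [Fv _]] := sl F FF; first by exists (q z).
  have : (F `&` chart_dom c) (q z) by [].
  have : (F `&` chart_dom c) (q z') by [].
  by rewrite Fv => -[_ e'] [_ e]; rewrite /C /coords /= e e'.
have nG : \forall m \near (q z0 : M'), [/\ smooth_at h m, q (h m) = m,
    smooth_at (Y := M') q (h m), \forall m' \near (m : M'), q (h m') = m'
    & dom kj (h m) /\ chart_dom c m].
  have N1 := near_smooth_at sh.
  have N2 := continuous_near ch hx (near_smooth_at sq).
  have okj : open (@dom _ _ X kj) := dom_open product_atlas kj.
  have N3 := continuous_near ch hx (open_nbhs_nbhs (conj okj (conj ka jb : dom kj z0))).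
  have oc : open (chart_dom c) := chart_dom_open cP.
  have N4 := open_nbhs_nbhs (conj oc cx).
  have N5 := near_join qh.
  by near=> m; split; [near: m..|split; near: m].
have [G [oG Gx GP]] := near_open nG.
have oCG : open (C @` (G `&` chart_dom c)) := chart_image_open cP oG.
have CGx : (C @` (G `&` chart_dom c)) (C (q z0)) by exists (q z0).
have /nbhs_ballP[e /= e0 eG] := open_nbhs_nbhs (conj oCG CGx).
pose H := @local_expr _ _ _ M' X None kj h.
pose beta (w : 'rV[R]_(n1 + n2)) := rsubmx (H w).
pose Phi := @local_expr _ _ _ X M' kj None q.
have dr (n m : nat) (v : 'rV[R]_(n + m)) :
    differentiable (rsubmx : 'rV[R]_(n + m) -> 'rV[R]_m) v by exact: differentiable_rsubmx.
have rdiff (n : nat) (K : 'rV[R]_n -> 'rV[R]_(n1 + n2)) v w : differentiable K v ->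
    differentiable (rsubmx \o K) v /\ 'D_w (rsubmx \o K) v = rsubmx (w *m 'J K v).
  move=> dK; have dc := differentiable_comp dK (dr _ _ (K v)); split=> //.
  apply: (etrans (deriveE _ dc)); apply: (etrans (diff_comp_apply w dK (dr _ _ (K v)))).
  apply: (etrans (diff_lin_apply _ _ (@continuous_rsubmx R 1 n1 n2))).
  by congr rsubmx; exact: jacobianE.
(* hence, in coordinates, q maps the M1-directions to slice directions *)
have JPhi z : chart_dom c (q z) -> dom kj z -> smooth_at (Y := M') q z ->
    forall u : 'rV_n1, rsubmx (row_mx u 0 *m 'J Phi (coords kj z)) = 0.
  move=> cz kjz sqz u.
  have dPhi : differentiable Phi (coords kj z).
    exact: (@local_expr_differentiable _ _ _ X M' product_atlas aM' q z kj None sqz kjz cz).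
  have [_ <-] := rdiff _ Phi _ (row_mx u 0) dPhi.
  apply: lim_near_cst => //=.
  have Nz : \forall z' \near z, chart_dom c (q z').
    by apply: (q_continuous _); exact: open_nbhs_nbhs (conj (chart_dom_open cP) cz).
  have Nv := local_expr_near product_atlas kjz Nz.
  have cl : {for 0, continuous (fun t : R => t *: row_mx u 0 + coords kj z)}.
    apply: continuousD; last exact: cst_continuous.
    by apply: cvgZr_tmp; exact: cvg_id.
  have e0' : 0 *: row_mx u 0 + coords kj z = coords kj z by rewrite scale0r add0r.
  have Nt := continuous_near cl e0' Nv.
  have := nbhs_dnbhs Nt; apply: filterS => t [_ ct].
  suff -> : rsubmx (Phi (t *: row_mx u 0 + coords kj z)) = rsubmx (Phi (coords kj z)).
    by rewrite subrr scaler0.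
  have pz : param kj (coords kj z) = z := paramK product_atlas kjz.
  rewrite /Phi /local_expr /= pz; apply: tr => //.
  exists id; first exact: Gam_id.
  rewrite /base_act /= linearD linearZ /= row_mxKr scaler0 add0r.
  by rewrite /coords /= row_mxKr; exact: (paramK M2_atlas (proj2 kjz)).
(* and the M2-coordinate of the local inverse has derivative 0 along slices *)
have key w u : ball (C (q z0)) e w -> differentiable H w /\ 'D_(row_mx u 0) beta w = 0.
  move=> /eG[m [Gm cm] <-]; have [shm qhm sqm qh' [kjm _]] := GP m Gm.
  have dH : differentiable H (C m).
    exact: (@local_expr_differentiable _ _ _ M' X aM' product_atlas h m None kj shm cm kjm).
  split=> //; have [_ ->] := rdiff _ H _ (row_mx u 0) dH.
  have /mulmx1C JJ : 'J H (C m) *m 'J Phi (coords kj (h m)) = 1%:M.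
    exact: (@jacobian_inverse _ _ M' X aM' product_atlas h q m None kj shm sqm qh' cm kjm).
  by apply: (inverse_block_triangular JJ); apply: JPhi => //; rewrite qhm.
have NX : \forall z \near z0, [/\ h (q z) = z, dom kj z, chart_dom c (q z)
    & ball (C (q z0)) e (C (q z))].
  have N1 := continuous_near cq erefl (open_nbhs_nbhs (conj (chart_dom_open cP) cx)).
  have N2 := open_nbhs_nbhs (conj (dom_open product_atlas kj) (conj ka jb : dom kj z0)).
  have cC := chart_map_continuous cP (mem_set cx).
  have N3 := continuous_near cq erefl (cC _ (nbhsx_ballx _ _ e0)).
  by near=> z; split; near: z.
have cpair : continuous (fun y : M2 => (a0, y) : X).
  by move=> y; apply: pair_continuous; [exact: cst_continuous | exact: cvg_id].
have [V [oV Vb VP]] := near_open (continuous_near (cpair b) erefl NX).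
exists V; split=> // f y Gf Vy Vfy; set y' := base_act f y.
have [hy [_ jy] cy By] := VP y Vy; have [hy' [_ jy'] cy' By'] := VP y' Vfy.
have betaE v : h (q (a0, v)) = (a0, v) -> chart_dom c (q (a0, v)) ->
    beta (C (q (a0, v))) = coords j v.
  move=> hv cv; rewrite /beta /H /local_expr /= /C /coords /param /= chart_mapK // hv.
  by rewrite row_mxKr.
set w := C (q (a0, y)) in By; set w' := C (q (a0, y')) in By'.
have ww : w' - w = row_mx (lsubmx (w' - w)) 0.
  rewrite -[LHS]hsubmxK; congr row_mx; rewrite linearB /=.
  apply/eqP; rewrite subr_eq0; apply/eqP/esym.
  by apply: (tr (a0, y) (a0, y')) => //; exists f.
have seg : beta (w + row_mx (lsubmx (w' - w)) 0) = beta w.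
  apply: (@derive0_segment _ _ _ (ball (C (q z0)) e)).
  - by move=> t t01; rewrite -ww; exact: ball_segment.
  - move=> v Bv; have [dH _] := key v 0 Bv.
    by have [] := rdiff _ H v 0 dH.
  - by move=> v Bv; have [] := key v (lsubmx (w' - w)) Bv.
move: seg; rewrite -ww addrC subrK betaE // betaE // => e'.
by apply: (etrans (esym (paramK M2_atlas jy'))); rewrite /= e'; exact: (paramK M2_atlas jy).
Unshelve. all: by end_near. Qed.

(** Near a fixed point all points return, so they are fixed. *)
Lemma base_act_fix f b : Gam f -> base_act f b = b -> forall y, base_act f y = y.
Proof.
move=> Gf fb; have [_ cT _] := cM2.
have cf := base_act_continuous Gf.
apply: (@clopen_connected _ [set y | base_act f y = y] b) => //.
  rewrite openE => y /= fy.
  have [V [oV Vy VP]] := base_act_return_fixed y.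
  have N1 := open_nbhs_nbhs (conj oV Vy).
  have N2 := continuous_near (cf y) fy N1.
  by apply: filterS2 N1 N2 => z Vz Vfz; exact: VP.
rewrite openE => y /= fy.
have ne : base_act f y != y by exact/eqP.
move: hausdorff2; rewrite open_hausdorff => /(_ _ _ ne)[[A B] /= [Afy By] [oA oB /eqP AB]].
rewrite !inE in Afy By.
have N1 := open_nbhs_nbhs (conj oB By).
have N2 := continuous_near (cf y) erefl (open_nbhs_nbhs (conj oA Afy)).
apply: filterS2 N1 N2 => z Bz Az e.
by have : (A `&` B) z by [split=> //; rewrite -e]; rewrite AB.
Qed.

Definition evenly_covered (V : set M2) := forall f y,
  Gam f -> V y -> V (base_act f y) -> forall y', base_act f y' = y'.

Lemma evenly_covered_nbhs b : exists V, [/\ open V, V b & evenly_covered V].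
Proof.
have [V [oV Vb VP]] := base_act_return_fixed b; exists V; split=> // f y Gf Vy Vfy.
by apply: (base_act_fix Gf); exact: VP Gf Vy Vfy.
Qed.

(** * The two coverings *)

Lemma base_proj_continuous : continuous base_proj.
Proof.
move=> b; apply: (@continuous_comp _ _ _ (fun b : M2 => q (a0, b)) (leaf_proj F1)).
  apply: (@continuous_comp _ _ _ (fun b : M2 => (a0, b) : X) q); last exact: q_continuous.
  by apply: pair_continuous; [exact: cst_continuous | exact: cvg_id].
exact: leaf_proj_continuous.
Qed.

Lemma base_proj_preimage V : leaf_proj F1 @^-1` (base_proj @` V) = q @` ([set: M1] `*` V).
Proof.
apply/seteqP; split=> [y [b Vb]|_ [[a b] [/= _ Vb] <-]]; last by exists b; rewrite // base_projE.
have [[a b'] <-] := q_surj y; rewrite base_projE => /esym/base_proj_fibre[f Gf fb].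
exists (f (a, b')); last exact: q_Gam.
by split=> //=; rewrite base_actE // fb.
Qed.

Lemma leaf_open (U : set (leaf_space F1)) : open (leaf_proj F1 @^-1` U) -> open U.
Proof. by []. Qed.

Lemma base_proj_open V : open V -> open (base_proj @` V).
Proof.
move=> oV; apply: leaf_open; rewrite base_proj_preimage.
by apply: q_open; exact: open_rectangle openT oV.
Qed.

Lemma base_proj_surj l : exists b, base_proj b = l.
Proof.
have [y <-] : exists y, leaf_proj F1 y = l by exists (repr l); exact: reprK.
by have [[a b] <-] := q_surj y; exists b; rewrite base_projE.
Qed.

Lemma base_proj_inj V : evenly_covered V -> {in V &, injective base_proj}.
Proof.
move=> eV b b'; rewrite !inE => Vb Vb' /base_proj_fibre[f Gf fb].
by rewrite -fb in Vb' *; rewrite (eV f b).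
Qed.

Lemma q_covering : covering q.
Proof.
apply: (@covering_of_orbits _ _ q Gam).
- exact: q_continuous.
- exact: q_open.
- exact: q_surj.
- move=> f Gf; have cG h : Gam h -> continuous h.
    by move=> Gh z; exact: smooth_at_continuous (Gam_smooth z Gh).
  split; first exact: cG.
  by have [h [Gh fK hK]] := Gam_inv Gf; exists h; split=> //; exact: cG.
- by move=> f z Gf; exact: q_Gam.
- by move=> y z /q_fibre.
- by move=> z; have [d _] := q_local z; exact: local_diffeo_inj d.
Qed.

Lemma base_proj_covering : covering base_proj.
Proof.
apply: (@covering_of_orbits _ _ base_proj [set base_act f | f in Gam]).
- exact: base_proj_continuous.
- exact: base_proj_open.
- exact: base_proj_surj.
- move=> _ [f Gf <-]; split; first exact: base_act_continuous.
  have [h [Gh fK hK]] := base_act_inv Gf.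
  by exists (base_act h); split=> //; exact: base_act_continuous.
- by move=> _ b [f Gf <-]; apply/esym/base_proj_fibre; exists f.
- by move=> b b' /base_proj_fibre[f Gf fb]; exists (base_act f) => //; exists f.
- move=> b; have [V [oV Vb eV]] := evenly_covered_nbhs b.
  by exists V; split=> //; exact: base_proj_inj.
Qed.

(** * The leaf space as a manifold *)

(** The elements of the group act on M2 by homotheties, which need not be
    isometric for g2. Only the smooth structure is carried over to the leaf
    space, and for the zero metric every map is isometric. *)
Definition zero_metric : metric_field M2 := fun _ _ => 0.

Lemma base_etale : etale zero_metric setT base_proj.
Proof.
split.
- exact: openT.
- by move=> b _; exact: base_proj_continuous.
- by move=> U oU _; exact: base_proj_open.
- by move=> l; have [b <-] := base_proj_surj l; exists b.
- move=> b _; have [V [oV Vb eV]] := evenly_covered_nbhs b.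
  by exists V; split=> //; exact: base_proj_inj.
- move=> b b' _ _ /base_proj_fibre[f Gf fb]; exists (base_act f); split=> //.
  + exact: base_act_smooth.
  + by move=> i j _ _; rewrite /zero_metric mulmx0 mul0mx.
  + by apply: near_everywhere => z; split=> //; apply/esym/base_proj_fibre; exists f.
Qed.

(** The leaf space with the atlas carried over from M2. It is compared first with
    the projection of M, and then with the atlas of all submersive charts. *)
Let carried_leaf_space := etale_quotient base_etale.

Lemma carried_atlas : smooth_atlas carried_leaf_space.
Proof. exact: etale_smooth_atlas M2_atlas base_etale. Qed.

Lemma base_proj_carried_diffeo b : local_diffeo (Y := carried_leaf_space) base_proj b.
Proof. exact: (etale_local_diffeo M2_atlas base_etale). Qed.

Lemma leaf_proj_smooth y : smooth_at (Y := carried_leaf_space) (leaf_proj F1) y.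
Proof.
have [z <-] := q_surj y; have [[sq [h [sh hq qh]]] _] := q_local z.
have hz : h (q z) = z := nbhs_singleton hq.
apply: (@smooth_at_eq _ _ _ M carried_leaf_space M_atlas carried_atlas (base_proj \o (snd \o h))).
  by apply: filterS qh => m {2}<-; rewrite /= [h m]surjective_pairing base_projE.
have s2 := smooth_at_comp M_atlas product_atlas M2_atlas sh (smooth_at_snd M1_atlas M2_atlas _).
apply: (smooth_at_comp M_atlas M2_atlas carried_atlas s2).
by have [] := base_proj_carried_diffeo (snd (h (q z))).
Qed.

(** Follow a local inverse of the covering M2 -> L by y |-> q(a, y). *)
Lemma leaf_proj_section y : exists s : carried_leaf_space -> M,
  [/\ smooth_at s (leaf_proj F1 y), s (leaf_proj F1 y) = y
    & \forall l \near (leaf_proj F1 y : carried_leaf_space), leaf_proj F1 (s l) = l].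
Proof.
have [[a b] <-] := q_surj y; rewrite base_projE.
have [sr [h [sh hr rh]]] := base_proj_carried_diffeo b.
have hb : h (base_proj b) = b := nbhs_singleton hr.
have s1 : smooth_at (Y := X) (fun b : M2 => (a, b)) (h (base_proj b)).
  apply: (smooth_at_pair M1_atlas M2_atlas M2_atlas); last exact: smooth_at_id M2_atlas.
  exact: smooth_at_cst M2_atlas M1_atlas.
have s2 := smooth_at_comp carried_atlas M2_atlas product_atlas sh s1.
exists (q \o ((fun b => (a, b)) \o h)); split.
- exact: (smooth_at_comp carried_atlas product_atlas M_atlas s2 (q_smooth _)).
- by rewrite /= hb.
- by apply: filterS rh => l {2}<-; rewrite /= base_projE.
Qed.

(** The Jacobian of a local section is a one-sided inverse. *)
Lemma leaf_proj_jacobian_full (i : chart_index M) (p : chart_index carried_leaf_space) y :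
  dom i y -> dom p (leaf_proj F1 y) ->
  row_full ('J (@local_expr _ _ _ M carried_leaf_space i p (leaf_proj F1)) (coords i y)).
Proof.
move=> iy py; have [s [ss sy es]] := leaf_proj_section y.
have el : leaf_proj F1 (s (leaf_proj F1 y)) = leaf_proj F1 y := nbhs_singleton es.
suff : row_full ('J (@local_expr _ _ _ M carried_leaf_space i p (leaf_proj F1)) (coords i (s (leaf_proj F1 y)))).
  by rewrite [s _]sy.
have isy : dom i (s (leaf_proj F1 y)) by rewrite sy.
have psy : @dom _ _ carried_leaf_space p (leaf_proj F1 (s (leaf_proj F1 y))) by rewrite el.
have sm := leaf_proj_smooth (s (leaf_proj F1 y)).
have E := jacobian_local_expr_comp carried_atlas M_atlas carried_atlas ss sm py isy psy.
apply/row_fullP; exists ('J (local_expr p i s) (coords p (leaf_proj F1 y))).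
apply: (etrans (esym E)); apply: (etrans _ (jacobian_local_expr_id carried_atlas py)).
apply: near_eq_jacobian; first by apply: (near_eq_local_expr (Y := carried_leaf_space) (f := leaf_proj F1 \o s) (g := fun l => l) carried_atlas p py es).
exact: (local_expr_differentiable carried_atlas carried_atlas (smooth_at_comp carried_atlas M_atlas carried_atlas ss sm) py psy).
Qed.

Lemma etale_leaf_chart (p : chart_index carried_leaf_space) : leaf_chart (@atlas _ _ carried_leaf_space p).
Proof.
split=> [|f i U]; first exact: (atlas_chart carried_atlas p).
have [_ sm] : smooth_map (Y := carried_leaf_space) setT (leaf_proj F1).
  by apply/smooth_mapP => [|y _]; [exact: openT | exact: leaf_proj_smooth].
split; first by have := sm i p; rewrite setTI.
by move=> _ [y [iy py] <-]; exact: leaf_proj_jacobian_full.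
Qed.

Section compare_charts.
Variables (c : chart R n2 (leaf_space F1)) (p : chart_index carried_leaf_space).
Hypothesis cL : leaf_chart c.

Let U := chart_im (@atlas _ _ carried_leaf_space p) `&` @param _ _ carried_leaf_space p @^-1` chart_dom c.

Let oU : open U.
Proof.
have [_ oi _ _ ci] := atlas_chart carried_atlas p.
by apply: open_setI_preimage => //; exact: chart_dom_open cL.1.
Qed.

(** Near a point of L, c is the composite of a local section with the submersion
    c o eta, hence smooth in the carried-over chart p. Conversely c o eta factors
    through p, so its full rank forces the square Jacobian to be invertible. *)
Lemma leaf_chart_smooth v : U v ->
  (exists S, S v /\ smooth_on S (chart_map c \o @param _ _ carried_leaf_space p)) /\
  'J (chart_map c \o @param _ _ carried_leaf_space p) v \in unitmx.
Proof.
have [cc sf] := cL; move=> [[l pl <-] cl]; move: cl => /=.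
rewrite -/(@coords _ _ carried_leaf_space p l) (paramK carried_atlas pl) => cl.
have [y yl] : exists y, leaf_proj F1 y = l by exists (repr l); exact: reprK.
have [s [ss sy es]] := leaf_proj_section y; rewrite yl in ss sy es.
have [i iy] := chart_at M_atlas y.
have isl : dom i (s l) by rewrite sy.
have [V [oV Vl Vi sV]] := smooth_at_local_expr carried_atlas M_atlas ss pl isl.
have [sfi rfi] := sf i.
have ns : \forall l' \near (l : carried_leaf_space), [/\ leaf_proj F1 (s l') = l', dom i (s l') & chart_dom c l'].
  have N1 := continuous_near (smooth_at_continuous ss) sy
    (open_nbhs_nbhs (conj (dom_open M_atlas i) iy)).
  have N2 := open_nbhs_nbhs (conj (chart_dom_open cc) cl).
  by near=> l'; split; near: l'.
have [W [oW Wl WP]] := near_open ns.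
have oWp : open (@coords _ _ carried_leaf_space p @` (W `&` dom p)).
  by apply: (coords_image_open carried_atlas) => //; apply: openI => //; exact: (dom_open carried_atlas p).
have oc : open (dom i `&` leaf_proj F1 @^-1` chart_dom c).
  apply: open_setI_preimage; [exact: (dom_open M_atlas i)| |exact: (chart_dom_open cc)].
  by move=> m _; exact: leaf_proj_continuous.
have oUf : open (coords i @` (dom i `&` leaf_proj F1 @^-1` chart_dom c)).
  by apply: (coords_image_open M_atlas) => // m [].
set f := chart_map c \o leaf_proj F1 in sfi rfi.
pose S := V `&` @coords _ _ carried_leaf_space p @` (W `&` dom p).
have oS : open S by exact: openI.
have Sl : S (@coords _ _ carried_leaf_space p l) by split=> //; exists l.
have fS w : S w -> (coords i @` (dom i `&` leaf_proj F1 @^-1` chart_dom c)) (@local_expr _ _ _ carried_leaf_space M p i s w).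
  move=> [_ [l' [Wl' pl'] <-]]; have [e1 e2 e3] := WP l' Wl'.
  rewrite /local_expr /= (paramK carried_atlas pl'); exists (s l') => //.
  by split=> //=; rewrite e1.
have sS : smooth_on S (chart_map c \o @param _ _ carried_leaf_space p).
  apply: (@smooth_on_eq _ _ _ _ ((f \o param i) \o @local_expr _ _ _ carried_leaf_space M p i s)) => //.
    move=> _ [_ [l' [Wl' pl'] <-]]; have [e1 e2 e3] := WP l' Wl'.
    by rewrite /local_expr /f /= (paramK carried_atlas pl') (paramK M_atlas e2) e1.
  by apply: (smooth_on_comp oS oUf fS _ sfi); apply: smooth_on_sub sV => ? [].
split; first by exists S.
have iyf : (coords i @` (dom i `&` leaf_proj F1 @^-1` chart_dom c)) (coords i y).
  by exists y => //; split=> //=; rewrite yl.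
have py : @dom _ _ carried_leaf_space p (leaf_proj F1 y) by rewrite yl.
have dl := local_expr_differentiable M_atlas carried_atlas (leaf_proj_smooth y) iy py.
have E : @local_expr _ _ _ M carried_leaf_space i p (leaf_proj F1) (coords i y) = @coords _ _ carried_leaf_space p l.
  by rewrite /local_expr /= (paramK M_atlas iy) yl.
have dc : differentiable (chart_map c \o @param _ _ carried_leaf_space p)
    (@local_expr _ _ _ M carried_leaf_space i p (leaf_proj F1) (coords i y)).
  by rewrite E; exact: smooth_on_differentiable sS Sl.
have JE := jacobian_comp dl dc; rewrite [X in _ *m jacobian _ X]E in JE.
have nf : \forall v \near coords i y,
    ((chart_map c \o @param _ _ carried_leaf_space p) \o @local_expr _ _ _ M carried_leaf_space i p (leaf_proj F1)) v = (f \o param i) v.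
  have Np : \forall m \near y, @dom _ _ carried_leaf_space p (leaf_proj F1 m).
    by apply: (leaf_proj_continuous _); exact: open_nbhs_nbhs (conj (dom_open carried_atlas p) py).
  apply: filterS (local_expr_near M_atlas iy Np) => w [_ pw].
  by rewrite /local_expr /f /= (paramK carried_atlas pw).
have JE' : 'J (f \o param i) (coords i y) = 'J (@local_expr _ _ _ M carried_leaf_space i p (leaf_proj F1)) (coords i y)
    *m 'J (chart_map c \o @param _ _ carried_leaf_space p) (@coords _ _ carried_leaf_space p l).
  exact: (etrans (esym (near_eq_jacobian nf (differentiable_comp dl dc))) JE).
have /row_fullP[B] := rfi _ iyf.
rewrite JE' mulmxA => BJ.
by have [_ u] := mulmx1_unit BJ; exact: u.
Unshelve. all: by end_near. Qed.

Lemma leaf_chart_to : smooth_on U (chart_map c \o @param _ _ carried_leaf_space p).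
Proof. by apply: smooth_on_local => v Uv; have [] := leaf_chart_smooth Uv. Qed.

Lemma leaf_chart_from : smooth_on (chart_map c @` (@dom _ _ carried_leaf_space p `&` chart_dom c))
  (@coords _ _ carried_leaf_space p \o chart_inv c).
Proof.
have [cc _] := cL; have [oc oi Kc _ ci] := cc.
have odp := dom_open carried_atlas p.
apply: (@inverse_smooth _ _ U _ (chart_map c \o @param _ _ carried_leaf_space p)).
- exact: oU.
- exact: chart_image_open.
- move=> _ [l [pl cl] <-] /=; rewrite chart_mapK //; split; first by exists l.
  by rewrite /= (paramK carried_atlas pl).
- move=> _ [l [pl cl] <-].
  have cp := chart_map_continuous (atlas_chart carried_atlas p).
  apply: continuous_comp; first by apply/ci/mem_set; exists l.
  rewrite (chart_mapK cc cl); exact: (cp l (mem_set pl)).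
- by move=> _ [l [pl cl] <-] /=; rewrite chart_mapK // (paramK carried_atlas pl).
- exact: leaf_chart_to.
- by move=> v Uv; have [_ u] := leaf_chart_smooth Uv; exact: u.
Qed.

End compare_charts.

(** Transition maps between submersive charts factor through a carried-over
    chart. *)
Lemma leaf_manifold_atlas : smooth_atlas (leaf_manifold F1).
Proof.
split=> [l|[c cL] //|[c cL] [d dL]]; first 2 last.
- apply: smooth_on_local => _ [l [/= cl dl] <-].
  have [p pl] := chart_at carried_atlas l.
  have odp := dom_open carried_atlas p; have odd := chart_dom_open dL.1.
  exists (chart_map c @` ((chart_dom d `&` @dom _ _ carried_leaf_space p) `&` chart_dom c)).
  split; first by exists l.
  have oS : open (chart_map c @` ((chart_dom d `&` @dom _ _ carried_leaf_space p) `&` chart_dom c)).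
    by apply: chart_image_open; [exact: cL.1 | exact: openI].
  have [_ oi _ _ ci] := atlas_chart carried_atlas p.
  have oU : open (chart_im (@atlas _ _ carried_leaf_space p) `&` @param _ _ carried_leaf_space p @^-1` chart_dom d).
    exact: open_setI_preimage.
  apply: (@smooth_on_eq _ _ _ _ ((chart_map d \o @param _ _ carried_leaf_space p) \o (@coords _ _ carried_leaf_space p \o chart_inv c))) => //.
    move=> _ [l' [[dl' pl'] cl'] <-] /=; rewrite (chart_mapK cL.1 cl').
    by rewrite (paramK carried_atlas pl').
  have s1 : smooth_on (chart_map c @` ((chart_dom d `&` @dom _ _ carried_leaf_space p) `&` chart_dom c))
      (@coords _ _ carried_leaf_space p \o chart_inv c).
    by apply: smooth_on_sub (leaf_chart_from (p := p) cL) => _ [l' [[dl' pl'] cl'] <-]; exists l'.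
  apply: (smooth_on_comp oS oU _ s1 (leaf_chart_to (p := p) dL)).
  move=> _ [l' [[dl' pl'] cl'] <-] /=; rewrite (chart_mapK cL.1 cl').
  by split; [exists l' | rewrite /= (paramK carried_atlas pl')].
- have [p pl] := chart_at carried_atlas l.
  by exists (exist _ _ (etale_leaf_chart p)).
- by case: cL.
Qed.

Lemma leaf_manifold_diffeo l : local_diffeo (X := carried_leaf_space) (Y := leaf_manifold F1) (fun l => l) l.
Proof.
have [p pl] := chart_at carried_atlas l.
pose p' : chart_index (leaf_manifold F1) := exist _ _ (etale_leaf_chart p).
have p'l : dom p' l by exact: pl.
have oi : open (chart_im (@atlas _ _ carried_leaf_space p)) by case: (atlas_chart carried_atlas p).
have cid : continuous (fun y : leaf_space F1 => y) by move=> y; exact: cvg_id.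
have sid : exists2 V, open V /\ V (@coords _ _ carried_leaf_space p l)
    & smooth_on V (fun v => @coords _ _ carried_leaf_space p (@param _ _ carried_leaf_space p v)).
  exists (chart_im (@atlas _ _ carried_leaf_space p)); first by split=> //; exists l.
  apply: smooth_on_eq (smooth_on_id oi) => // v iv.
  by apply/esym; exact: chart_invK (atlas_chart carried_atlas p) v iv.
have aL := leaf_manifold_atlas.
split.
  by apply: (smooth_at_chart carried_atlas aL pl p'l) => //; apply: near_everywhere => y; exact: cid.
exists (fun y => y); split; [|exact: near_everywhere|exact: near_everywhere].
by apply: (smooth_at_chart aL carried_atlas p'l pl) => //; apply: near_everywhere => y; exact: cid.
Qed.

Lemma base_proj_local_diffeo b : local_diffeo (Y := leaf_manifold F1) base_proj b.
Proof.
exact: (local_diffeo_comp M2_atlas carried_atlas leaf_manifold_atlas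
  (base_proj_carried_diffeo b) (leaf_manifold_diffeo _)).
Qed.

Lemma leaf_manifold_smooth : smooth_manifold (leaf_manifold F1).
Proof.
have [h1 h2 h3] := leaf_manifold_atlas; split=> //.
have [[[_ _ _ sc] _] _ _] := cM2.
exact: second_countable_image base_proj_continuous base_proj_open base_proj_surj sc.
Qed.

(** * The fibre and the local trivialisations *)

Section fibre.
Variable b0 : M2.

Definition fibre : set M := leaf F1 (q (a0, b0)).

Lemma fibre_q a : fibre (q (a, b0)).
Proof. by rewrite /fibre leafE; exists (a, b0). Qed.

Definition fibre_proj (a : M1) : fibre := exist _ (q (a, b0)) (mem_set (fibre_q a)).

(** Elements identifying two points over b0 fix b0, hence all of M2. *)
Lemma fibre_proj_fibre a a' : fibre_proj a = fibre_proj a' <->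
  exists2 f, Gam f & (forall y, base_act f y = y) /\ forall b, (f (a, b)).1 = a'.
Proof.
split=> [e|[f Gf [fid fa]]].
  have /q_fibre[f Gf fe] : q (a, b0) = q (a', b0) := congr1 sval e.
  have fb : base_act f b0 = b0 by rewrite -(base_actE a) // fe.
  exists f => //; split; first exact: base_act_fix Gf fb.
  by move=> b; rewrite (Gam_fst a b b0 Gf) fe.
apply: set_type_eq => /=; apply/q_fibre; exists f => //.
by rewrite [f _]surjective_pairing fa base_actE // fid.
Qed.

(** Over an evenly covered V, only the elements fixing M2 identify points of
    M1 x V, and these act on the first factor alone. *)
Lemma cylinder_fibre V z z' : evenly_covered V -> V z.2 -> V z'.2 ->
  q z = q z' <-> fibre_proj z.1 = fibre_proj z'.1 /\ z.2 = z'.2.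
Proof.
move=> eV Vz Vz'; split=> [/q_fibre[f Gf fz]|[/fibre_proj_fibre[f Gf [fid fa]] e]].
  have fE : base_act f z.2 = z'.2 by rewrite -fz -(base_actE z.1) // -surjective_pairing.
  have fid := eV f z.2 Gf Vz; rewrite fE in fid; have {}fid := fid Vz'.
  split; last by rewrite -fE fid.
  apply/fibre_proj_fibre; exists f => //; split=> // b.
  by rewrite (Gam_fst z.1 b z.2 Gf) -surjective_pairing fz.
apply/q_fibre; exists f => //.
rewrite [f z]surjective_pairing [in RHS](surjective_pairing z') -e.
by rewrite [in f z](surjective_pairing z) fa base_actE // fid.
Qed.

(** With V evenly covered around b0, the leaf meets the open set q(U x V) exactly
    in the image of U. *)
Lemma fibre_proj_open U : open U -> open (fibre_proj @` U).
Proof.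
move=> oU; have [V [oV Vb eV]] := evenly_covered_nbhs b0.
exists (q @` (U `*` V)); first exact/q_open/open_rectangle.
apply/seteqP; split=> [y [[u v] [/= Uu Vv] qy]|_ [u Uu <-]]; last by exists (u, b0).
suff e : v = b0 by exists u => //; apply: set_type_eq; rewrite /= -e; exact: qy.
have : fibre (q (u, v)) by move: (svalP y) => /set_mem; rewrite -[sval y]qy.
rewrite /fibre leaf_base /= base_projE => e.
by apply: (base_proj_inj eV); rewrite ?inE.
Qed.

(** For f = phi x id the metric condition reads l1^2 phi^*g1 = l1^2 g1 and
    (l2 o phi)^2 g2 = l2^2 g2. The second determines l2 o phi unless g2 is the
    empty matrix. *)
Lemma vertical_isometry f a : Gam f -> (forall y, base_act f y = y) ->
  let phi x := (f (x, b0)).1 in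
  [/\ smooth_at phi a, isometric_at g1 g1 phi a
    & n2 = 0%N \/ l2 (phi a) = l2 a].
Proof.
move=> Gf fid phi; have [ug2 _ /preserves_metricP Ig2] := mg2.
have [l1p _] := pl1; have [l2p _] := pl2.
have s1 : smooth_at (Y := X) (fun a : M1 => (a, b0)) a.
  apply: (smooth_at_pair M1_atlas M2_atlas M1_atlas); first exact: smooth_at_id M1_atlas.
  exact: smooth_at_cst M1_atlas M2_atlas.
have s2 := smooth_at_comp M1_atlas product_atlas product_atlas s1 (Gam_smooth _ Gf).
have sphi : smooth_at phi a.
  exact: (smooth_at_comp M1_atlas product_atlas M1_atlas s2 (smooth_at_fst M1_atlas M2_atlas _)).
have sid := smooth_at_id b0 M2_atlas.
have fE : f = map_prod phi (fun y : M2 => y).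
  apply/funext => -[x y]; rewrite [LHS]surjective_pairing /map_prod /phi /=.
  by rewrite (Gam_fst x y b0 Gf) base_actE // fid.
have := @Gam_isometric f (a, b0) Gf; rewrite [X in isometric_at _ _ X]fE => If.
have [I1 I2] := map_prod_isometric_at M1_atlas M1_atlas M2_atlas M2_atlas (z := (a, b0)) sphi sid If.
split=> //.
  move=> i j ix jx; have := I1 i j ix jx => /=.
  by apply: scalerI; rewrite sqrf_eq0 gt_eqF.
have [->|n20] := eqVneq n2 0%N; [by left|right].
have [j jb] := chart_at M2_atlas b0.
have := I2 j j jb jb => /=; rewrite -(Ig2 b0 I j j jb jb) => e.
have [_ ug] := ug2 j b0 jb.
have {}e : l2 a ^+ 2 = l2 (phi a) ^+ 2.
  apply/eqP; rewrite -subr_eq0; apply/eqP/(@contra_notP _ (g2 j b0 = 0)); last first.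
    rewrite -lt0n in n20; move=> g0; have := mulmxV ug; rewrite g0 mul0mx.
    move=> /matrixP/(_ (Ordinal n20) (Ordinal n20)); rewrite !mxE eqxx => /eqP.
    by rewrite eq_sym oner_eq0.
  by move=> /eqP ne; apply: (scalerI ne); rewrite scalerBl e subrr scaler0.
by apply/eqP; rewrite eq_sym -(@eqrXn2 _ 2) ?e // ltW.
Qed.

Lemma fibre_etale : etale g1 setT fibre_proj.
Proof.
have cq : continuous (fun a : M1 => q (a, b0)).
  move=> a; apply: (@continuous_comp _ _ _ (fun a : M1 => (a, b0) : X) q); last exact: q_continuous.
  by apply: pair_continuous; [exact: cvg_id | exact: cst_continuous].
split.
- exact: openT.
- by move=> a _; have cf := set_type_map_continuous (FK := fibre_q) cq; move: (cf a).
- by move=> U oU _; exact: fibre_proj_open.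
- move=> [y Fy]; have [[a b] [/= _ e] qy] : (q @` ([set: M1] `*` [set b0])) y.
    by rewrite -(leafE a0); exact: set_mem Fy.
  by exists a => //; apply: set_type_eq; rewrite /= -qy e.
- move=> a _; have [dq _] := q_local (a, b0).
  have [U [oU Ua iU]] := local_diffeo_inj dq.
  have cpair : {for a, continuous (fun a : M1 => (a, b0) : X)}.
    by apply: pair_continuous; [exact: cvg_id | exact: cst_continuous].
  have [W [oW Wa WU]] := near_open (continuous_near cpair erefl (open_nbhs_nbhs (conj oU Ua))).
  exists W; split=> // x y; rewrite !inE => Wx Wy /(congr1 sval) /= e.
  by have [] : (x, b0) = (y, b0) by apply: iU => //; rewrite inE; exact: WU.
- move=> a a' _ _ /fibre_proj_fibre[f Gf [fid fa]].
  have [s I _] := vertical_isometry a Gf fid.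
  exists (fun x => (f (x, b0)).1); split=> //.
  apply: near_everywhere => x; split=> //; apply/esym/fibre_proj_fibre.
  by exists f => //; split=> // b; exact: Gam_fst.
Qed.

Definition fibre_manifold : charted R n1 := etale_quotient fibre_etale.

Lemma fibre_hausdorff_manifold : hausdorff_manifold fibre_manifold.
Proof.
have [[[_ _ _ sc] hM] _ _] := cM.
have [h1 h2 h3] : smooth_atlas fibre_manifold := etale_smooth_atlas M1_atlas fibre_etale.
split; last exact: hausdorff_subtype.
by split=> //; exact: second_countable_subtype.
Qed.

Lemma fibre_atlas : smooth_atlas fibre_manifold.
Proof. exact: etale_smooth_atlas M1_atlas fibre_etale. Qed.

Lemma fibre_proj_local_diffeo a : local_diffeo (Y := fibre_manifold) fibre_proj a.
Proof. exact: (etale_local_diffeo M1_atlas fibre_etale). Qed.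

End fibre.

Lemma leaf_fiber_bundle : fiber_bundle (leaf_proj F1 : M -> leaf_manifold F1).
Proof.
have [_ _ [b0 _]] := cM2.
exists n1, (fibre_manifold b0); split; first exact: fibre_hausdorff_manifold.
move=> l; have [b <-] := base_proj_surj l.
have [V [oV Vb eV]] := evenly_covered_nbhs b.
exists (base_proj @` V); split; [exact: base_proj_open | by exists b |].
pose D : set X := [set: M1] `*` V.
pose N := fibre_manifold b0; pose L := leaf_manifold F1.
have aN := fibre_atlas b0; have aL := leaf_manifold_atlas.
have aLN := prod_smooth_atlas aL aN.
pose t (z : X) : prod_charted L N := (base_proj z.2, fibre_proj b0 z.1).
have /choice[s sP] : forall x, exists y : N, forall z, D z -> q z = x -> fibre_proj b0 z.1 = y.
  move=> x; have [[z [Dz zx]]|nz] := pselect (exists z, D z /\ q z = x).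
    exists (fibre_proj b0 z.1) => z' Dz' z'x.
    by have [] := (cylinder_fibre b0 eV (proj2 Dz') (proj2 Dz)).1 (etrans z'x (esym zx)).
  by exists (fibre_proj b0 a0) => z Dz zx; exfalso; apply: nz; exists z.
pose F (x : M) : prod_charted L N := (leaf_proj F1 x, s x).
exists F => //.
have -> : leaf_proj F1 @^-1` (base_proj @` V) = q @` D by exact: base_proj_preimage.
have -> : base_proj @` V `*` setT = t @` D.
  apply/seteqP; split=> [[l' y] [[v Vv /= vl] _]|_ [[a v] [/= _ Vv] <-]].
    have [a _ <-] := etale_surj (fibre_etale b0) y.
    by exists (a, v); rewrite // -vl.
  by split=> //; exists v.
apply: diffeomorphism_of_fibres.
- exact: product_atlas.
- exact: M_atlas.
- exact: aLN.
- exact: open_rectangle openT oV.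
- by exists (a0, b).
- by move=> z _; have [] := q_local z.
- move=> z _.
  have d1 : local_diffeo (map_prod (fibre_proj b0 : M1 -> N) (base_proj : M2 -> L)) z.
    apply: (local_diffeo_prod M1_atlas aN M2_atlas aL); first exact: fibre_proj_local_diffeo.
    exact: base_proj_local_diffeo.
  exact: (local_diffeo_comp product_atlas (prod_smooth_atlas aN aL) aLN d1 (local_diffeo_swap _ aN aL)).
- move=> z z' [_ Vz] [_ Vz']; apply: (iff_trans (cylinder_fibre b0 eV Vz Vz')).
  split=> [[e1 e2]|e]; first by rewrite /t e1 e2.
  have e1 := congr1 snd e; have e2 := congr1 fst e; split=> //.
  by apply: (base_proj_inj eV); rewrite ?inE.
- move=> z Dz; rewrite /F /t (sP (q z) z Dz erefl); congr pair.
  by case: (z) => a b'; exact: base_projE.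
Qed.

(** * A fundamental domain, and the open dense warped product *)

(** Among the members V of a countable basis of evenly covered sets, numbered by
    rk, keep the points of V that have a neighbourhood missing all translates of
    the members with smaller number. Two points of one orbit then lie in the
    same V; and an open set, moved by the group, meets B in the member of least
    number that its orbit meets. *)
Lemma fundamental_domain : exists B : set M2, [/\ open B, evenly_covered B &
  forall O : set M2, open O -> O !=set0 ->
    exists v f, [/\ O v, Gam f & B (base_act f v)]].
Proof.
have [[[_ _ _ [Ba /countable_injP[rk rkI] [oBa bBa]]] _] _ _] := cM2.
pose good V := Ba V /\ evenly_covered V.
have goodE v : exists2 V, good V & V v.
  have [V [oV Vv eV]] := evenly_covered_nbhs v.
  have [U [BU Uv] UV] := bBa v _ (open_nbhs_nbhs (conj oV Vv)).
  exists U => //; split=> // f y Gf /UV Vy /UV; exact: eV.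
pose B := [set v | exists V, [/\ good V, V v & exists O, [/\ open O, O v &
  forall V' f w, good V' -> (rk V' < rk V)%N -> Gam f -> O w -> ~ V' (base_act f w)]]].
exists B; split.
- rewrite openE => v [V [gV Vv [Q [oQ Qv QP]]]].
  have oV : open V := oBa _ gV.1.
  apply: filterS (open_nbhs_nbhs (conj (openI oV oQ) (conj Vv Qv))) => w [Vw Qw].
  by exists V; split=> //; exists Q.
- move=> f y Gf [V [gV Vy [Q [oQ Qy QP]]]] [V' [gV' Vy' [Q' [oQ' Qy' QP']]]].
  have [h [Gh fK hK]] := base_act_inv Gf.
  case: (ltngtP (rk V) (rk V')) => [lt|lt|e].
  + by have := QP' V h _ gV lt Gh Qy'; rewrite fK.
  + by have := QP V' f y gV' lt Gf Qy.
  + have VV : V = V' by apply: rkI => //; rewrite inE; [exact: gV.1|exact: gV'.1].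
    by apply: (gV.2 f y) => //; rewrite VV.
- move=> O oO [u Ou].
  pose hit k := exists V f w, [/\ good V, rk V = k, Gam f, O w & V (base_act f w)].
  have ex : exists k, `[< hit k >].
    have [V gV Vu] := goodE u; exists (rk V); apply/asboolP.
    by exists V, id, u; split=> //; exact: Gam_id.
  case: (ex_minnP ex) => k /asboolP[V [f [w [gV rV Gf Ow Vfw]]]] kmin.
  exists w, f; split=> //; have [h [Gh fK hK]] := base_act_inv Gf.
  exists V; split=> //; exists (base_act h @^-1` O); split.
  + by apply: open_comp => // y _; exact: base_act_continuous.
  + by rewrite /= fK.
  + move=> V' f' y gV' lt Gf' Oy V'y.
    have : (k <= rk V')%N.
      apply: kmin; apply/asboolP; exists V', (f' \o f), (base_act h y); split=> //.
        exact: Gam_comp.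
      by rewrite base_act_comp // hK.
    by rewrite leqNgt -rV lt.
Qed.

Section open_submanifold.
Variables (B : set M2) (e : M2 -> B).
Hypotheses (oB : open B) (eB : forall v, B v -> sval (e v) = v).

(** An open subset as an etale quotient of itself; e is any retraction. *)
Lemma open_etale : etale g2 B e.
Proof.
have esval y : e (sval y) = y.
  by apply: set_type_eq; rewrite eB //; exact/set_mem/(svalP y).
have [_ _ /preserves_metricP Ig2] := mg2.
split=> //.
- move=> v /set_mem Bv W; rewrite nbhsE => -[_ [[U oU <-] Uv] UW].
  have Uv' : U v by rewrite -(eB Bv).
  apply: filterS (open_nbhs_nbhs (conj (openI oU oB) (conj Uv' Bv))) => z [Uz Bz].
  by apply: UW; rewrite /= /set_val /= eB.
- move=> U oU UB; exists U => //; apply/seteqP; split=> [y Uy|_ [v Uv <-]].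
    by exists (sval y).
  by rewrite /= /set_val /= eB //; exact: UB.
- by move=> y; exists (sval y) => //; exact/set_mem/(svalP y).
- move=> v Bv; exists B; split=> // x y /set_mem Bx /set_mem By exy.
  by rewrite -(eB Bx) -(eB By) exy.
- move=> x y Bx By exy; have xy : x = y by rewrite -(eB Bx) -(eB By) exy.
  exists (fun z => z); split=> //; first exact: smooth_at_id M2_atlas.
    exact: Ig2.
  by apply: filterS (open_nbhs_nbhs (conj oB Bx)) => z Bz.
Qed.

Lemma open_hausdorff_manifold : hausdorff_manifold (etale_quotient open_etale).
Proof.
have [[[_ _ _ sc] hM] _ _] := cM2.
have [h1 h2 h3] : smooth_atlas (etale_quotient open_etale) := etale_smooth_atlas M2_atlas open_etale.
split; last exact: hausdorff_subtype.
by split=> //; exact: second_countable_subtype.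
Qed.

End open_submanifold.

(** When M2 is a point l2 need not be invariant, but it does not enter the metric
    and can be replaced by 1. *)
Lemma fibre_warping b0 : exists m2 : fibre_manifold b0 -> R,
  positive_smooth m2 /\ forall a, n2 = 0%N \/ m2 (fibre_proj b0 a) = l2 a.
Proof.
have [l2p l2s] := pl2.
have [n20|n20] := eqVneq n2 0%N.
  exists (fun _ => 1); split; last by left.
  split=> //; apply: (etale_smooth_function M1_atlas (w := fun _ => 1)) => //.
  by move=> i; apply: smooth_on_cst; case: (atlas_chart M1_atlas i).
have /choice[m2 m2P] : forall y : fibre_manifold b0, exists t, forall a, fibre_proj b0 a = y -> t = l2 a.
  move=> y; have [a _ <-] := etale_surj (fibre_etale b0) y.
  exists (l2 a) => a' /esym/fibre_proj_fibre[f Gf [fid fa]].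
  have [_ _ [n0|]] := vertical_isometry b0 a Gf fid; first by rewrite n0 eqxx in n20.
  by rewrite fa.
have m2E a : m2 (fibre_proj b0 a) = l2 a by exact: m2P.
exists m2; split; last by right.
split; first by move=> y; have [a _ <-] := etale_surj (fibre_etale b0) y; rewrite m2E.
by apply: (etale_smooth_function M1_atlas (w := l2)).
Qed.

Lemma open_dense_warped_product : exists W : set M, [/\ open W, dense W &
     exists (A : charted R n1) (gA : metric_field A)
            (B : charted R n2) (gB : metric_field B)
            (m1 : B -> R) (m2 : A -> R),
       [/\ hausdorff_manifold A /\ metric_tensor gA,
           hausdorff_manifold B /\ metric_tensor gB,
           positive_smooth m1, positive_smooth m2 &
           exists f : prod_charted A B -> M,
             sr_isometry (doubly_warped gA gB m1 m2) setT g W f]].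
Proof.
have [_ _ [b0 _]] := cM2.
have [B [oB eB dB]] := fundamental_domain.
pose D : set X := [set: M1] `*` B.
have oD : open D := open_rectangle openT oB.
exists (q @` D); split; first exact: q_open.
  move=> O [y Oy] oO; have [[a b] qy] := q_surj y.
  have ca : continuous (fun b => q (a, b)).
    move=> v; apply: (@continuous_comp _ _ _ (fun b => (a, b) : X) q); last exact: q_continuous.
    by apply: pair_continuous; [exact: cst_continuous | exact: cvg_id].
  have oO' : open ((fun b => q (a, b)) @^-1` O) by apply: open_comp => // v _; exact: ca.
  have [|v [f [Ov Gf Bv]]] := dB _ oO'; first by exists b; rewrite /= qy.
  exists (q (a, v)); split=> //; exists (f (a, v)); last exact: q_Gam.
  by split=> //=; rewrite base_actE.
have [v0 [f0 [_ _ Bv0]]] := dB setT openT (ex_intro _ b0 I).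
have /choice[e eP] : forall v, exists y : B, B v -> sval y = v.
  move=> v; have [Bv|nBv] := pselect (B v); first by exists (exist _ v (mem_set Bv)).
  by exists (exist _ (base_act f0 v0) (mem_set Bv0)).
pose N := fibre_manifold b0; pose Be := etale_quotient (open_etale oB eP).
have [m2 [m2p m2E]] := fibre_warping b0.
pose gN : metric_field N := etale_metric (eE := fibre_etale b0).
pose gB : metric_field Be := etale_metric (eE := open_etale oB eP).
pose m1 : Be -> R := fun y => l1 (sval y).
exists N, gN, Be, gB, m1, m2.
have aN := fibre_atlas b0.
have aB : smooth_atlas Be := etale_smooth_atlas M2_atlas (open_etale oB eP).
have aNB := prod_smooth_atlas aN aB.
have [l1p l1s] := pl1.
split=> //.
- split; first exact: fibre_hausdorff_manifold.
  exact: (etale_metric_tensor M1_atlas (fibre_etale b0) mg1).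
- split; first exact: open_hausdorff_manifold.
  exact: (etale_metric_tensor M2_atlas (open_etale oB eP) mg2).
- split; first by move=> y; exact: l1p.
  by apply: (etale_smooth_function M2_atlas (w := l1)) => // v Bv; rewrite /m1 eP.
pose p : X -> prod_charted N Be := map_prod (fibre_proj b0 : M1 -> N) (e : M2 -> Be).
have dp z : D z -> local_diffeo p z.
  move=> [_ Bz]; apply: (local_diffeo_prod M1_atlas aN M2_atlas aB).
    exact: fibre_proj_local_diffeo.
  exact: (etale_local_diffeo M2_atlas (open_etale oB eP)).
have pfib z z' : D z -> D z' -> p z = p z' <-> q z = q z'.
  move=> [_ Bz] [_ Bz']; apply: iff_sym; apply: (iff_trans (cylinder_fibre b0 eB Bz Bz')).
  split=> [[e1 e2]|ez]; first by rewrite /p /map_prod e1 e2.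
  split; first exact: (congr1 fst ez).
  by rewrite -(eP _ Bz) -(eP _ Bz'); congr sval; exact: (congr1 snd ez).
have psurj w : exists2 z, D z & p z = w.
  case: w => y y'; have [a _ <-] := etale_surj (fibre_etale b0) y.
  have [v Bv <-] := etale_surj (open_etale oB eP) y'.
  by exists (a, v).
have /choice[F FP] : forall w, exists m, forall z, D z -> p z = w -> q z = m.
  move=> w; have [z Dz <-] := psurj w; exists (q z) => z' Dz' e'.
  by apply/(pfib z' z).
have FE z : D z -> F (p z) = q z by move=> Dz; rewrite (FP (p z) z).
exists F; split.
  have -> : [set: prod_charted N Be] = p @` D.
    by apply/seteqP; split=> // w _; have [z Dz <-] := psurj w; exists z.
  apply: diffeomorphism_of_fibres => //.
  - exact: product_atlas.
  - exact: M_atlas.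
  - by exists (a0, base_act f0 v0).
  - by move=> z _; have [] := q_local z.
apply/preserves_metricP => w _; have [z Dz <-] := psurj w.
have [sp [h [sh hp ph]]] := dp z Dz; have [_ Bz] := Dz.
have hz : h (p z) = z := nbhs_singleton hp.
have Ip : isometric_at gX (doubly_warped gN gB m1 m2) p z.
  apply: (isometric_at_prod M1_atlas aN M2_atlas aB).
  - by have [] := fibre_proj_local_diffeo b0 z.1.
  - by have [] := etale_local_diffeo M2_atlas (open_etale oB eP) Bz.
  - have I1 := @etale_isometric_at _ _ _ _ _ _ _ M1_atlas (fibre_etale b0) z.1 I; exact: I1.
  - have I2 := @etale_isometric_at _ _ _ _ _ _ _ M2_atlas (open_etale oB eP) z.2 Bz; exact: I2.
  - by rewrite /m1 eP.
  - exact: m2E.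
have Ih := isometric_at_inverse product_atlas aNB sp sh hp Ip.
have sq := q_smooth (h (p z)); have [_ Iq] := q_local (h (p z)).
apply: (isometric_at_eq aNB M_atlas (smooth_at_comp aNB product_atlas M_atlas sh sq)).
  have N1 := continuous_near (smooth_at_continuous sh) hz (open_nbhs_nbhs (conj oD Dz)).
  by apply: filterS2 N1 ph => w' Dw' {2}<-; rewrite /= FE.
exact: (isometric_at_comp aNB product_atlas M_atlas sh sq Ih Iq).
Qed.

(** * Fundamental groups *)

Lemma pi1_leaf b (x : M) (xF : x \in leaf F1 x) : q (a0, b) = x ->
  let i : fundamental_group R (exist _ x xF : leaf F1 x) -> fundamental_group R x :=
    pi1_map (@leaf_inclusion_continuous M (leaf F1 x)) (exist _ x xF) in
  let eta : fundamental_group R x -> fundamental_group R (leaf_proj F1 x) :=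
    pi1_map (@leaf_proj_continuous M F1) x in
  injective i /\
  exists2 N : normal_subgroup (fundamental_group R x), normal_set N = range i &
    exists theta : quotient_group N -> fundamental_group R (leaf_proj F1 x),
      [/\ bijective theta, {morph theta : a b / (a * b)%g} &
          forall u, theta (\pi_(quotient_group N) u) = eta u].
Proof.
move=> qx; have lx : leaf F1 x = fibre b by rewrite /fibre qx.
have F_slice a : leaf F1 x (q (a, b)) by rewrite lx; exact: fibre_q.
have eta_F y : leaf F1 x y -> leaf_proj F1 y = base_proj b.
  by rewrite lx /fibre leaf_base.
have deck b' : base_proj b' = base_proj b -> exists (a : M1) (alpha : R -> M1),
  [/\ continuous alpha, forall t, t <= 0 -> alpha t = a0,
      forall t, 1 <= t -> alpha t = a & q (a, b') = q (a0, b)].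
  move=> /esym/base_proj_fibre[f Gf fb].
  have [al [ca al0 al1]] := connected_manifold_joined a0 (f (a0, b)).1 cM1.
  exists (f (a0, b)).1, al; split=> //.
  by rewrite -fb /base_act -surjective_pairing q_Gam.
exact: (pi1_exact q_covering base_proj_covering hausdorff1 hausdorff2
  (@leaf_proj_continuous M F1) base_projE F_slice eta_F deck xF qx).
Qed.

End quotient_geometry.

Theorem theorem4p7 (R : realType) (n1 n2 : nat)
  (M1 : charted R n1) (g1 : metric_field M1)
  (M2 : charted R n2) (g2 : metric_field M2)
  (l1 : M2 -> R) (l2 : M1 -> R)
  (Gam : set (prod_charted M1 M2 -> prod_charted M1 M2))
  (M : charted R (n1 + n2)) (g : metric_field M)
  (q : prod_charted M1 M2 -> M)
  (F1 := image_foliation q (@canonical_foliation1 M1 M2)) :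
  connected_manifold M1 -> metric_tensor g1 ->
  connected_manifold M2 -> metric_tensor g2 ->
  positive_smooth l1 -> positive_smooth l2 ->
  isometry_group (doubly_warped g1 g2 l1 l2) Gam ->
  properly_discontinuous Gam ->
  (forall f, Gam f -> preserves_foliation (@canonical_foliation1 M1 M2) f /\
                      preserves_foliation (@canonical_foliation2 M1 M2) f) ->
  connected_manifold M -> metric_tensor g ->
  quotient_map (doubly_warped g1 g2 l1 l2) Gam g q ->
  regular_foliation F1 ->
  ([/\ smooth_manifold (leaf_manifold F1),
       fiber_bundle (leaf_proj F1 : M -> leaf_manifold F1) &
       forall (x : M) (xF : x \in leaf F1 x),
         let i : fundamental_group R (exist _ x xF : leaf F1 x) ->
                 fundamental_group R x :=
           pi1_map (@leaf_inclusion_continuous M (leaf F1 x)) (exist _ x xF) in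
         let eta : fundamental_group R x ->
                   fundamental_group R (leaf_proj F1 x) :=
           pi1_map (@leaf_proj_continuous M F1) x in
         injective i /\
         exists2 N : normal_subgroup (fundamental_group R x),
           normal_set N = range i &
           exists theta : quotient_group N ->
                          fundamental_group R (leaf_proj F1 x),
             [/\ bijective theta,
                 {morph theta : a b / (a * b)%g} &
                 forall u, theta (\pi_(quotient_group N) u) = eta u]]
   /\
   exists W : set M, [/\ open W, dense W &
     exists (A : charted R n1) (gA : metric_field A)
            (B : charted R n2) (gB : metric_field B)
            (m1 : B -> R) (m2 : A -> R),
       [/\ hausdorff_manifold A /\ metric_tensor gA,
           hausdorff_manifold B /\ metric_tensor gB,
           positive_smooth m1, positive_smooth m2 &
           exists f : prod_charted A B -> M,
             sr_isometry (doubly_warped gA gB m1 m2) setT g W f]]).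
Proof.
move=> cM1 mg1 cM2 mg2 pl1 pl2 isoG _ folG cM mg qM regF.
have [_ _ [a0 _]] := cM1.
split; last exact: (open_dense_warped_product cM1 cM2 cM mg1 mg2 pl1 pl2 isoG folG qM regF a0).
split.
- exact: (leaf_manifold_smooth cM1 cM2 cM isoG folG qM regF a0).
- exact: (leaf_fiber_bundle cM1 cM2 cM mg2 pl1 pl2 isoG folG qM regF a0).
- move=> x xF; have [[a b] qx] := q_surj qM x.
  exact: (pi1_leaf cM1 cM2 cM isoG folG qM regF xF qx).
Qed.
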